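(* The following identity of Hopf algebra homomorphisms $\mathrm{Peak}\to\mathcal K$ holds: $$\mathrm{Res}_{\mathcal H}^{\mathcal{HC}}\circ\widetilde{\mathrm{Ch}}^*=\mathrm{Ch}^*\circ\bar\varphi\circ i\circ\varphi ,$$ where $i:\mathrm{Peak}\to\mathrm{NSym}$ is the inclusion (equivalently, ${}^{\bar\varphi}\mathrm{Res}_{\mathcal H}^{\mathcal{HC}}\circ\widetilde{\mathrm{Ch}}^*=\mathrm{Ch}^*\circ i\circ\varphi$). Equivalently, for every composition $\alpha\vDash n$, in $\mathcal K$, $$[\mathrm{Res}_{\mathcal H}^{\mathcal{HC}}\tilde P_\alpha]=\sum_{\beta\vDash n,\;P(\beta)\subseteq D(\bar\alpha)\triangle(D(\bar\alpha)+1)}2^{|P(\beta)|+1}\,[P_{\bar\beta}].$$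
   Context: $\mathbb K$ is an algebraically closed field of characteristic $0$; all Hopf algebras and Grothendieck groups below are taken with scalars extended to $\mathbb K$. Combinatorics. For a composition $\alpha=(\alpha_1,\dots,\alpha_r)\vDash n$: $\ell(\alpha)=r$, $D(\alpha)=\{\alpha_1,\alpha_1+\alpha_2,\dots,\alpha_1+\cdots+\alpha_{r-1}\}\subseteq[n-1]$, $\bar\alpha=(\alpha_r,\dots,\alpha_1)$, $P(\alpha)=\{x\in[2,n-1]:x-1\notin D(\alpha),x\in D(\alpha)\}$. $\alpha\le\beta$ iff $D(\beta)\subseteq D(\alpha)$. $D+1=\{x+1:x\in D\}$; $\triangle$ is symmetric difference. A peak set in $[n]$ is $P\subseteq[2,n-1]$ with $i\in P\Rightarrow i-1\notin P$. Hopf algebras. $\mathrm{NSym}$ is the free associative algebra on $H_n$ ($n\ge1$), $H_0=1$, $\Delta(H_n)=\sum_kH_k\otimes H_{n-k}$; $E_n$ is defined by $\sum_{i=0}^n(-1)^iE_iH_{n-i}=\delta_{n,0}$; $H_\beta=H_{\beta_1}\cdots H_{\beta_r}$; $R_\alpha=\sum_{\beta\ge\alpha}(-1)^{\ell(\beta)-\ell(\alpha)}H_\beta$. $\mathrm{QSym}$ is its graded dual, with fundamental basis $F_\alpha$ dual to $R_\alpha$. $Q_n=\sum_{k=0}^nE_kH_{n-k}$; $\mathrm{Peak}\subseteq\mathrm{NSym}$ is the Hopf subalgebra generated by the $Q_n$, with basis $\Xi_P=\sum_{P(\alpha)=P}R_\alpha$. $\Theta:\mathrm{NSym}\to\mathrm{Peak}$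 is the Hopf epimorphism $H_n\mapsto Q_n$. $\mathrm{Peak}^*\subseteq\mathrm{QSym}$ is spanned by the basis $K_P=2^{|P|+1}\sum_{\alpha\vDash n,\,P\subseteq D(\alpha)\triangle(D(\alpha)+1)}F_\alpha$ ($P$ a peak set in $[n]$) and is dual to Peak via $[\Xi_P,K_Q]=\delta_{P,Q}$. $\bar\varphi:\mathrm{NSym}\to\mathrm{NSym}$ is the algebra anti-involution with $\bar\varphi(H_n)=H_n$ (so $\bar\varphi(R_\alpha)=R_{\bar\alpha}$); since it preserves $\ker\Theta$, it induces an anti-involution $\varphi$ of $\mathrm{Peak}$ determined by $\varphi\circ\Theta=\Theta\circ\bar\varphi$. Algebras. The 0-Hecke algebra $\mathcal H_n$ is generated by $T_1,\dots,T_{n-1}$ with $T_i^2=-T_i$, $T_iT_j=T_jT_i$ for $|i-j|>1$, $T_iT_{i+1}T_i=T_{i+1}T_iT_{i+1}$. The 0-Hecke-Clifford superalgebra $\mathcal{HC}_n$ is generated by even $T_1,\dots,T_{n-1}$ satisfying these relations and odd $c_1,\dots,c_n$ with $c_i^2=-1$, $c_ic_j=-c_jc_i$ ($i\ne j$), $T_ic_j=c_jT_i$ ($j\neq i,i+1$), $T_ic_i=c_{i+1}T_i$, $(T_i+1)c_{i+1}=c_i(T_i+1)$. Modules. For $\alpha\vDash n$, $S_\alpha=\mathbb K\eta_\alpha$ is the simple $\mathcal H_n$-module with $T_i\eta_\alpha=-\eta_\alpha$ if $i\in D(\alpha)$ and $0$ otherwise; $P_\alpha$ is its projective cover; $\tilde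 S_\alpha=\mathrm{Ind}_{\mathcal H_n}^{\mathcal{HC}_n}S_\alpha$, $\tilde P_\alpha=\mathrm{Ind}_{\mathcal H_n}^{\mathcal{HC}_n}P_\alpha$. Grothendieck groups. $\mathcal K=\bigoplus_nK_0(\mathcal H_n\text{-pmod})$; $\widetilde{\mathcal K}=\bigoplus_nK_0(\mathcal{HC}_n\text{-pmod})$, $\widetilde{\mathcal G}=\bigoplus_nK_0(\mathcal{HC}_n\text{-mod})$ (finitely generated projective, resp. all finitely generated, supermodules; relations from even short exact sequences and $[M]=[\Pi M]$, $\Pi$ the parity change). They are graded Hopf algebras, product by induction along $\mathcal{HC}_m\otimes\mathcal{HC}_n\subseteq\mathcal{HC}_{m+n}$ (resp. $\mathcal H_m\otimes\mathcal H_n\subseteq\mathcal H_{m+n}$), coproduct by restriction. $\mathrm{Res}_{\mathcal H}^{\mathcal{HC}}:\widetilde{\mathcal K}\to\mathcal K$ is induced by restriction along $\mathcal H_n\subseteq\mathcal{HC}_n$; ${}^{\bar\varphi}\mathrm{Res}_{\mathcal H}^{\mathcal{HC}}$ is this restriction followed by twisting $\mathcal H_n$-modules by the automorphism $T_i\mapsto T_{n-i}$ of $\mathcal H_n$. Pairing: $\langle[P],[M]\rangle=\dim_{\mathbb K}\mathrm{Hom}_{\mathcal{HC}_n}(P,M)$ (even and odd morphisms) on $\widetilde{\mathcal K}\times\widetilde{\mathcal G}$ in equal degree, $0$ otherwise. $\mathrm{Ch}^*:\mathrm{NSym}\to\mathcal K$ is the Hopf isomorphism $R_\alpha\mapsto[P_\alpha]$;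 $\widetilde{\mathrm{Ch}}:\widetilde{\mathcal G}\to\mathrm{Peak}^*$ is the Hopf isomorphism $[\tilde S_\alpha]\mapsto K_{P(\alpha)}$; $\widetilde{\mathrm{Ch}}^*:\mathrm{Peak}\to\widetilde{\mathcal K}$ is the adjoint Hopf isomorphism defined by $[F,\widetilde{\mathrm{Ch}}([M])]=\langle\widetilde{\mathrm{Ch}}^*(F),[M]\rangle$.
   Formalization: The explicit formula is stated for n ≥ 1 only (for n = 0 it would read [K] = 2[K]); in degree 0, K_∅ is taken to be 1 without the factor 2; the identities are stated as equalities of maps, their being Hopf homomorphisms left as background. *)

(* Defs.v *)
From HB Require Import structures.
From mathcomp Require Import all_boot all_order all_algebra.
From mathcomp Require Import zify boolp.
From mathcomp Require Import finmap.
From mathcomp.multinomials Require Import monalg.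

Set Implicit Arguments.
Unset Strict Implicit.
Unset Printing Implicit Defensive.

Import GRing.Theory.
Local Open Scope ring_scope.
Local Open Scope quotient_scope.

(* A composition is a word in the positive integers, i.e. an element of the
   free monoid on them: concatenation is the product of the free monoid. *)
Definition posnat := {m : nat | (0 < m)%N}.
Notation composition := {fmonom posnat}.

Definition parts (a : composition) : seq nat := map val (fmonom_val a).
Definition weight (a : composition) : nat := sumn (parts a).

Record compn (n : nat) := Comp { comp_val : composition; _ : weight comp_val == n }.
HB.instance Definition _ n := [isSub for @comp_val n].
HB.instance Definition _ n := [Choice of compn n by <:].

Definition clen n (a : compn n) : nat := size (parts (val a)).

Definition seq_comp (s : seq nat) : composition :=
  FMonom (pmap (insub : nat -> option posnat) s).

Lemma seq_compK (a : composition) : seq_comp (parts a) = a.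
Proof.
case: a => s; rewrite /seq_comp /parts /=; congr FMonom.
by elim: s => //= x s IH; rewrite valK /= IH.
Qed.

Definition comp_code n (a : compn n) : {ffun 'I_n -> 'I_n.+1} :=
  [ffun i : 'I_n => inord (nth 0%N (parts (val a)) i)].
Definition comp_decode n (f : {ffun 'I_n -> 'I_n.+1}) : option (compn n) :=
  insub (seq_comp [seq val (f i) | i <- enum 'I_n]).

Lemma comp_codeK n : pcancel (@comp_code n) (@comp_decode n).
Proof.
move=> a; rewrite /comp_decode.
suff -> : seq_comp [seq val (comp_code a i) | i <- enum 'I_n] = val a
  by rewrite valK.
set p := parts (val a); have wa : sumn p = n by exact/eqP/(valP a).
have p0 : all (leq 1) p.
  by rewrite /p /parts; case: (val a) => s /=; elim: s => //= x s ->; rewrite (valP x).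
have sz : (size p <= n)%N.
  rewrite -wa; elim: p p0 {wa} => //= x s IH /andP[x0 /IH h].
  by rewrite -add1n leq_add.
have -> : [seq val (comp_code a i) | i <- enum 'I_n]
          = p ++ nseq (n - size p) 0%N.
  have e i : nth 0%N p i = nth 0%N (p ++ nseq (n - size p) 0%N) i.
    by rewrite nth_cat nth_nseq if_same; case: ltnP => // h; rewrite nth_default.
  apply: (@eq_from_nth _ 0%N).
    by rewrite size_map size_enum_ord size_cat size_nseq subnKC.
  move=> i; rewrite size_map size_enum_ord => lt_in.
  rewrite -e // (nth_map (Ordinal lt_in)) ?size_enum_ord //.
  rewrite ffunE /= nth_enum_ord // inordK // ltnS -[X in (_ <= X)%N]wa -/p.
  elim: (p) i {lt_in} => [|x s IH] [|i] //=; first exact: leq_addr.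
  by rewrite (leq_trans (IH i)) ?leq_addl.
rewrite -[RHS]seq_compK /seq_comp pmap_cat; congr FMonom.
rewrite -[RHS]cats0; congr (_ ++ _).
by elim: (n - _)%N => //= m ->; rewrite insubF.
Qed.
HB.instance Definition _ n := PCanIsCountable (@comp_codeK n).
HB.instance Definition _ n : isFinite (compn n) := PCanIsFinite (@comp_codeK n).

Lemma crev_subproof n (a : compn n) :
  weight (FMonom (rev (fmonom_val (val a)))) == n.
Proof.
by rewrite /weight /parts /= map_rev sumn_rev; exact: (valP a).
Qed.
Definition crev n (a : compn n) : compn n := Comp (crev_subproof a).

Definition partial_sums n (a : compn n) : seq nat :=
  [seq sumn (take i (parts (val a))) | i <- iota 1 (clen a).-1].

(* Subsets of {0, ..., n} are used for all the subsets of [n] at stake. *)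
Definition D n (a : compn n) : {set 'I_n.+1} :=
  [set x : 'I_n.+1 | (x : nat) \in partial_sums a].

(* For 1 < x < n, inord x.-1 is x - 1. *)
Definition peaks n (a : compn n) : {set 'I_n.+1} :=
  [set x : 'I_n.+1 | [&& (1 < x < n)%N, inord x.-1 \notin D a & x \in D a]].

Definition peak_set n (P : {set 'I_n.+1}) : bool :=
  [forall x in P, (1 < x < n)%N && (inord x.-1 \notin P)].

Definition shift1 n (A : {set 'I_n.+1}) : {set 'I_n.+1} :=
  [set x : 'I_n.+1 | [exists y in A, (x : nat) == y.+1]].

Definition symdiff (T : finType) (A B : {set T}) : {set T} :=
  (A :\: B) :|: (B :\: A).

Definition DD n (a : compn n) : {set 'I_n.+1} := symdiff (D a) (shift1 (D a)).

Section LinearSpan.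
Variables (K : fieldType) (V : lmodType K).

Inductive lspan (S : V -> Prop) : V -> Prop :=
| lspan0 : lspan S 0
| lspanD a u v of S u & lspan S v : lspan S (a *: u + v).

Definition lspanb (S : V -> Prop) : pred V := fun x => `[< lspan S x >].

Lemma lspan_closed S : submod_closed (lspanb S).
Proof.
split; first by apply/asboolP; exact: lspan0.
move=> a u v /asboolP su /asboolP sv; apply/asboolP.
elim: su => [|b w z Sw _ IH]; first by rewrite scaler0 add0r.
by rewrite scalerDr scalerA -addrA; exact: lspanD.
Qed.
HB.instance Definition _ S := GRing.isSubmodClosed.Build K V (lspanb S)
  (lspan_closed S).

Lemma lspan_gen (S : V -> Prop) u : S u -> u \in lspanb S.
Proof.
by move=> Su; apply/asboolP; rewrite -[u]addr0 -[u]scale1r; apply: lspanD => //; exact: lspan0.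
Qed.

End LinearSpan.

Section LinearExtension.
Variables (K : fieldType) (X : choiceType) (V : lmodType K).

Definition lext (f : X -> V) (u : {malg K[X]}) : V :=
  \sum_(x <- msupp u) u@_x *: f x.

Lemma lextw f u (d : {fset X}) : (msupp u `<=` d)%fset ->
  lext f u = \sum_(x <- d) u@_x *: f x.
Proof.
move=> le_ud; rewrite /lext (big_fset_incl _ le_ud) // => x _ xu.
by rewrite mcoeff_outdom // scale0r.
Qed.

Lemma lext_linear f : linear (lext f).
Proof.
move=> a u v; set d := (msupp u `|` msupp v)%fset.
have hu : (msupp u `<=` d)%fset by exact: fsubsetUl.
have hv : (msupp v `<=` d)%fset by exact: fsubsetUr.
have huv : (msupp (a *: u + v) `<=` d)%fset.
  apply: (fsubset_trans (msuppD_le _ _)).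
  by apply: fsetSU; exact: msuppZ_le.
rewrite (lextw _ hu) (lextw _ hv) (lextw _ huv) scaler_sumr -big_split /=.
by apply: eq_bigr => x _; rewrite mcoeffD mcoeffZ scalerDl scalerA.
Qed.
HB.instance Definition _ f :=
  GRing.isLinear.Build K {malg K[X]} V *:%R (lext f) (lext_linear f).

Lemma lextU f x : lext f << x >> = f x.
Proof.
rewrite (@lextw _ _ [fset x]%fset) ?msuppU_le // big_seq_fset1.
by rewrite mcoeffUU scale1r.
Qed.

End LinearExtension.

(* The free algebra on the positive integers; << a >> is H_a. *)
Definition NSym (K : fieldType) := {malg K[composition]}.

Section NSym.
Variable K : fieldType.
Local Notation NSym := (NSym K).

Definition Hcomp n (a : compn n) : NSym := << val a >>.

(* the generators; H 0 = 1 *)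
Definition H (n : nat) : NSym :=
  if (insub n : option posnat) is Some m then << FMonom [:: m] >> else 1.

(* The sum is over the b >= a; the sign is that of (-1)^(l(b) - l(a)). *)
Definition Rib n (a : compn n) : NSym :=
  \sum_(b : compn n | D b \subset D a) (-1) ^+ (clen b + clen a) *: Hcomp b.

(* [:: E 0; ...; E n] *)
Fixpoint Eseq (n : nat) : seq NSym :=
  if n is m.+1 then
    rcons (Eseq m) (- ((-1) ^+ n * \sum_(i < n) (-1) ^+ i * (Eseq m)`_i * H (n - i)))
  else [:: 1].
Definition E (n : nat) : NSym := (Eseq n)`_n.

Lemma E_def n :
  \sum_(i < n.+1) (-1) ^+ i * E i * H (n - i) = (n == 0%N)%:R.
Proof.
have sz m : size (Eseq m) = m.+1 by elim: m => //= m IH; rewrite size_rcons IH.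
have En m i : (i <= m)%N -> (Eseq m)`_i = E i.
  elim: m => [|m IH]; first by rewrite leqn0 => /eqP ->.
  rewrite leq_eqVlt => /orP[/eqP-> //|]; rewrite ltnS => le_im.
  by rewrite /= nth_rcons sz ltnS le_im IH.
have H0 : H 0 = 1 by rewrite /H insubF.
case: n => [|n]; first by rewrite big_ord1 /= subn0 H0 /E /= !mulr1.
rewrite big_ord_recr /= subnn H0 mulr1.
rewrite {2}/E /= nth_rcons sz ltnn eqxx mulrN mulrA -expr2 -exprM muln2.
rewrite -signr_odd odd_double expr0 mul1r; apply/eqP; rewrite subr_eq0.
by apply/eqP/eq_bigr => i _; rewrite En // -ltnS.
Qed.

Definition Q (n : nat) : NSym := \sum_(k < n.+1) E k * H (n - k).

(* The subalgebra generated by the Q n; as Delta(Q_n) is the sum of the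
   Q_k (x) Q_(n-k), it is also the Hopf subalgebra they generate. *)
Inductive in_Peak : NSym -> Prop :=
| in_Peak_gen n : in_Peak (Q n)
| in_Peak1 : in_Peak 1
| in_Peak0 : in_Peak 0
| in_PeakL a u v of in_Peak u & in_Peak v : in_Peak (a *: u + v)
| in_PeakM u v of in_Peak u & in_Peak v : in_Peak (u * v).

Definition in_Peakb : pred NSym := fun x => `[< in_Peak x >].
Lemma in_Peak_closed : submod_closed in_Peakb.
Proof.
split; first by apply/asboolP; exact: in_Peak0.
by move=> a u v /asboolP su /asboolP sv; apply/asboolP; exact: in_PeakL.
Qed.
HB.instance Definition _ :=
  GRing.isSubmodClosed.Build K NSym in_Peakb in_Peak_closed.

Record Peak := MkPeak { Peak_val : NSym; _ : in_Peakb Peak_val }.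
HB.instance Definition _ := [isSub for Peak_val].
HB.instance Definition _ := [Choice of Peak by <:].
HB.instance Definition _ := [SubChoice_isSubLmodule of Peak by <:].

(* the algebra morphism H_n |-> Q_n, see thetaM and theta_H *)
Definition theta : NSym -> NSym :=
  lext (fun a : composition => \prod_(m <- parts a) Q m).

Lemma theta_in_Peak h : in_Peakb (theta h).
Proof.
rewrite -[in_Peakb _]/(theta h \in in_Peakb); apply: rpred_sum => a _.
apply: rpredZ; apply/asboolP; apply: big_ind => [|u v|n _].
- exact: in_Peak1.
- exact: in_PeakM.
- exact: in_Peak_gen.
Qed.
Definition Theta (h : NSym) : Peak := MkPeak (theta_in_Peak h).

(* the algebra anti-involution fixing the H_n, see phibarM and phibar_H *)
Definition phibar : NSym -> NSym :=
  lext (fun a : composition => << FMonom (rev (fmonom_val a)) >>).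

Lemma nsym_scalerAr (c : K) (u v : NSym) : u * (c *: v) = c *: (u * v).
Proof.
have central w : w * c%:MP = c *: w :> NSym.
  rewrite malgM_def fgmulgU malgZ_def; apply: eq_bigr => k _.
  by rewrite mulm1 mulrC.
by rewrite -mul_malgC mulrA central -scalerAl.
Qed.

Lemma lextM (f : composition -> NSym) (op : NSym -> NSym -> NSym) :
  (forall x, additive (op x)) -> (forall y, additive (op^~ y)) ->
  (forall c x y, op (c *: x) y = c *: op x y) ->
  (forall c x y, op x (c *: y) = c *: op x y) ->
  (forall a b : composition, f (mmul a b) = op (f a) (f b)) ->
  forall u v, lext f (u * v) = op (lext f u) (lext f v).
Proof.
move=> opr opl opZl opZr fM u v.
have sumr I (s : seq I) x (g : I -> NSym) :
    op x (\sum_(i <- s) g i) = \sum_(i <- s) op x (g i).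
  have o0 : op x 0 = 0 by have := opr x 0 0; rewrite !subrr.
  have oD : {morph op x : y z / y + z >-> y + z}; last exact: (big_morph _ oD o0).
  move=> y z; have oN : op x (- z) = - op x z by rewrite -[- z]sub0r opr o0 sub0r.
  by rewrite -{1}[z]opprK opr oN opprK.
have suml I (s : seq I) y (g : I -> NSym) :
    op (\sum_(i <- s) g i) y = \sum_(i <- s) op (g i) y.
  have o0 : op 0 y = 0 by have := opl y 0 0; rewrite !subrr.
  have oD : {morph op^~ y : x z / x + z >-> x + z}; last exact: (big_morph _ oD o0).
  move=> x z /=; have oN : op (- z) y = - op z y by rewrite -[- z]sub0r opl o0 sub0r.
  by rewrite -{1}[z]opprK opl oN opprK.
rewrite malgME linear_sum {2}/lext suml; apply: eq_bigr => a _.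
rewrite linear_sum sumr; apply: eq_bigr => b _.
have UZ (c : K) k : << c *g k >> = c *: << k >> :> NSym.
  by apply/malgP => k'; rewrite mcoeffZ !mcoeffU mulrnAr mulr1.
by rewrite UZ linearZ /= lextU fM opZl opZr scalerA.
Qed.

Lemma H_gen (m : posnat) : H (val m) = << FMonom [:: m] >>.
Proof. by rewrite /H valK. Qed.

Lemma thetaM u v : theta (u * v) = theta u * theta v.
Proof.
apply: (lextM (op := *%R)) => [x y z|y x z|c x y|c x y|a b].
- exact: mulrBr.
- exact: mulrBl.
- by rewrite scalerAl.
- exact: nsym_scalerAr.
- by rewrite /mmul /= fmmulE /parts /= map_cat big_cat.
Qed.

Lemma theta_H (m : posnat) : theta (H (val m)) = Q (val m).
Proof. by rewrite H_gen /theta lextU /parts /= big_seq1. Qed.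

Lemma phibarM u v : phibar (u * v) = phibar v * phibar u.
Proof.
apply: (lextM (op := fun x y => y * x)) => [x y z|y x z|c x y|c x y|a b].
- exact: mulrBl.
- exact: mulrBr.
- exact: nsym_scalerAr.
- by rewrite scalerAl.
- by rewrite /mmul /= malgM_def fgmulUU mulr1 /mmul /= !fmmulE /= rev_cat.
Qed.

Lemma phibar_H (m : posnat) : phibar (H (val m)) = H (val m).
Proof. by rewrite H_gen /phibar lextU. Qed.

Definition Xi n (P : {set 'I_n.+1}) : NSym :=
  \sum_(a : compn n | peaks a == P) Rib a.

(* The graded dual of NSym, as the space with basis F_a: its homogeneous
   components are finite-dimensional, so that the F_a dual to the R_a form a
   basis. *)
Definition QSym := {malg K[{n : nat & compn n}]}.
Definition F n (a : compn n) : QSym := << Tagged compn a >>.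

(* In degree 0, K_emptyset is the unit of QSym, so that the factor
   2 ^ (|P| + 1) is only there for n > 0. *)
Definition KP n (P : {set 'I_n.+1}) : QSym :=
  (if n == 0%N then 1 else 2%:R ^+ (#|P| + 1)) *:
    \sum_(a : compn n | P \subset DD a) F a.

Definition is_KP (x : QSym) : Prop :=
  exists n (P : {set 'I_n.+1}), peak_set P /\ x = KP P.

Record PeakDual := MkPeakDual { PeakDual_val : QSym; _ : lspanb is_KP PeakDual_val }.
HB.instance Definition _ := [isSub for PeakDual_val].
HB.instance Definition _ := [Choice of PeakDual by <:].
HB.instance Definition _ := [SubChoice_isSubLmodule of PeakDual by <:].

(* [Xi_P, K_Q] = delta_(P,Q), bilinearly; this determines the pairing *)
Definition peak_pairing (pair : Peak -> PeakDual -> K) : Prop :=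
  [/\ forall x, scalar (pair x), forall y, scalar (pair^~ y) &
      forall n m (P : {set 'I_n.+1}) (P' : {set 'I_m.+1}) (x : Peak) (y : PeakDual),
        peak_set P -> peak_set P' -> val x = Xi P -> val y = KP P' ->
        pair x y = (Tagged (fun k => {set 'I_k.+1}) P ==
                    Tagged (fun k => {set 'I_k.+1}) P')%:R].

End NSym.

Section Modules.
Variable K : fieldType.

(* Linear maps K^a -> K^b are b x a matrices acting on column vectors. *)
Definition short_exact a b c (f : 'M[K]_(b, a)) (g : 'M[K]_(c, b)) : Prop :=
  [/\ forall v : 'cV_a, f *m v = 0 -> v = 0,
      forall w : 'cV_c, exists v : 'cV_b, g *m v = w &
      forall v : 'cV_b, g *m v = 0 <-> exists u : 'cV_a, v = f *m u].

Definition surjective_mx b c (g : 'M[K]_(c, b)) : Prop :=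
  forall w : 'cV_c, exists v : 'cV_b, g *m v = w.

Section Algebras.
Variable n : nat.

(* The generators are numbered from 0: T i stands for T_(i+1), c j for
   c_(j+1). *)
Definition hecke_rel d (T : 'I_n.-1 -> 'M[K]_d) : Prop :=
  [/\ forall i, T i *m T i = - T i,
      forall i j : 'I_n.-1, (i.+1 < j)%N || (j.+1 < i)%N ->
        T i *m T j = T j *m T i &
      forall i j : 'I_n.-1, j = i.+1 :> nat ->
        T i *m T j *m T i = T j *m T i *m T j].

Definition clifford_rel d (T : 'I_n.-1 -> 'M[K]_d) (c : 'I_n -> 'M[K]_d) : Prop :=
  [/\ forall j, c j *m c j = - 1%:M,
      forall j k, j != k -> c j *m c k = - (c k *m c j),
      forall (i : 'I_n.-1) (j : 'I_n), (j != i :> nat) && (j != i.+1 :> nat) ->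
        T i *m c j = c j *m T i,
      forall (i : 'I_n.-1) (j k : 'I_n), j = i :> nat -> k = i.+1 :> nat ->
        T i *m c j = c k *m T i &
      forall (i : 'I_n.-1) (j k : 'I_n), j = i :> nat -> k = i.+1 :> nat ->
        (T i + 1%:M) *m c k = c j *m (T i + 1%:M)].

(* Finitely generated modules over the (finite-dimensional) 0-Hecke algebra
   are, up to isomorphism, the K^d with an action of the generators. *)
Record hmod := HMod {
  hdim : nat;
  hT : 'I_n.-1 -> 'M[K]_hdim;
  hT_rel : hecke_rel hT }.

Definition hhom (M N : hmod) (f : 'M[K]_(hdim N, hdim M)) : Prop :=
  forall i, f *m hT M i = hT N i *m f.

Arguments hhom : clear implicits.

Definition hprojective (P : hmod) : Prop :=
  forall (M N : hmod) (g : 'M_(hdim N, hdim M)) (f : 'M_(hdim N, hdim P)),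
    hhom M N g -> surjective_mx g -> hhom P N f ->
    exists2 h : 'M_(hdim M, hdim P), hhom P M h & g *m h = f.

(* P -> M is surjective and no proper submodule of P surjects onto M *)
Definition hproj_cover (P M : hmod) : Prop :=
  hprojective P /\
  exists p : 'M_(hdim M, hdim P), [/\ hhom P M p, surjective_mx p &
    forall (N : hmod) (h : 'M_(hdim P, hdim N)), hhom N P h ->
      surjective_mx (p *m h) -> surjective_mx h].

Lemma simple_rel (a : compn n) : hecke_rel (fun i : 'I_n.-1 =>
  (if (inord i.+1 : 'I_n.+1) \in D a then -1 else 0 : K)%:M : 'M_1).
Proof.
split=> [i|i j _|i j _].
- by case: ifP => _; rewrite -scalar_mxM -raddfN /= ?mulrNN ?mulr1 ?opprK ?mulr0 ?oppr0.
- by rewrite -!scalar_mxM mulrC.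
- by rewrite -!scalar_mxM; do 2 case: ifP => _;
    rewrite ?(mulr0, mul0r, mulrNN, mulr1).
Qed.
Definition Smod (a : compn n) : hmod := HMod (simple_rel a).

Lemma twist_rel (M : hmod) : hecke_rel (fun i => hT M (rev_ord i)).
Proof.
have [h1 h2 h3] := hT_rel M; split=> [i|i j ij|i j ij]; first exact: h1.
  apply: h2; case/orP: ij => h; apply/orP; [right|left] => /=; have := ltn_ord i;
  have := ltn_ord j; lia.
symmetry; apply: h3 => /=; have := ltn_ord j; lia.
Qed.
(* T_i acts as T_(n-i) *)
Definition htwist (M : hmod) : hmod := HMod (twist_rel M).

(* Finitely generated supermodules: K^d with a basis of homogeneous vectors,
   of parities given by spar; the T_i act evenly and the c_j oddly. *)
Record smod := SMod {
  sdim : nat;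
  spar : 'I_sdim -> bool;
  sT : 'I_n.-1 -> 'M[K]_sdim;
  sc : 'I_n -> 'M[K]_sdim;
  sT_even : forall i a b, spar a != spar b -> sT i a b = 0;
  sc_odd : forall j a b, spar a = spar b -> sc j a b = 0;
  sT_rel : hecke_rel sT;
  sc_rel : clifford_rel sT sc }.

Definition homogeneous_mx (s : bool) (M N : smod) (f : 'M[K]_(sdim N, sdim M)) : Prop :=
  forall a b, spar a (+) spar b != s -> f a b = 0.

(* homomorphisms of parity s : f (x v) = (-1)^(s |x|) x f(v) *)
Definition shom (s : bool) (M N : smod) (f : 'M[K]_(sdim N, sdim M)) : Prop :=
  [/\ homogeneous_mx s f,
      forall i, f *m sT M i = sT N i *m f &
      forall j, f *m sc M j = (-1) ^+ s *: (sc N j *m f)].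

Arguments shom : clear implicits.

Definition shoms (s : bool) (M N : smod) : {vspace 'M[K]_(sdim N, sdim M)} :=
  ((\bigcap_(p : 'I_(sdim N) * 'I_(sdim M) | spar p.1 (+) spar p.2 != s)
      lker (linfun (fun f : 'M[K]_(sdim N, sdim M) => f p.1 p.2 : K^o)))
   :&: (\bigcap_(i < n.-1)
      lker (linfun (fun f : 'M[K]_(sdim N, sdim M) => f *m sT M i - sT N i *m f)))
   :&: (\bigcap_(j < n)
      lker (linfun (fun f : 'M[K]_(sdim N, sdim M) =>
        f *m sc M j - (-1) ^+ s *: (sc N j *m f)))))%VS.

Lemma memv_bigcap (V : vectType K) (I : finType) (P : pred I) (U : I -> {vspace V}) v :
  reflect (forall i, P i -> v \in U i) (v \in \bigcap_(i | P i) U i)%VS.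
Proof.
apply: (iffP idP) => [h i Pi|h].
  by move: v h; apply/subvP; exact: bigcapv_inf Pi (subvv _).
by rewrite memvE; apply/subv_bigcapP => i Pi; rewrite -memvE; exact: h.
Qed.

Lemma memv_lker_linear (V W : vectType K) (f : V -> W) v :
  linear f -> (v \in lker (linfun f)) = (f v == 0).
Proof.
move=> fL; pose F := GRing.isLinear.Build K V W *:%R f fL.
pose fF : {linear V -> W} := HB.pack f F.
by rewrite memv_ker (lfunE fF).
Qed.

Lemma shomsP s M N (f : 'M[K]_(sdim N, sdim M)) : f \in shoms s M N <-> shom s M N f.
Proof.
have e1 (p : 'I_(sdim N) * 'I_(sdim M)) :
    linear (fun f : 'M[K]_(sdim N, sdim M) => f p.1 p.2 : K^o).
  by move=> a u v; rewrite !mxE.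
have e2 (i : 'I_n.-1) : linear (fun f : 'M[K]_(sdim N, sdim M) =>
    f *m sT M i - sT N i *m f).
  by move=> a u v; rewrite mulmxDl mulmxDr opprD addrACA -scalemxAl -scalemxAr scalerBr.
have e3 (j : 'I_n) : linear (fun f : 'M[K]_(sdim N, sdim M) =>
    f *m sc M j - (-1) ^+ s *: (sc N j *m f)).
  move=> a u v; rewrite mulmxDl mulmxDr scalerDr opprD addrACA.
  by rewrite -scalemxAl -scalemxAr scalerBr !scalerA [a * _]mulrC.
rewrite /shoms !memv_cap; split.
  case/andP=> /andP[/memv_bigcap h1 /memv_bigcap h2] /memv_bigcap h3; split.
  - move=> a b ab; have := h1 (a, b) ab.
    by rewrite (memv_lker_linear _ (e1 (a, b))) => /eqP.
  - by move=> i; have := h2 i isT; rewrite (memv_lker_linear _ (e2 i)) subr_eq0 => /eqP.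
  - by move=> j; have := h3 j isT; rewrite (memv_lker_linear _ (e3 j)) subr_eq0 => /eqP.
case=> h1 h2 h3; apply/andP; split; first apply/andP; first split.
- by apply/memv_bigcap => p hp; rewrite (memv_lker_linear _ (e1 p)); apply/eqP/h1.
- by apply/memv_bigcap => i _; rewrite (memv_lker_linear _ (e2 i)) subr_eq0; apply/eqP.
- by apply/memv_bigcap => j _; rewrite (memv_lker_linear _ (e3 j)) subr_eq0; apply/eqP.
Qed.

Definition hom_dim (M N : smod) : nat :=
  (\dim (shoms false M N) + \dim (shoms true M N))%N.

Definition sprojective (P : smod) : Prop :=
  forall (M N : smod) (g : 'M_(sdim N, sdim M)) (f : 'M_(sdim N, sdim P)),
    shom false M N g -> surjective_mx g -> shom false P N f ->
    exists2 h : 'M_(sdim M, sdim P), shom false P M h & g *m h = f.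

(* Parity change: x acts on Pi M as (-1)^|x| x does on M. *)
Section ParityChange.
Variable M : smod.
Let par (a : 'I_(sdim M)) := ~~ spar a.
Let c (j : 'I_n) := - sc M j.
Lemma parity_T i a b : par a != par b -> sT M i a b = 0.
Proof. by move=> h; apply: sT_even; apply: contraNneq h; rewrite /par => ->. Qed.
Lemma parity_c j a b : par a = par b -> c j a b = 0.
Proof. by move/negb_inj => h; rewrite /c mxE sc_odd // oppr0. Qed.
Lemma parity_rel : clifford_rel (sT M) c.
Proof.
have [h1 h2 h3 h4 h5] := sc_rel M; rewrite /c; split.
- by move=> j; rewrite mulmxN mulNmx opprK.
- by move=> j k /h2 h; rewrite !mulmxN !mulNmx h.
- by move=> i j /h3 h; rewrite mulmxN mulNmx h.
- by move=> i j k ij ik; rewrite mulmxN mulNmx (h4 i j k).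
- by move=> i j k ij ik; rewrite mulmxN mulNmx (h5 i j k).
Qed.
Definition parity_change : smod :=
  SMod parity_T parity_c (sT_rel M) parity_rel.
End ParityChange.

Definition res (M : smod) : hmod := HMod (sT_rel M).

(* N = Ind M, for M concentrated in degree 0: extension of scalars along
   H_n -> HC_n, through its universal property *)
Definition induced (M : hmod) (N : smod) : Prop :=
  exists eta : 'M_(sdim N, hdim M),
    [/\ hhom M (res N) eta,
        forall a b, spar a -> eta a b = 0 &
        forall (N' : smod) (f : 'M_(sdim N', hdim M)),
          hhom M (res N') f -> (forall a b, spar a -> f a b = 0) ->
          exists! g : 'M_(sdim N', sdim N), shom false N N' g /\ g *m eta = f].

Record hpmod := HPMod { hp_val : hmod; hp_proj : hprojective hp_val }.
Record spmod := SPMod { sp_val : smod; sp_proj : sprojective sp_val }.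

HB.instance Definition _ := gen_eqMixin hpmod.
HB.instance Definition _ := gen_choiceMixin hpmod.
HB.instance Definition _ := gen_eqMixin spmod.
HB.instance Definition _ := gen_choiceMixin spmod.
HB.instance Definition _ := gen_eqMixin smod.
HB.instance Definition _ := gen_choiceMixin smod.

End Algebras.
End Modules.
Arguments hhom {K n} M N f.
Arguments shom {K n} s M N f.

Section Quotient.
Variables (K : fieldType) (X : choiceType) (rel : {malg K[X]} -> Prop).
Local Notation V := {malg K[X]}.

(* The K-space with generators [x], x : X, and relations u = 0, rel u. *)
Definition groth :=
  Quotient.quot (GRing.ZmodClosed.clone V (lspanb rel) _ : zmodClosed V).
HB.instance Definition _ := GRing.Zmodule.on groth.
HB.instance Definition _ := EqQuotient.on groth.

Definition cls (x : X) : groth := \pi_groth << x >>.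

Lemma piP (u v : V) : \pi_groth u = \pi_groth v <-> lspan rel (u - v).
Proof.
split=> [/eqP|h]; first by rewrite -Quotient.idealrBE => /asboolP.
by apply/eqP; rewrite -Quotient.idealrBE; apply/asboolP.
Qed.

Definition groth_scale (a : K) (x : groth) : groth := \pi_groth (a *: repr x).

Lemma pi_scale a (u : V) : groth_scale a (\pi_groth u) = \pi_groth (a *: u).
Proof.
apply/piP; rewrite -scalerBr; set w := _ - u.
have hw : w \in lspanb rel by apply/asboolP/piP; exact: reprK.
suff: a *: w \in lspanb rel by move/asboolP.
exact: rpredZ.
Qed.

Lemma groth_scaleA a b x : groth_scale a (groth_scale b x) = groth_scale (a * b) x.
Proof. by elim/quotW: x => u; rewrite (pi_scale b u) (pi_scale a (b *: u)) (pi_scale _ u) scalerA. Qed.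
Lemma groth_scale1 : left_id 1 groth_scale.
Proof. by elim/quotW=> u; rewrite (pi_scale _ u) scale1r. Qed.
Lemma groth_scaleDr : right_distributive groth_scale +%R.
Proof.
move=> a; elim/quotW=> u; elim/quotW=> v; rewrite (pi_scale _ u) (pi_scale _ v).
by rewrite -!(raddfD (\pi_groth)) (pi_scale _ (u + v)) scalerDr.
Qed.
Lemma groth_scaleDl x : {morph groth_scale^~ x : a b / a + b >-> a + b}.
Proof.
by move=> a b; elim/quotW: x => u; rewrite !(pi_scale _ u) -(raddfD (\pi_groth)) scalerDl.
Qed.
HB.instance Definition _ := GRing.Zmodule_isLmodule.Build K groth
  groth_scaleA groth_scale1 groth_scaleDr groth_scaleDl.

(* The linear map groth -> W with [x] |-> f x; it is meant for maps f that
   respect the relations, see glift_cls. *)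
Definition glift (W : lmodType K) (f : X -> W) (x : groth) : W :=
  lext f (repr x).

Lemma glift_cls (W : lmodType K) (f : X -> W) :
  (forall u, rel u -> lext f u = 0) ->
  linear (glift f) /\ forall x, glift f (cls x) = f x.
Proof.
move=> f0.
have gpi u : glift f (\pi_groth u) = lext f u.
  have /piP h : \pi_groth (repr (\pi_groth u)) = \pi_groth u by rewrite reprK.
  apply/eqP; rewrite -subr_eq0 -linearB /=; apply/eqP.
  elim: h => [|a v w /f0 v0 _ IH]; first by rewrite linear0.
  by rewrite linearP /= v0 IH scaler0 addr0.
split=> [a x y|x]; last by rewrite gpi lextU.
elim/quotW: x => u; elim/quotW: y => v; rewrite /GRing.scale /= (pi_scale _ u).
by rewrite -(raddfD (\pi_groth)) !gpi linearP.
Qed.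

End Quotient.

Section GrothendieckGroups.
Variable K : fieldType.

Variant Khecke_rel : {malg K[{n : nat & hpmod K n}]} -> Prop :=
| Khecke_ses n (A B C : hpmod K n)
    (f : 'M_(hdim (hp_val B), hdim (hp_val A)))
    (g : 'M_(hdim (hp_val C), hdim (hp_val B))) of
    hhom (hp_val A) (hp_val B) f & hhom (hp_val B) (hp_val C) g & short_exact f g :
  Khecke_rel (<< Tagged (hpmod K) B >> - << Tagged (hpmod K) A >>
              - << Tagged (hpmod K) C >>).

(* U assigns to the objects of the class X their underlying supermodules. *)
Variant super_rel (X : nat -> choiceType) (U : forall n, X n -> smod K n) :
    {malg K[{n : nat & X n}]} -> Prop :=
| super_ses n (A B C : X n) (f : 'M_(sdim (U n B), sdim (U n A)))
    (g : 'M_(sdim (U n C), sdim (U n B))) of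
    shom false (U n A) (U n B) f & shom false (U n B) (U n C) g & short_exact f g :
  super_rel U (<< Tagged X B >> - << Tagged X A >> - << Tagged X C >>)
| super_parity n (A B : X n) of U n B = parity_change (U n A) :
  super_rel U (<< Tagged X B >> - << Tagged X A >>).

(* the direct sums over n of K_0(H_n-pmod), K_0(HC_n-pmod), K_0(HC_n-mod) *)
Definition Khecke := groth Khecke_rel.
Definition Ksuper := groth (@super_rel (fun n => spmod K n) (@sp_val K)).
Definition Gsuper := groth (@super_rel (fun n => smod K n) (fun n M => M)).

(* the class of a projective module M (and a dummy value for the others) *)
Definition clsKh n (M : hmod K n) : Khecke :=
  if pselect (hprojective M) is left pM then
    cls Khecke_rel (Tagged (hpmod K) (HPMod pM))
  else 0.

Definition clsG n (M : smod K n) : Gsuper :=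
  cls (@super_rel (fun n => smod K n) (fun n M => M)) (Tagged (smod K) M).

(* HC_n is free over H_n, so that the restriction of a projective module is
   projective. *)
Definition Res : Ksuper -> Khecke :=
  glift (fun P : {n : nat & spmod K n} => clsKh (res (sp_val (tagged P)))).

Definition Twist : Khecke -> Khecke :=
  glift (fun P : {n : nat & hpmod K n} => clsKh (htwist (hp_val (tagged P)))).

(* dim Hom(P, M) in equal degree, 0 otherwise; Hom(P, -) is exact since P is
   projective, so that it descends to classes. *)
Definition hom_pairing (P : {n : nat & spmod K n}) (M : {n : nat & smod K n}) : K^o :=
  if eqVneq (tag M) (tag P) is EqNotNeq e then
    (hom_dim (sp_val (tagged P)) (ecast n (smod K n) e (tagged M)))%:R
  else 0.

Definition pairing (x : Ksuper) (y : Gsuper) : K :=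
  glift (fun P => glift (hom_pairing P) y) x.

End GrothendieckGroups.

(* Main.v *)
(* Let S be the one-dimensional H_n-module with descent set B.  The module
   Ind S has the basis of the Clifford monomials c_x, x in {0,1}^n, and for a
   suitable height of the c_x all the T_i are triangular.  Hence the
   composition factors of Res Ind S are one-dimensional, and the descents of
   the factor at x are the i in B with x_i = 0 and the i not in B with
   x_(i+1) = 1.  The number N(B, A) of the x giving the descent set A is
   2^(|P(B)| + 1) if P(B) is contained in the symmetric difference of A and
   A + 1, and 0 otherwise: the peaks of B are the positions with two
   constraints on x, and those without constraint are one more than the peaks.

   Three consequences.  By adjunction dim Hom(Ind P_a, Ind S_b) = N(b, a).
   Coinduction, the right adjoint of Res, is the conjugate of induction by a
   duality that reverses the indices of the T_i and the c_j; hence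
   dim Hom(Res Ind P_a, S_c) is N(c, a) for the reversed compositions, which
   is the formula for [Res Ind P_a].  In NSym, Theta(R_a) is the sum of the
   N(b, a) R_b, as both sides are multiplicative under concatenation of words.
   The pairings then show that the class of Ind P_a corresponds to
   Theta(R_a), whose image under phi is Theta of the reversed ribbon. *)
From HB Require Import structures.
Require Import Defs.
From mathcomp Require Import all_boot all_order all_algebra.
From mathcomp Require Import boolp finmap.
From mathcomp.multinomials Require Import monalg.
From mathcomp Require Import zify ring.
Import GRing.Theory.
Local Open Scope ring_scope.

Set Implicit Arguments.
Unset Strict Implicit.
Unset Printing Implicit Defensive.

(** * Spaces of intertwiners *)

(** The reversal in the formula comes from the asymmetry of the Clifford relations: an
    anti-automorphism fixing every [T_i] and [c_j] would turn [T_i c_i = c_(i+1) T_i] into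
    [c_i T_i = T_i c_(i+1)], which fails in HC_n, whereas reversing the indices as well preserves
    all the relations. The covers, the induced modules and the isomorphisms are known only through
    their characterizing properties, so equalities of classes are tested numerically. The
    functionals dim Hom(-, line) descend to Grothendieck groups because short exact sequences of
    projectives split, and they are dual to the classes of the covers. No module is decomposed into
    indecomposables: the surjectivity of [Ch_star] says that the classes of the covers span. Signs
    are avoided by replacing homomorphisms of supermodules by the matrices commuting with all
    generators; the parity operator translates between the two. The pairing is prescribed only on
    the Xi_P; that these lie in [Peak] follows from a triangular system with powers of 2 on the
    diagonal, invertible in characteristic 0. *)

Section Dimension.
Variable K : fieldType.

Lemma dim_exact (U V W : vectType K) (A : {vspace U}) (B : {vspace V})
    (C : {vspace W}) (f : {linear U -> V}) (g : {linear V -> W}) :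
  (forall u, f u = 0 -> u = 0) ->
  (forall v, v \in B -> g v = 0 -> exists2 u, u \in A & v = f u) ->
  (forall u, u \in A -> f u \in B /\ g (f u) = 0) ->
  (forall w, w \in C -> exists2 v, v \in B & g v = w) ->
  (forall v, v \in B -> g v \in C) ->
  \dim B = (\dim A + \dim C)%N.
Proof.
move=> f_inj kerB imA surC gB.
rewrite -(limg_ker_dim (linfun g) B).
have -> : \dim (B :&: lker (linfun g))%VS = \dim A.
  suff -> : (B :&: lker (linfun g))%VS = (linfun f @: A)%VS.
    apply: limg_dim_eq; apply/eqP; rewrite -subv0; apply/subvP=> u.
    rewrite memv_cap memv_ker lfunE /= memv0 => /andP[_ /eqP fu].
    by rewrite (f_inj _ fu).
  apply/vspaceP => v; rewrite memv_cap memv_ker lfunE /=.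
  apply/andP/memv_imgP => [[vB /eqP gv]|[u uA ->]].
    by have [u uA ->] := kerB v vB gv; exists u => //; rewrite lfunE.
  by rewrite !lfunE /=; have [-> ->] := imA u uA.
congr (_ + _)%N; suff -> : (linfun g @: B)%VS = C by [].
apply/vspaceP => w; apply/memv_imgP/idP => [[v vB ->]|/surC[v vB <-]].
  by rewrite lfunE /=; exact: gB.
by exists v => //; rewrite lfunE.
Qed.

Lemma dim_bij (U V : vectType K) (A : {vspace U}) (B : {vspace V})
    (f : {linear U -> V}) :
  (forall u, u \in A -> f u = 0 -> u = 0) -> (forall u, u \in A -> f u \in B) ->
  (forall v, v \in B -> exists2 u, u \in A & f u = v) -> \dim A = \dim B.
Proof.
move=> f_inj fA surB.
have <- : (linfun f @: A)%VS = B.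
  apply/vspaceP => v; apply/memv_imgP/idP => [[u uA ->]|/surB[u uA <-]].
    by rewrite lfunE /=; exact: fA.
  by exists u => //; rewrite lfunE.
apply/esym/limg_dim_eq/eqP; rewrite -subv0; apply/subvP=> u.
rewrite memv_cap memv_ker lfunE /= memv0 => /andP[uA /eqP fu].
by rewrite (f_inj _ uA fu).
Qed.

Lemma mx_colP a b (f g : 'M[K]_(a, b)) :
  (forall v : 'cV_b, f *m v = g *m v) -> f = g.
Proof.
move=> fg; apply/matrixP => i j; have /colP/(_ i) := fg (delta_mx j 0).
by rewrite -!colE !mxE.
Qed.

Lemma injective_mxI a b c (f : 'M[K]_(b, a)) (u v : 'M[K]_(a, c)) :
  (forall v : 'cV_a, f *m v = 0 -> v = 0) -> f *m u = f *m v -> u = v.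
Proof.
move=> f_inj fuv; apply/eqP; rewrite -subr_eq0; apply/eqP/mx_colP => w.
by rewrite mul0mx; apply: f_inj; rewrite mulmxA mulmxBr fuv subrr mul0mx.
Qed.

Lemma surjective_mxI a b c (g : 'M[K]_(b, a)) (u v : 'M[K]_(c, b)) :
  surjective_mx g -> u *m g = v *m g -> u = v.
Proof.
move=> g_surj uvg; apply: mx_colP => w; have [z <-] := g_surj w.
by rewrite !mulmxA uvg.
Qed.

Lemma factor_mx a b c d (f : 'M[K]_(b, a)) (g : 'M[K]_(c, b)) (u : 'M[K]_(b, d)) :
  (forall v : 'cV_b, g *m v = 0 -> exists w : 'cV_a, v = f *m w) ->
  g *m u = 0 -> exists v, u = f *m v.
Proof.
move=> fg gu.
have /fin_all_exists[v hv] j : exists w : 'cV_a, col j u = f *m w.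
  by apply: fg; rewrite colE mulmxA gu mul0mx.
exists (\matrix_(i, j) v j i 0); apply/matrixP => i j.
have /colP/(_ i) := hv j; rewrite !mxE => ->.
by apply: eq_bigr => k _; rewrite mxE.
Qed.

Lemma surjective_mx_section b c (g : 'M[K]_(c, b)) :
  surjective_mx g -> exists h, g *m h = 1%:M.
Proof.
move=> g_surj.
have /fin_all_exists[v hv] j : exists v : 'cV_b, g *m v = delta_mx j 0 by exact: g_surj.
exists (\matrix_(i, j) v j i 0); apply/matrixP => i j.
have /colP/(_ i) := hv j; rewrite !mxE eqxx andbT => <-.
by apply: eq_bigr => k _; rewrite mxE.
Qed.

End Dimension.

Section Intertwiners.
Variables (K : fieldType) (X : finType).

(** [X] is any finite index set of operators, so that the exactness lemmas below serve both H_n,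
    with the [T_i], and HC_n, with the [T_i] and [c_j] together. *)
Definition intertwiners a b (A : X -> 'M[K]_a) (B : X -> 'M[K]_b) :
    {vspace 'M[K]_(b, a)} :=
  (\bigcap_(x : X) lker (linfun (fun f : 'M[K]_(b, a) => f *m A x - B x *m f)))%VS.

Lemma intertwinersP a b (A : X -> 'M[K]_a) (B : X -> 'M[K]_b) f :
  f \in intertwiners A B <-> forall x, f *m A x = B x *m f.
Proof.
have lin x : linear (fun f : 'M[K]_(b, a) => f *m A x - B x *m f).
  by move=> k u v; rewrite mulmxDl mulmxDr opprD addrACA -scalemxAl -scalemxAr scalerBr.
split=> [/memv_bigcap h x|h].
  by have := h x isT; rewrite (memv_lker_linear _ (lin x)) subr_eq0 => /eqP.
by apply/memv_bigcap => x _; rewrite (memv_lker_linear _ (lin x)) h subrr.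
Qed.

Lemma intertwiners_mul a b c (A : X -> 'M[K]_a) (B : X -> 'M[K]_b)
    (C : X -> 'M[K]_c) f g :
  f \in intertwiners A B -> g \in intertwiners B C -> g *m f \in intertwiners A C.
Proof.
move=> /intertwinersP hf /intertwinersP hg; apply/intertwinersP => x.
by rewrite -mulmxA hf mulmxA hg mulmxA.
Qed.

Variables (a b c p : nat) (A : X -> 'M[K]_a) (B : X -> 'M[K]_b)
  (C : X -> 'M[K]_c) (P : X -> 'M[K]_p).
Variables (f : 'M[K]_(b, a)) (g : 'M[K]_(c, b)).
Hypotheses (fP : f \in intertwiners A B) (gP : g \in intertwiners B C)
  (fg : short_exact f g).

Let f_inj := let: And3 h _ _ := fg in h.
Let fgE : forall v : 'cV_b, g *m v = 0 -> exists u : 'cV_a, v = f *m u.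
Proof. by case: fg => _ _ h v /h. Qed.
Let gf0 : g *m f = 0.
Proof.
case: fg => _ _ h; apply: mx_colP => v; rewrite mul0mx -mulmxA.
by apply/h; exists v.
Qed.

Lemma dim_intertwiners_exactr :
  (forall u, u \in intertwiners P C -> exists2 v, v \in intertwiners P B & g *m v = u) ->
  \dim (intertwiners P B) =
    (\dim (intertwiners P A) + \dim (intertwiners P C))%N.
Proof.
move=> lift.
apply: (dim_exact (f := mulmx f) (g := mulmx g)) => //=.
- by move=> u fu; apply: (injective_mxI f_inj); rewrite fu mulmx0.
- move=> v /intertwinersP hv gv; have [u vE] := factor_mx fgE gv; exists u => //.
  apply/intertwinersP => x; apply: (injective_mxI f_inj); rewrite !mulmxA -vE hv vE.
  by move/intertwinersP: fP => ->; rewrite mulmxA.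
- move=> u uP; rewrite mulmxA gf0 mul0mx; split=> //; exact: intertwiners_mul uP fP.
- by move=> v vP; exact: intertwiners_mul vP gP.
Qed.

(** For an arbitrary [P] a map need not extend along [f]. An equivariant section [s] of [g] yields
    an equivariant retraction [r] of [f], and then every map extends. *)
Lemma dim_intertwiners_exactl :
  (exists2 s, s \in intertwiners C B & g *m s = 1%:M) ->
  \dim (intertwiners B P) =
    (\dim (intertwiners C P) + \dim (intertwiners A P))%N.
Proof.
(* [1 - s g] is killed by [g], so it factors through [f]; the factor is the retraction. *)
case=> s sP gs.
have [r rE] : exists r, 1%:M - s *m g = f *m r.
  by apply: factor_mx fgE _; rewrite mulmxBr mulmx1 mulmxA gs mul1mx subrr.
have rP : r \in intertwiners B A.
  apply/intertwinersP => x; apply: (injective_mxI f_inj); rewrite !mulmxA -rE.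
  move/intertwinersP: (fP) => ->; rewrite -mulmxA -rE mulmxBl mulmxBr mul1mx mulmx1.
  by have /intertwinersP -> := intertwiners_mul gP sP.
have rf : r *m f = 1%:M.
  apply: (injective_mxI f_inj); rewrite mulmxA -rE mulmxBl -mulmxA gf0.
  by rewrite mulmx0 subr0 mul1mx mulmx1.
apply: (dim_exact (f := mulmxr g) (g := mulmxr f)) => /=.
- by move=> u ug; rewrite -[u]mulmx1 -gs mulmxA ug mul0mx.
- move=> v vP vf; exists (v *m s); first exact: intertwiners_mul sP vP.
  by apply/eqP; rewrite -mulmxA -subr_eq0 -{1}[v]mulmx1 -mulmxBr rE mulmxA vf mul0mx.
- by move=> u uP; rewrite -mulmxA gf0 mulmx0; split=> //; exact: intertwiners_mul gP uP.
- move=> w wP; exists (w *m r); first exact: intertwiners_mul rP wP.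
  by rewrite -mulmxA rf mulmx1.
- by move=> v vP; exact: intertwiners_mul fP vP.
Qed.

End Intertwiners.

(** * Supermodules *)

Section Supermodules.
Variables (K : fieldType) (n : nat).
Implicit Types (M N P : smod K n) (A B : hmod K n).

Definition hhoms A B := intertwiners (hT A) (hT B).

Lemma hhomsP A B f : f \in hhoms A B <-> hhom A B f.
Proof. exact: intertwinersP. Qed.

Definition sgen M (x : 'I_n.-1 + 'I_n) : 'M[K]_(sdim M) :=
  match x with inl i => sT M i | inr j => sc M j end.

(** Homomorphisms of the underlying ungraded modules: no sign rule and no homogeneity, so that the
    lemmas on [intertwiners] apply. *)
Definition uhoms M N := intertwiners (sgen M) (sgen N).

Lemma uhomsP M N f :
  f \in uhoms M N <->
  (forall i, f *m sT M i = sT N i *m f) /\ (forall j, f *m sc M j = sc N j *m f).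
Proof.
split=> [/intertwinersP h|[h1 h2]]; last by apply/intertwinersP => -[i|j] /=.
by split=> x; [exact: (h (inl x)) | exact: (h (inr x))].
Qed.

Lemma uhoms_res M N f : f \in uhoms M N -> f \in hhoms (res M) (res N).
Proof. by case/uhomsP=> h _; apply/hhomsP. Qed.

Definition hpart (s : bool) M N (f : 'M[K]_(sdim N, sdim M)) : 'M[K]_(sdim N, sdim M) :=
  \matrix_(a, b) (f a b *+ (spar a (+) spar b == s)).

Definition parop M : 'M[K]_(sdim M) := diag_mx (\row_a (-1) ^+ spar a).

Lemma hpart_linear s M N : linear (@hpart s M N).
Proof. by move=> k f g; apply/matrixP => a b; rewrite !mxE mulrnDl mulrnAr. Qed.
HB.instance Definition _ s M N := GRing.isLinear.Build K _ _ _ (@hpart s M N)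
  (@hpart_linear s M N).

Lemma hpart_sum M N f : hpart false f + hpart true f = f :> 'M[K]_(sdim N, sdim M).
Proof.
by apply/matrixP => a b; rewrite !mxE; case: (_ (+) _); rewrite ?addr0 ?add0r.
Qed.

Lemma hpart_homogeneous s M N (f : 'M[K]_(sdim N, sdim M)) :
  homogeneous_mx s (hpart s f).
Proof. by move=> a b /negPf h; rewrite mxE h. Qed.

Lemma hpartMr s t M N P (f : 'M_(sdim N, sdim M)) (X : 'M_(sdim M, sdim P)) :
  homogeneous_mx t X -> hpart s f *m X = hpart (s (+) t) (f *m X).
Proof.
move=> hX; apply/matrixP => a b; rewrite !mxE -sumrMnl; apply: eq_bigr => k _.
have [kb|kb] := eqVneq (spar k (+) spar b) t; last by rewrite hX // !mulr0 mul0rn.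
by rewrite -kb mxE mulrnAl; case: (spar a) s (spar k) (spar b) => [] [] [] [].
Qed.

Lemma hpartMl s t M N P (f : 'M_(sdim N, sdim M)) (X : 'M_(sdim P, sdim N)) :
  homogeneous_mx t X -> X *m hpart s f = hpart (s (+) t) (X *m f).
Proof.
move=> hX; apply/matrixP => a b; rewrite !mxE -sumrMnl; apply: eq_bigr => k _.
have [kb|kb] := eqVneq (spar a (+) spar k) t; last by rewrite hX // !mul0r mul0rn.
by rewrite -kb mxE mulrnAr; case: (spar a) s (spar k) (spar b) => [] [] [] [].
Qed.

Lemma sT_homogeneous M i : homogeneous_mx false (sT M i).
Proof. by move=> a b ab; apply: sT_even; case: (spar a) (spar b) ab => [] []. Qed.

Lemma sc_homogeneous M j : homogeneous_mx true (sc M j).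
Proof. by move=> a b ab; apply: sc_odd; case: (spar a) (spar b) ab => [] []. Qed.

Lemma hpart_uhoms s M N f : f \in uhoms M N -> hpart s f \in uhoms M N.
Proof.
case/uhomsP=> h1 h2; apply/uhomsP; split=> x.
  by rewrite (hpartMr _ _ (sT_homogeneous x)) (hpartMl _ _ (sT_homogeneous x)) h1.
by rewrite (hpartMr _ _ (sc_homogeneous x)) (hpartMl _ _ (sc_homogeneous x)) h2.
Qed.

Lemma paropK M : parop M *m parop M = 1%:M.
Proof.
apply/matrixP => a b; rewrite mul_diag_mx !mxE mulrnAr -expr2 sqrr_sign.
by [].
Qed.

Lemma mul_paropr M p (f : 'M[K]_(p, sdim M)) a b :
  (f *m parop M) a b = (-1) ^+ spar b * f a b.
Proof. by rewrite mul_mx_diag !mxE mulrC. Qed.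

Lemma mul_paropl M p (f : 'M[K]_(sdim M, p)) a b :
  (parop M *m f) a b = (-1) ^+ spar a * f a b.
Proof. by rewrite mul_diag_mx !mxE. Qed.

Lemma parop_T M i : parop M *m sT M i = sT M i *m parop M.
Proof.
apply/matrixP => a b; rewrite mul_paropl mul_paropr.
by have [->|/sT_even->] := eqVneq (spar a) (spar b) => //; rewrite !mulr0.
Qed.

Lemma parop_c M j : parop M *m sc M j = - (sc M j *m parop M).
Proof.
apply/matrixP => a b; rewrite [RHS]mxE mul_paropl mul_paropr.
have [ab|ab] := eqVneq (spar a) (spar b); first by rewrite sc_odd // !mulr0 oppr0.
by case: (spar a) (spar b) ab => [] [] // _; rewrite ?expr0 ?expr1 ?mul1r ?mulN1r ?opprK.
Qed.

Lemma shom_uhoms M N f : shom false M N f <-> homogeneous_mx false f /\ f \in uhoms M N.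
Proof.
split=> [[h0 h1 h2]|[h0 /uhomsP[h1 h2]]].
  by split=> //; apply/uhomsP; split=> // j; rewrite h2 scale1r.
by split=> // j; rewrite h2 scale1r.
Qed.

Lemma shom_true_uhoms M N f :
  shom true M N f <-> homogeneous_mx true f /\ f *m parop M \in uhoms M N.
Proof.
split=> [[h0 h1 h2]|[h0 /uhomsP[h1 h2]]].
  split=> //; apply/uhomsP; split=> x; rewrite -(mulmxA f).
    by rewrite parop_T (mulmxA f) h1 mulmxA.
  by rewrite parop_c mulmxN (mulmxA f) h2 expr1 scaleN1r mulNmx opprK mulmxA.
have cancel (u v : 'M_(sdim N, sdim M)) : u *m parop M = v *m parop M -> u = v.
  by move=> uv; rewrite -[u]mulmx1 -paropK mulmxA uv -mulmxA paropK mulmx1.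
split=> // x; apply: cancel; rewrite -(mulmxA f).
  by rewrite -parop_T (mulmxA f) h1 mulmxA.
rewrite -[sc M x *m _]opprK -parop_c mulmxN (mulmxA f) h2.
by rewrite expr1 scaleN1r mulNmx mulmxA.
Qed.

(* An odd homomorphism, which anticommutes with the c_j, becomes a map
   commuting with them after composition with the parity operator. *)
Lemma hom_dimE M N : hom_dim M N = \dim (uhoms M N).
Proof.
rewrite /hom_dim addnC; apply/esym.
apply: (dim_exact (f := mulmxr (parop M)) (g := @hpart false M N)) => /=.
- by move=> u uM; rewrite -[u]mulmx1 -paropK mulmxA uM mul0mx.
- move=> v vP v0; exists (v *m parop M); last by rewrite -mulmxA paropK mulmx1.
  apply/shomsP/shom_true_uhoms; rewrite -mulmxA paropK mulmx1; split=> // a b ab.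
  rewrite mul_paropr -[v]hpart_sum v0 add0r hpart_homogeneous ?mulr0 //.
- move=> u /shomsP/shom_true_uhoms[u1 uP]; split=> //; apply/matrixP => a b.
  rewrite mxE mul_paropr; case: eqP => [h|]; last by rewrite mulr0n mxE.
  by rewrite u1 ?h // mulr0 mxE.
- move=> w /shomsP/shom_uhoms[w0 wP]; exists w => //; apply/matrixP => a b.
  by rewrite mxE; case: eqP => // /eqP/w0 ->.
- move=> v vP; apply/shomsP/shom_uhoms; split; first exact: hpart_homogeneous.
  exact: hpart_uhoms.
Qed.

Lemma shom_parity s M N f : shom s M (parity_change N) f <-> shom (~~ s) M N f.
Proof.
split=> -[h0 h1 h2]; split=> //.
- move=> a b ab; apply: h0; apply: contra ab; rewrite /= addNb.
  by case: (_ (+) _) s {h2} => [] [].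
- by move=> j; rewrite h2 /= mulNmx scalerN -scaleNr; case: (s); rewrite ?opprK.
- move=> a b ab; apply: h0; apply: contra ab; rewrite /= addNb.
  by case: (_ (+) _) s {h2} => [] [].
- by move=> j; rewrite h2 /= mulNmx scalerN -scaleNr; case: (s); rewrite ?opprK.
Qed.

Lemma shom_parity2 M N f :
  shom false M N f -> shom false (parity_change M) (parity_change N) f.
Proof.
case=> h0 h1 h2; split=> //.
  by move=> a b ab; apply: h0; apply: contra ab; rewrite /= addNb addbN negbK.
by move=> j; rewrite /= mulmxN h2 mulNmx !scale1r.
Qed.

Lemma shom_parityl s M N f :
  shom s (parity_change M) N f <-> shom (~~ s) M N f.
Proof.
split=> -[h0 h1 h2]; split=> //.
- move=> a b ab; apply: h0; apply: contra ab; rewrite /= addbN.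
  by case: (_ (+) _) s {h2} => [] [].
- move=> j; apply: oppr_inj; rewrite -mulmxN h2 -scaleNr.
  by case: (s); rewrite ?opprK.
- move=> a b ab; apply: h0; apply: contra ab; rewrite /= addbN.
  by case: (_ (+) _) s {h2} => [] [].
- by move=> j; rewrite /= mulmxN h2 -scaleNr; case: (s); rewrite ?opprK.
Qed.

Lemma hom_dim_parityr M N : hom_dim M (parity_change N) = hom_dim M N.
Proof.
have e s : shoms s M (parity_change N) = shoms (~~ s) M N.
  apply/vspaceP => f; apply/idP/idP => [/shomsP h|h].
    by apply/(@shomsP K n (~~ s) M N)/shom_parity.
  by apply/shomsP/shom_parity/(@shomsP K n (~~ s) M N).
by rewrite /hom_dim !e addnC.
Qed.

Lemma hom_dim_parityl M N : hom_dim (parity_change M) N = hom_dim M N.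
Proof.
have e s : shoms s (parity_change M) N = shoms (~~ s) M N.
  apply/vspaceP => f; apply/idP/idP => [/shomsP h|h].
    by apply/(@shomsP K n (~~ s) M N)/shom_parityl.
  by apply/shomsP/shom_parityl/(@shomsP K n (~~ s) M N).
by rewrite /hom_dim !e addnC.
Qed.

(** [sprojective] lifts even maps only. The odd part of [f], composed with the parity operator, is
    an even map to the parity change of [N] and lifts to that of [M]. *)
Lemma sprojective_lift M N P (g : 'M_(sdim N, sdim M)) f :
  sprojective P -> shom false M N g -> surjective_mx g -> f \in uhoms P N ->
  exists2 h, h \in uhoms P M & g *m h = f.
Proof.
move=> Pproj gP g_surj fP.
have f0P : shom false P N (hpart false f).
  by apply/shom_uhoms; split; [exact: hpart_homogeneous | exact: hpart_uhoms].
have f1P : shom false P (parity_change N) (hpart true f *m parop P).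
  apply/shom_parity/shom_true_uhoms; rewrite -mulmxA paropK mulmx1.
  split; last exact: hpart_uhoms.
  by move=> a b ab; rewrite mul_paropr hpart_homogeneous ?mulr0.
have [h0 h0P gh0] := Pproj _ _ _ _ gP g_surj f0P.
have [h1 h1P gh1] := Pproj _ _ _ _ (shom_parity2 gP) g_surj f1P.
exists (h0 + h1 *m parop P).
  have [_ u0] := (shom_uhoms _).1 h0P.
  by have [_ u1] := (shom_true_uhoms _).1 ((shom_parity _ _).1 h1P); rewrite rpredD.
by rewrite mulmxDr mulmxA gh0 gh1 -mulmxA paropK mulmx1 hpart_sum.
Qed.

Lemma hhoms_even A N (f : 'M_(sdim N, hdim A)) s : f \in hhoms A (res N) ->
  (\matrix_(a, b) (f a b *+ (spar a == s))) \in hhoms A (res N).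
Proof.
move/hhomsP=> hf; apply/hhomsP => i; apply/matrixP => a b; rewrite mxE.
under eq_bigr do rewrite mxE mulrnAl.
rewrite sumrMnl; have /matrixP/(_ a b) := hf i; rewrite mxE => ->.
rewrite !mxE -sumrMnl; apply: eq_bigr => k _; rewrite mxE /=.
by have [->|/sT_even->] := eqVneq (spar a) (spar k); rewrite ?mulrnAr // !mul0r !mul0rn.
Qed.

(** The universal property of [induced] freed from parity: all maps to [res N'] extend, not only
    those with even values, and uniqueness becomes a cancellation law. *)
Definition uinduced A N (eta : 'M_(sdim N, hdim A)) : Prop :=
  [/\ eta \in hhoms A (res N),
      forall a b, spar a -> eta a b = 0,
      forall N' f, f \in hhoms A (res N') -> exists2 g, g \in uhoms N N' & g *m eta = f &
      forall N' g, g \in uhoms N N' -> g *m eta = 0 -> g = 0].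

(** A map to [res N'] is the sum of an even-valued and an odd-valued part, and the latter is
    even-valued for the parity change of [N']. *)
Lemma induced_uinduced A N : induced A N -> exists eta, @uinduced A N eta.
Proof.
case=> eta [etaP eta0 univ]; exists eta.
(* [eta] has even values, so inserting the parity operator to remove signs does not affect the
   composite with [eta]. *)
have par_eta : parop N *m eta = eta.
  apply/matrixP => a b; rewrite mul_diag_mx !mxE.
  by case: (spar a) (eta0 a b) => [->|_]; rewrite ?mulr0 ?expr0 ?mul1r.
have uniq N' g : shom false N N' g -> g *m eta = 0 -> g = 0.
  move=> gP g0; have z : hhom A (res N') 0 by move=> i; rewrite mul0mx mulmx0.
  have [|g' [_ g'P]] := univ N' 0 z; first by move=> *; rewrite mxE.
  rewrite -(g'P 0); first by apply/esym; rewrite -(g'P g) //.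
  by split; [apply/shomsP; rewrite mem0v | rewrite mul0mx].
split=> //; first exact/hhomsP.
- move=> N' f fP.
  set f0 := \matrix_(a, b) (f a b *+ (spar a == false)).
  set f1 := \matrix_(a, b) (f a b *+ (spar a == true)).
  have fE : f0 + f1 = f.
    by apply/matrixP => a b; rewrite !mxE; case: (spar a); rewrite ?addr0 ?add0r.
  have [g0 [[g0P g0E] _]] := univ N' f0 ((hhomsP _).1 (hhoms_even false fP))
    (fun a b ha => ltac:(by rewrite mxE ha)).
  have [g1 [[g1P g1E] _]] := univ (parity_change N') f1 ((hhomsP _).1 (hhoms_even true fP))
    (fun a b (ha : spar (s := parity_change N') a) => ltac:(by rewrite mxE (negPf ha))).
  exists (g0 + g1 *m parop N); last by rewrite mulmxDl -mulmxA par_eta g0E g1E.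
  have [_ u0] := (shom_uhoms _).1 g0P.
  by have [_ u1] := (shom_true_uhoms _).1 ((shom_parity _ _).1 g1P); rewrite rpredD.
- move=> N' g gP geta.
  have heta s : hpart s g *m eta = 0.
    apply/matrixP => a b; transitivity ((g *m eta) a b *+ (spar a == s)); last first.
      by rewrite geta !mxE mul0rn.
    rewrite !mxE -sumrMnl; apply: eq_bigr => k _.
    rewrite mxE mulrnAl; case ek: (spar k); first by rewrite eta0 // mulr0 !mul0rn.
    by rewrite addbF.
  rewrite -[g]hpart_sum (uniq N' (hpart false g)) //; last first.
    by apply/shom_uhoms; split; [exact: hpart_homogeneous | exact: hpart_uhoms].
  rewrite add0r -[hpart true g]mulmx1 -paropK mulmxA.
  rewrite (uniq (parity_change N') (hpart true g *m parop N)) ?mul0mx //.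
    apply/shom_parity/shom_true_uhoms; rewrite -mulmxA paropK mulmx1.
    split; last exact: hpart_uhoms.
    by move=> a b ab; rewrite mul_paropr hpart_homogeneous ?mulr0.
  by rewrite -mulmxA par_eta heta.
Qed.

Lemma dim_uhoms_induced A N eta N' :
  @uinduced A N eta -> \dim (uhoms N N') = \dim (hhoms A (res N')).
Proof.
case=> etaP _ ex uq; apply: (dim_bij (f := mulmxr eta)) => /=.
- by move=> u; exact: uq.
- by move=> u /uhoms_res uP; exact: intertwiners_mul etaP uP.
- by move=> v /ex[g gP ge]; exists g.
Qed.

(** Induction is left adjoint to the exact functor [res], hence preserves projectives. *)
Lemma sprojective_induced A N eta :
  hprojective A -> @uinduced A N eta -> sprojective N.
Proof.
move=> Aproj [etaP eta0 ex uq] M M' g f gP g_surj fP.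
have [[f0 fu] [g0 gu]] := ((shom_uhoms _).1 fP, (shom_uhoms _).1 gP).
have feP : hhom A (res M') (f *m eta).
  by apply/hhomsP; exact: intertwiners_mul etaP (uhoms_res fu).
have [h hP gh] := Aproj (res M) (res M') g (f *m eta) ((hhomsP _).1 (uhoms_res gu)) g_surj feP.
have [k ku ke] := ex M h ((hhomsP _).2 hP).
(* [k] comes from the parity-free property and may mix parities; as [g] and [f] are even, its even
   part is still a lift. *)
exists (hpart false k).
  by apply/shom_uhoms; split; [exact: hpart_homogeneous | exact: hpart_uhoms].
rewrite (hpartMl _ _ g0) /= -[RHS](_ : hpart false f = f); last first.
  by apply/matrixP => a b; rewrite mxE; case: eqP => // /eqP/f0 ->.
suff -> : g *m k = f by [].
apply/eqP; rewrite -subr_eq0; apply/eqP/uq; last by rewrite mulmxBl -mulmxA ke gh subrr.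
by rewrite rpredB //; exact: intertwiners_mul ku gu.
Qed.

End Supermodules.

(** * The induced module *)

Section Bits.
Variable n : nat.
Local Notation bits := {ffun 'I_n -> bool}.
Implicit Types (x : bits) (i : 'I_n.-1) (j k : 'I_n) (a b : bool).

Definition lo i : 'I_n := widen_ord (leq_pred n) i.
Lemma hi_subproof i : (i.+1 < n)%N.
Proof. by have := ltn_ord i; lia. Qed.
Definition hi i : 'I_n := Ordinal (hi_subproof i).

Lemma lo_hi i : (lo i == hi i) = false.
Proof. by apply/negP => /eqP /(congr1 val) /=; lia. Qed.

Definition upd x j b : bits := [ffun k => if k == j then b else x k].
Definition flip x j : bits := upd x j (~~ x j).
Definition upd2 x i a b : bits := upd (upd x (lo i) a) (hi i) b.

Lemma updE x j b k : upd x j b k = if k == j then b else x k.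
Proof. by rewrite ffunE. Qed.

Lemma upd2_lo x i a b : upd2 x i a b (lo i) = a.
Proof. by rewrite !updE lo_hi eqxx. Qed.
Lemma upd2_hi x i a b : upd2 x i a b (hi i) = b.
Proof. by rewrite !updE eqxx. Qed.
Lemma upd2_upd2 x i a b a' b' : upd2 (upd2 x i a b) i a' b' = upd2 x i a' b'.
Proof. by apply/ffunP => k; rewrite !updE; case: (k == hi i) (k == lo i) => [] []. Qed.
Lemma upd2_id x i : upd2 x i (x (lo i)) (x (hi i)) = x.
Proof. by apply/ffunP => k; rewrite !updE; case: eqP => [->//|_]; case: eqP => [->|]. Qed.
Lemma upd_upd x j b b' : upd (upd x j b) j b' = upd x j b'.
Proof. by apply/ffunP => k; rewrite !updE; case: eqP. Qed.
Lemma updC x j k a b : j != k -> upd (upd x j a) k b = upd (upd x k b) j a.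
Proof.
move=> jk; apply/ffunP => l; rewrite !updE.
by case: (eqVneq l k) => [->|//]; rewrite eq_sym (negPf jk).
Qed.
Lemma flipK x j : flip (flip x j) j = x.
Proof. by apply/ffunP => k; rewrite !updE eqxx negbK; case: eqP => [->|]. Qed.

Definition parity (P : pred 'I_n) x : bool := \big[addb/false]_(k | P k) x k.

Lemma parity_upd P x j b : parity P (upd x j b) = parity P x (+) (P j && (x j (+) b)).
Proof.
rewrite /parity; have [Pj|Pj] := boolP (P j); last first.
  rewrite addbF; apply: eq_bigr => k Pk; rewrite updE; case: eqP => // kj.
  by rewrite -kj Pk in Pj.
rewrite (bigD1 j) //= [in RHS](bigD1 j) //= updE eqxx.
rewrite (eq_bigr x) => [|k /andP[_ /negPf kj]]; last by rewrite updE kj.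
by case: b (x j) (\big[_/_]_(_ | _) _) => [] [] [].
Qed.

Lemma parity_flip P x j : parity P (flip x j) = parity P x (+) P j.
Proof. by rewrite parity_upd; case: (x j); rewrite andbT. Qed.

(** [T_i] mixes only the four monomials that differ at the positions [lo i] and [hi i]; each such
    block is represented by its member with both bits false. *)
Lemma sum_upd2 (V : nmodType) (F : bits -> V) i :
  \sum_x F x = \sum_(x : bits | ~~ x (lo i) && ~~ x (hi i))
    (F (upd2 x i false false) + F (upd2 x i true false) +
     (F (upd2 x i false true) + F (upd2 x i true true))).
Proof.
have part a b : \sum_(x : bits | (x (lo i) == a) && (x (hi i) == b)) F x =
    \sum_(x : bits | ~~ x (lo i) && ~~ x (hi i)) F (upd2 x i a b).
  rewrite (reindex_onto (fun x => upd2 x i a b) (fun x => upd2 x i false false)) /=.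
    apply: eq_bigl => x; rewrite upd2_lo upd2_hi !eqxx upd2_upd2 /=.
    apply/eqP/andP => [<-|[/negPf h1 /negPf h2]]; first by rewrite upd2_lo upd2_hi.
    by rewrite -[in RHS](upd2_id x i) h1 h2.
  by move=> x /andP[/eqP <- /eqP <-]; rewrite upd2_upd2 upd2_id.
rewrite !big_split -!part /= (bigID (fun x : bits => x (hi i))) /= addrC.
congr (_ + _); rewrite (bigID (fun x : bits => x (lo i))) /= addrC;
congr (_ + _); apply: eq_bigl => x; case: (x (lo i)) (x (hi i)) => [] [] //.
Qed.

End Bits.

Ltac linear_ring :=
  repeat match goal with |- context [mulmx ?A ?w] => move: (mulmx A w) => ? end;
  apply/matrixP => ? ?; rewrite !mxE; ring.

Section LocalAction.
Variables (K : fieldType) (d : nat).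
Implicit Types (t : 'M[K]_d) (w : bool -> bool -> 'cV[K]_d).

(* The action of T_i on the coefficients of 1, c_i, c_(i+1), c_i c_(i+1), i.e.
     T m = 1 (t m), T c_i m = c_(i+1) (t m), T c_(i+1) m = c_i (t + 1) m - c_(i+1) m,
     T c_i c_(i+1) m = m - c_i c_(i+1) (t + 1) m. *)
Definition Tloc t w a b : 'cV[K]_d :=
  match a, b with
  | false, false => t *m w false false + w true true
  | true, false => t *m w false true + w false true
  | false, true => t *m w true false - w false true
  | true, true => - (t *m w true true) - w true true
  end.

Lemma Tloc_quad t w a b : t *m t = - t ->
  Tloc t (Tloc t w) a b = - Tloc t w a b.
Proof.
move=> tt; have ttw v : t *m (t *m v) = - (t *m v) :> 'cV_d by rewrite mulmxA tt mulNmx.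
by case: a b => [] []; rewrite /Tloc ?(mulmxDr, mulmxN, mulmxBr, opprK, ttw);
  linear_ring.
Qed.

Lemma Tloc_comm t t' (w : bool -> bool -> bool -> bool -> 'cV[K]_d) a b a' b' :
  t *m t' = t' *m t ->
  Tloc t (fun a b => Tloc t' (w a b) a' b') a b =
  Tloc t' (fun a' b' => Tloc t (fun a b => w a b a' b') a b) a' b'.
Proof.
move=> tt; have ttw v : t *m (t' *m v) = t' *m (t *m v) :> 'cV_d by rewrite !mulmxA tt.
case: a b a' b' => [] [] [] []; rewrite /Tloc ?(mulmxDr, mulmxN, mulmxBr, opprK, ttw);
  linear_ring.
Qed.

Lemma Tloc_braid t t' (w : bool -> bool -> bool -> 'cV[K]_d) a b c :
  t *m t = - t -> t' *m t' = - t' -> t *m t' *m t = t' *m t *m t' ->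
  let L (w : bool -> bool -> bool -> 'cV[K]_d) a b c := Tloc t (fun a b => w a b c) a b in
  let L' (w : bool -> bool -> bool -> 'cV[K]_d) a b c := Tloc t' (fun b c => w a b c) b c in
  L (L' (L w)) a b c = L' (L (L' w)) a b c.
Proof.
move=> tt tt' ttt /=.
have e1 v : t *m (t *m v) = - (t *m v) :> 'cV_d by rewrite mulmxA tt mulNmx.
have e2 v : t' *m (t' *m v) = - (t' *m v) :> 'cV_d by rewrite mulmxA tt' mulNmx.
have e3 v : t *m (t' *m (t *m v)) = t' *m (t *m (t' *m v)) :> 'cV_d.
  by rewrite !mulmxA ttt.
case: a b c => [] [] []; rewrite /Tloc ?(mulmxDr, mulmxN, mulmxBr, opprK, e3, e1, e2);
  linear_ring.
Qed.

(** This is the sign picked up by a [c_j] further right on its way past the block; [T_i] preserves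
    the parity of the number of Clifford factors. *)
Lemma Tloc_sign t w a b :
  Tloc t (fun a b => (-1) ^+ (a (+) b) *: w a b) a b = (-1) ^+ (a (+) b) *: Tloc t w a b.
Proof.
case: a b => [] []; rewrite /Tloc /= ?expr0 ?expr1 ?scale1r ?scaleN1r
  ?mulmxN ?opprK; linear_ring.
Qed.

Lemma Tloc_scale t w k a b : Tloc t (fun a b => k *: w a b) a b = k *: Tloc t w a b.
Proof. case: a b => [] []; rewrite /Tloc -?scalemxAr; linear_ring. Qed.

(** The relation [T_i c_i = c_(i+1) T_i], read on the coefficients of a block. *)
Lemma Tloc_swap t w a b :
  Tloc t (fun a b => (-1) ^+ (~~ a) *: w (~~ a) b) a b =
  (-1) ^+ (a (+) ~~ b) *: Tloc t w a (~~ b).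
Proof.
case: a b => [] []; rewrite /Tloc /= ?expr0 ?expr1 ?scale1r ?scaleN1r
  ?mulmxN ?opprK; linear_ring.
Qed.

(** The relation [(T_i + 1) c_(i+1) = c_i (T_i + 1)], read on the coefficients of a block. *)
Lemma Tloc_swap1 t w a b :
  let w' a b := (-1) ^+ (a (+) ~~ b) *: w a (~~ b) in
  Tloc t w' a b + w' a b = (-1) ^+ (~~ a) *: (Tloc t w (~~ a) b + w (~~ a) b).
Proof.
case: a b => [] []; rewrite /Tloc /= ?expr0 ?expr1 ?scale1r ?scaleN1r
  ?mulmxN ?opprK; linear_ring.
Qed.

End LocalAction.

Definition linmx (K : fieldType) a b (f : 'cV[K]_a -> 'cV[K]_b) : 'M[K]_(b, a) :=
  \matrix_(i, j) f (delta_mx j 0) i 0.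

Lemma linmxE (K : fieldType) a b (f : {linear 'cV[K]_a -> 'cV[K]_b}) v :
  linmx f *m v = f v.
Proof.
rewrite {2}(matrix_sum_delta v) linear_sum; apply/colP => i.
rewrite mxE summxE; apply: eq_bigr => j _.
by rewrite big_ord1 linearZ !mxE mulrC.
Qed.

Section InducedModule.
Variables (K : fieldType) (n : nat) (A : hmod K n).
Local Notation bits := {ffun 'I_n -> bool}.
Local Notation d := (hdim A).
Local Notation t := (hT A).
Local Notation V := {ffun bits -> 'cV[K]_d}.
Local Notation X := (bits * 'I_d)%type.
Local Notation N := #|{: X}|.

Definition flat (v : V) : 'cV[K]_N := \col_k v (enum_val k).1 (enum_val k).2 0.
Definition unflat (c : 'cV[K]_N) : V :=
  [ffun x => \col_k c (enum_rank (x, k)) 0].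

Lemma flatK : cancel flat unflat.
Proof.
by move=> v; apply/ffunP => x; apply/colP => k; rewrite ffunE !mxE enum_rankK.
Qed.

Lemma unflatK : cancel unflat flat.
Proof.
move=> c; apply/colP => k; rewrite mxE ffunE mxE -surjective_pairing.
by rewrite enum_valK.
Qed.

Lemma flat_linear : linear flat.
Proof. by move=> a u v; apply/colP => k; rewrite !mxE !ffunE !mxE. Qed.
HB.instance Definition _ := GRing.isLinear.Build K _ _ _ flat flat_linear.

Lemma unflat_linear : linear unflat.
Proof.
by move=> a u v; apply/ffunP => x; apply/colP => k; rewrite !(ffunE, mxE).
Qed.
HB.instance Definition _ := GRing.isLinear.Build K _ _ _ unflat unflat_linear.

Definition before (j : 'I_n) : pred 'I_n := fun k => (k < j)%N.

Definition Top i (v : V) : V :=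
  [ffun x => Tloc (t i) (fun a b => v (upd2 x i a b)) (x (lo i)) (x (hi i))].

(* The coefficient of c_x in c_j v, where c_x is the ordered product of the
   c_k with x k. *)
Definition Cop (j : 'I_n) (v : V) : V :=
  [ffun x => (-1) ^+ (parity (before j) x (+) ~~ x j) *: v (flip x j)].

Lemma Top_linear i : linear (Top i).
Proof.
move=> k u v; apply/ffunP => x; rewrite !ffunE.
case: (x (lo i)) (x (hi i)) => [] []; rewrite /Tloc !ffunE ?(mulmxDr, scalerDr, opprD) -?scalemxAr;
linear_ring.
Qed.
HB.instance Definition _ i := GRing.isLinear.Build K _ _ _ (Top i) (Top_linear i).

Lemma Cop_linear j : linear (Cop j).
Proof.
by move=> k u v; apply/ffunP => x; rewrite !ffunE scalerDr !scalerA mulrC.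
Qed.
HB.instance Definition _ j := GRing.isLinear.Build K _ _ _ (Cop j) (Cop_linear j).

Lemma TopE i v x a b :
  Top i v (upd2 x i a b) = Tloc (t i) (fun a b => v (upd2 x i a b)) a b.
Proof.
rewrite ffunE upd2_lo upd2_hi; congr (Tloc _ _ _ _).
by apply/funext => a'; apply/funext => b'; rewrite upd2_upd2.
Qed.

Lemma Top_ext i (v : V) x w : (forall a b, v (upd2 x i a b) = w a b) ->
  Top i v x = Tloc (t i) w (x (lo i)) (x (hi i)).
Proof.
move=> e; rewrite ffunE; congr (Tloc _ _ _ _).
by apply/funext => a; apply/funext => b; rewrite e.
Qed.

Lemma Top_quad i v : Top i (Top i v) = - Top i v.
Proof.
have [h _ _] := hT_rel A; apply/ffunP => x; rewrite (Top_ext (TopE i v x)).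
by rewrite Tloc_quad ?ffunE.
Qed.

Lemma Top_comm (i j : 'I_n.-1) v : (i.+1 < j)%N || (j.+1 < i)%N ->
  Top i (Top j v) = Top j (Top i v).
Proof.
move=> ij; have [_ h _] := hT_rel A; apply/ffunP => x.
have ne : [/\ lo i != lo j, lo i != hi j, hi i != lo j & hi i != hi j].
  by split; apply/negP => /eqP /(congr1 val) /=; lia.
have [n1 n2 n3 n4] := ne.
have e a b k l : upd2 (upd2 x i a b) j k l = upd2 (upd2 x j k l) i a b.
  by rewrite /upd2 (updC _ _ _ n3) (updC _ _ _ n1) (updC _ _ _ n4) (updC _ _ _ n2).
rewrite (@Top_ext i _ x (fun a b => Tloc (t j) (fun k l => v (upd2 (upd2 x i a b) j k l))
   (x (lo j)) (x (hi j)))); last first.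
  move=> a b; rewrite ffunE /upd2 !updE.
  by rewrite ![lo j == _]eq_sym ![hi j == _]eq_sym (negPf n1) (negPf n2) (negPf n3) (negPf n4).
rewrite (@Top_ext j _ x (fun k l => Tloc (t i) (fun a b => v (upd2 (upd2 x i a b) j k l))
   (x (lo i)) (x (hi i)))); last first.
  move=> k l; rewrite (@Top_ext i v _ (fun a b => v (upd2 (upd2 x i a b) j k l))).
    by rewrite /upd2 !updE (negPf n1) (negPf n2) (negPf n3) (negPf n4).
  by move=> a b; rewrite e.
exact: (Tloc_comm (fun a b k l => v (upd2 (upd2 x i a b) j k l)) _ _ _ _ (h _ _ ij)).
Qed.

Lemma Top_braid (i j : 'I_n.-1) v : j = i.+1 :> nat ->
  Top i (Top j (Top i v)) = Top j (Top i (Top j v)).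
Proof.
move=> ij; have [h1 _ h3] := hT_rel A; apply/ffunP => x.
have eij : hi i = lo j by apply/val_inj => /=.
have ne1 : (lo i == lo j) = false by apply/negP => /eqP /(congr1 val) /=; lia.
have ne2 : (lo i == hi j) = false by apply/negP => /eqP /(congr1 val) /=; lia.
have ne3 : (lo j == hi j) = false by apply/negP => /eqP /(congr1 val) /=; lia.
(* [U a b c] sets the three bits on which [T_i] and [T_j] act and keeps the others, which reduces
   the claim to [Tloc_braid]. *)
pose U a b c := upd (upd (upd x (lo i) a) (lo j) b) (hi j) c.
have Ui a b c a' b' : upd2 (U a b c) i a' b' = U a' b' c.
  rewrite /upd2 eij; apply/ffunP => k; rewrite !updE.
  case: (eqVneq k (lo j)) => [->|_]; first by rewrite ne3.
  case: (eqVneq k (lo i)) => [->|_]; first by rewrite ne2.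
  by [].
have Uj a b c b' c' : upd2 (U a b c) j b' c' = U a b' c'.
  rewrite /upd2; apply/ffunP => k; rewrite !updE.
  by case: (k == hi j) (k == lo j) => [] [].
have xE : x = U (x (lo i)) (x (lo j)) (x (hi j)).
  apply/ffunP => k; rewrite !updE.
  by case: eqP => [->|_] //; case: eqP => [->|_] //; case: eqP => [->|].
have Ti u a b c : Top i u (U a b c) = Tloc (t i) (fun a b => u (U a b c)) a b.
  rewrite (@Top_ext i u _ (fun a b => u (U a b c))) => [|a' b']; last by rewrite Ui.
  by rewrite eij !updE ?(eqxx, ne1, ne2, ne3).
have Tj u a b c : Top j u (U a b c) = Tloc (t j) (fun b c => u (U a b c)) b c.
  rewrite (@Top_ext j u _ (fun b c => u (U a b c))) => [|b' c']; last by rewrite Uj.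
  by rewrite !updE ?(eqxx, ne1, ne2, ne3).
have := Tloc_braid (fun a b c => v (U a b c)) (x (lo i)) (x (lo j)) (x (hi j))
  (h1 i) (h1 j) (h3 i j ij).
cbv zeta => e; rewrite xE Ti Tj -/(U _ _ _).
transitivity (Tloc (t i) (fun a b => Tloc (t j) (fun b c =>
  Tloc (t i) (fun a b => v (U a b c)) a b) b (x (hi j))) (x (lo i)) (x (lo j))).
  congr (Tloc _ _ _ _); apply/funext => a; apply/funext => b; rewrite Tj.
  by congr (Tloc _ _ _ _); apply/funext => b'; apply/funext => c; rewrite Ti.
rewrite e; congr (Tloc _ _ _ _); apply/funext => b; apply/funext => c; rewrite Ti.
by congr (Tloc _ _ _ _); apply/funext => a; apply/funext => b'; rewrite Tj.
Qed.

Lemma Cop_Cop j v : Cop j (Cop j v) = - v.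
Proof.
apply/ffunP => x; rewrite !ffunE flipK scalerA -signr_addb parity_flip /before ltnn addbF.
rewrite eqxx; case: (parity _ _) (x j) => [] [] /=;
by rewrite expr1 scaleN1r.
Qed.

Lemma Cop_anticomm j k v : j != k -> Cop j (Cop k v) = - Cop k (Cop j v).
Proof.
move=> jk; apply/ffunP => x; rewrite !ffunE !scalerA -!signr_addb !parity_flip /before.
have fl : flip (flip x j) k = flip (flip x k) j.
  rewrite /flip !updE (negPf jk) eq_sym (negPf jk); exact: updC.
rewrite fl (negPf jk) eq_sym (negPf jk) -scaleNr -signrN; congr (_ ^+ _ *: _).
have -> : (k < j)%N = ~~ (j < k)%N by move: jk; rewrite -(inj_eq val_inj) /=; lia.
by case: (j < k)%N (x j) (x k) (parity _ _) (parity _ _) => [] [] [] [] [].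
Qed.

Lemma Top_Cop_far (i : 'I_n.-1) (j : 'I_n) v : (j != i :> nat) && (j != i.+1 :> nat) ->
  Top i (Cop j v) = Cop j (Top i v).
Proof.
case/andP => ji ji1; apply/ffunP => x.
have n1 : (j == lo i) = false by apply/negP => /eqP /(congr1 val) /= /eqP; apply/negP.
have n2 : (j == hi i) = false by apply/negP => /eqP /(congr1 val) /= /eqP; apply/negP.
have lohi : (lo i < j)%N = (hi i < j)%N by rewrite /=; lia.
have fl a b : flip (upd2 x i a b) j = upd2 (flip x j) i a b.
  by apply/ffunP => k; rewrite !updE n1 n2; case: (eqVneq k j) => [->|//]; rewrite n1 n2.
set p := before j.
(* [s] is the part of the sign of [c_j] that does not depend on the two bits of the block; those
   bits count only when [c_j] stands to their right. *)
pose s := parity p x (+) (p (lo i) && (x (lo i) (+) x (hi i))) (+) ~~ x j.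
rewrite (@Top_ext i _ x (fun a b => (-1) ^+ s *:
   ((if p (lo i) then (-1) ^+ (a (+) b) else 1) *: v (upd2 (flip x j) i a b)))); last first.
  move=> a b; rewrite ffunE fl; rewrite /upd2 !parity_upd !updE n1 n2 -/(p _).
  rewrite eq_sym lo_hi /s /p /before -lohi scalerA; congr (_ *: _).
  case: (lo i < j)%N => /=; last by rewrite !addbF mulr1.
  rewrite -signr_addb; congr (_ ^+ _).
  by case: (parity _ _) (x j) (x (lo i)) (x (hi i)) a b => [] [] [] [] [] [].
rewrite Tloc_scale [RHS]ffunE [Top i v _]ffunE.
have -> : flip x j (lo i) = x (lo i) by rewrite !updE eq_sym n1.
have -> : flip x j (hi i) = x (hi i) by rewrite !updE eq_sym n2.
rewrite /s; case: (p (lo i)) => /=.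
  rewrite Tloc_sign scalerA -signr_addb; congr (_ ^+ _ *: _).
  by case: (parity _ _) (x j) (x (lo i)) (x (hi i)) => [] [] [] [].
rewrite addbF; congr (_ *: Tloc _ _ _ _).
by apply/funext => a; apply/funext => b; rewrite scale1r.
Qed.

Lemma parity_lo i (x : bits) a b :
  parity (before (lo i)) (upd2 x i a b) = parity (before (lo i)) x.
Proof. by rewrite /upd2 !parity_upd /before ltnn /= ltnNge leqnSn /= !addbF. Qed.

Lemma parity_hi (i : 'I_n.-1) (x : bits) :
  parity (before (hi i)) x = parity (before (lo i)) x (+) x (lo i).
Proof.
rewrite /parity /before (bigD1 (lo i)) //= addbC; congr (_ (+) _); apply: eq_bigl => k.
by rewrite -(inj_eq val_inj) /=; lia.
Qed.

Lemma flip_lo i (x : bits) a b : flip (upd2 x i a b) (lo i) = upd2 x i (~~ a) b.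
Proof.
rewrite /flip upd2_lo /upd2; apply/ffunP => k; rewrite !updE.
by case: (eqVneq k (lo i)) => [->|//]; rewrite lo_hi.
Qed.

Lemma flip_hi i (x : bits) a b : flip (upd2 x i a b) (hi i) = upd2 x i a (~~ b).
Proof. by rewrite /flip upd2_hi /upd2 upd_upd. Qed.

Lemma Cop_loE i v x a b : Cop (lo i) v (upd2 x i a b) =
  (-1) ^+ parity (before (lo i)) x *: ((-1) ^+ (~~ a) *: v (upd2 x i (~~ a) b)).
Proof. by rewrite ffunE parity_lo upd2_lo flip_lo scalerA -signr_addb. Qed.

Lemma Cop_hiE i v x a b : Cop (hi i) v (upd2 x i a b) =
  (-1) ^+ parity (before (lo i)) x *: ((-1) ^+ (a (+) ~~ b) *: v (upd2 x i a (~~ b))).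
Proof.
by rewrite ffunE parity_hi parity_lo upd2_lo upd2_hi flip_hi scalerA -signr_addb addbA.
Qed.

Lemma Top_Cop_lo i v : Top i (Cop (lo i) v) = Cop (hi i) (Top i v).
Proof.
apply/ffunP => x; rewrite (Top_ext (Cop_loE i v x)) Tloc_scale.
rewrite (Tloc_swap _ (fun a b => v (upd2 x i a b))).
by rewrite -[in RHS](upd2_id x i) Cop_hiE TopE.
Qed.

Lemma Top_Cop_hi i v :
  Top i (Cop (hi i) v) + Cop (hi i) v = Cop (lo i) (Top i v + v).
Proof.
apply/ffunP => x; rewrite [LHS]ffunE (Top_ext (Cop_hiE i v x)) Tloc_scale.
have -> : Cop (hi i) v x = Cop (hi i) v (upd2 x i (x (lo i)) (x (hi i))) by rewrite upd2_id.
rewrite Cop_hiE -scalerDr (Tloc_swap1 _ (fun a b => v (upd2 x i a b))).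
by rewrite -[in RHS](upd2_id x i) Cop_loE ffunE TopE.
Qed.

Definition parity_all (x : bits) := parity (fun=> true) x.

Lemma Top_support i (v : V) (q : bool) x : (forall y, parity_all y = q -> v y = 0) ->
  parity_all x = q -> Top i v x = 0.
Proof.
move=> v0 px.
have e a b : a (+) b = x (lo i) (+) x (hi i) -> v (upd2 x i a b) = 0.
  move=> ab; apply: v0; rewrite -px /parity_all /upd2 !parity_upd /= !updE eq_sym lo_hi.
  by case: a b (x (lo i)) (x (hi i)) (parity _ _) ab {px} => [] [] [] [] [].
rewrite ffunE; case: (x (lo i)) (x (hi i)) e => [] [] e;
by rewrite /Tloc !e ?mulmx0 ?oppr0 ?addr0 ?subr0.
Qed.

Lemma Cop_support j (v : V) (q : bool) x : (forall y, parity_all y = q -> v y = 0) ->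
  parity_all x = ~~ q -> Cop j v x = 0.
Proof.
move=> v0 px; rewrite ffunE v0 ?scaler0 // /parity_all parity_flip -/(parity_all x) px.
by rewrite addbT negbK.
Qed.

Definition ind_T i : 'M[K]_N := linmx (flat \o Top i \o unflat).
Definition ind_c j : 'M[K]_N := linmx (flat \o Cop j \o unflat).

Lemma ind_TE i v : ind_T i *m flat v = flat (Top i v).
Proof. by rewrite /ind_T linmxE /= flatK. Qed.
Lemma ind_cE j v : ind_c j *m flat v = flat (Cop j v).
Proof. by rewrite /ind_c linmxE /= flatK. Qed.

Lemma flat_mxP p (f g : 'M[K]_(p, N)) :
  (forall v, f *m flat v = g *m flat v) -> f = g.
Proof. by move=> h; apply: mx_colP => c; rewrite -[c]unflatK. Qed.

Definition ind_par (k : 'I_N) : bool := parity_all (enum_val k).1.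

Lemma unflat_delta (k : 'I_N) y : y != (enum_val k).1 ->
  unflat (delta_mx k 0) y = 0.
Proof.
move=> yk; apply/colP => l; rewrite !(ffunE, mxE) andbT; case: eqP => // e.
by rewrite -e enum_rankK eqxx in yk.
Qed.

Lemma ind_T_even i a b : ind_par a != ind_par b -> ind_T i a b = 0.
Proof.
move=> ab; rewrite !mxE (@Top_support i _ (ind_par a)) ?mxE // => y py.
by apply: unflat_delta; apply: contraNneq ab => ye; rewrite -py ye.
Qed.

Lemma ind_c_odd j a b : ind_par a = ind_par b -> ind_c j a b = 0.
Proof.
move=> ab; rewrite !mxE (@Cop_support j _ (~~ ind_par a)) ?negbK ?mxE // => y py.
apply: unflat_delta; apply/eqP => ye; move: py.
by rewrite ye ab -/(ind_par b); case: (ind_par b).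
Qed.

Lemma ind_hecke_rel : hecke_rel ind_T.
Proof.
split=> [i|i j ij|i j ij]; apply: flat_mxP => v.
- by rewrite mulNmx -mulmxA !ind_TE Top_quad linearN.
- by rewrite -!mulmxA !ind_TE Top_comm.
- by rewrite -!mulmxA !ind_TE Top_braid.
Qed.

Lemma ind_clifford_rel : clifford_rel ind_T ind_c.
Proof.
have loE (i : 'I_n.-1) (j : 'I_n) : j = i :> nat -> j = lo i by move=> h; apply/val_inj.
have hiE (i : 'I_n.-1) (j : 'I_n) : j = i.+1 :> nat -> j = hi i by move=> h; apply/val_inj.
split=> [j|j k jk|i j ij|i j k /loE-> /hiE->|i j k /loE-> /hiE->]; apply: flat_mxP => v.
- by rewrite mulNmx mul1mx -mulmxA !ind_cE Cop_Cop linearN.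
- by rewrite mulNmx -!mulmxA !ind_cE Cop_anticomm // linearN.
- by rewrite -!mulmxA !(ind_TE, ind_cE) Top_Cop_far.
- by rewrite -!mulmxA !(ind_TE, ind_cE) Top_Cop_lo.
- rewrite -!mulmxA !mulmxDl !mul1mx !(ind_TE, ind_cE).
  by rewrite -(linearD (@flat)) Top_Cop_hi -(linearD (@flat)) ind_cE.
Qed.

Definition Ind : smod K n :=
  SMod ind_T_even ind_c_odd ind_hecke_rel ind_clifford_rel.

End InducedModule.

Section CliffordMonomials.
Variables (K : fieldType) (n : nat) (N : smod K n).
Local Notation bits := {ffun 'I_n -> bool}.
Implicit Types (x y : bits) (s : seq 'I_n).

Definition cpow (j : 'I_n) (b : bool) : 'M[K]_(sdim N) := if b then sc N j else 1%:M.

Definition cprod s x : 'M[K]_(sdim N) := foldr (fun j M => cpow j (x j) *m M) 1%:M s.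

Definition cmon x := cprod (enum 'I_n) x.

Lemma cprod_cat s s' x : cprod (s ++ s') x = cprod s x *m cprod s' x.
Proof. by elim: s => [|j s IH] /=; rewrite ?mul1mx // IH mulmxA. Qed.

Lemma cprod_eq s x y : {in s, x =1 y} -> cprod s x = cprod s y.
Proof.
elim: s => //= j s IH xy; rewrite xy ?mem_head // IH // => k ks.
by rewrite xy // inE ks orbT.
Qed.

Lemma cprod_T i s x : lo i \notin s -> hi i \notin s ->
  sT N i *m cprod s x = cprod s x *m sT N i.
Proof.
have [_ _ h _ _] := sc_rel N.
elim: s => [|j s IH] /=; first by rewrite mulmx1 mul1mx.
rewrite !inE !negb_or => /andP[lj ls] /andP[hj hs].
have -> : sT N i *m (cpow j (x j) *m cprod s x) = cpow j (x j) *m (sT N i *m cprod s x).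
  rewrite !mulmxA; congr (_ *m _); rewrite /cpow; case: (x j); last by rewrite mulmx1 mul1mx.
  apply: h; move: lj hj; rewrite eq_sym -(inj_eq val_inj) /= => ->.
  by rewrite eq_sym -(inj_eq val_inj).
by rewrite IH // mulmxA.
Qed.

Lemma cprod_c j s x : j \notin s ->
  sc N j *m cprod s x = (-1) ^+ (\big[addb/false]_(k <- s) x k) *: (cprod s x *m sc N j).
Proof.
have [_ h _ _ _] := sc_rel N.
elim: s => [|k s IH] /=; first by rewrite big_nil mulmx1 mul1mx scale1r.
rewrite inE negb_or big_cons => /andP[jk js].
rewrite mulmxA /cpow; case: (x k) => /=; last by rewrite mulmx1 IH // mul1mx.
rewrite h // mulNmx -!mulmxA IH // -scalemxAr -scaleN1r scalerA.
by case: (\big[_/_]_(_ <- _) _); rewrite ?expr0 ?expr1 ?mulNr ?mul1r ?mulrN ?mulr1 ?opprK.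
Qed.

Lemma enum_splitE (j : 'I_n) : exists s s', [/\ enum 'I_n = s ++ j :: s',
  forall k, (k \in s) = (k < j)%N, forall k, (k \in s') = (j < k)%N & uniq s].
Proof.
have E : enum 'I_n = take j (enum 'I_n) ++ j :: drop j.+1 (enum 'I_n).
  rewrite -{1}(cat_take_drop j (enum 'I_n)) (drop_nth j) ?size_enum_ord //.
  by rewrite nth_ord_enum.
have sj k : (k \in take j (enum 'I_n)) = (k < j)%N.
  by rewrite in_take ?mem_enum // index_enum_ord.
move: E sj; move: (take _ _) (drop _ _) => s s' E sj.
have u := enum_uniq 'I_n; rewrite E cat_uniq in u.
case/and3P: u => us /hasPn hs; rewrite cons_uniq => /andP[js _].
exists s, s'; split=> // k.
have := mem_enum 'I_n k; rewrite E mem_cat inE sj => kE.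
have [kj|kj|kj] := ltngtP (val k) (val j) => /=.
- by apply/negP => ks; have := hs k; rewrite inE ks orbT sj kj => /(_ isT).
- by move: kE; rewrite ltnNge (ltnW kj) /= -(inj_eq val_inj) gtn_eqF.
- by rewrite (val_inj kj); apply/negbTE.
Qed.

Lemma cmon_c j x :
  sc N j *m cmon x = (-1) ^+ (parity (before j) x (+) x j) *: cmon (flip x j).
Proof.
have [cc _ _ _ _] := sc_rel N.
have [s [s' [E sE s'E us]]] := enum_splitE j.
rewrite /cmon E !cprod_cat /= mulmxA cprod_c; last by rewrite sE ltnn.
have -> : \big[addb/false]_(k <- s) x k = parity (before j) x.
  rewrite /parity -[RHS]big_filter; apply: perm_big.
  apply: uniq_perm; rewrite ?filter_uniq ?index_enum_uniq // => k.
  by rewrite sE mem_filter mem_index_enum andbT.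
have fl k : k != j -> flip x j k = x k by rewrite updE => /negPf ->.
rewrite (cprod_eq (s := s) (y := flip x j)); last first.
  by move=> k; rewrite sE => kj; rewrite fl // -(inj_eq val_inj) /=; lia.
rewrite (cprod_eq (s := s') (x := x) (y := flip x j)); last first.
  by move=> k; rewrite s'E => kj; rewrite fl // -(inj_eq val_inj) /=; lia.
rewrite signr_addb -scalerA -!scalemxAl; congr (_ *: _).
rewrite -!mulmxA scalemxAr; congr (_ *m _).
rewrite mulmxA scalemxAl; congr (_ *m _).
rewrite /cpow updE eqxx; case: (x j) => /=; first by rewrite cc scaleN1r.
by rewrite mulmx1 scale1r.
Qed.

Lemma cmon0 : cmon [ffun=> false] = 1%:M.
Proof.
rewrite /cmon; elim: (enum _) => //= j s ->.
by rewrite /cpow ffunE mul1mx.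
Qed.

(** All factors of a monomial other than those at [lo i] and [hi i] commute with [T_i], and these
    two positions are adjacent in the ordered product. *)
Lemma cmon_upd2 i x : exists L R, [/\ sT N i *m L = L *m sT N i,
  sT N i *m R = R *m sT N i &
  forall a b, cmon (upd2 x i a b) = L *m (cpow (lo i) a *m (cpow (hi i) b *m R))].
Proof.
have [s [s' [E sE s'E us]]] := enum_splitE (lo i).
have [s'' E'] : exists s'', s' = hi i :: s''.
  case: s' E s'E => [|k s'] E s'E; first by have := s'E (hi i); rewrite in_nil /= ltnSn.
  exists s'; congr (_ :: _); apply/val_inj => /=.
  have := congr1 (map val) E; rewrite val_enum_ord map_cat /= => e.
  have szs : size s = i.
    have := congr1 size e; rewrite size_iota size_cat size_map /= => sz.
    have := congr1 (fun l => nth 0%N l (size s)) e.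
    have szn : (size s < n)%N by lia.
    by rewrite /= nth_iota // nth_cat size_map ltnn subnn.
  have := congr1 (fun l => nth 0%N l i.+1) e.
  rewrite /= nth_iota ?hi_subproof // add0n nth_cat size_map szs ltnNge leqnSn /=.
  by rewrite subSnn.
have u := enum_uniq 'I_n; rewrite E E' in u.
exists (cprod s x), (cprod s'' x); split.
- apply: cprod_T; rewrite sE /=; lia.
- move: u; rewrite cat_uniq => /and3P[_ _ /= /andP[+ /andP[]]].
  by rewrite inE negb_or => /andP[_ h] h' _; apply: cprod_T.
move=> a b; rewrite /cmon E E' cprod_cat; congr (_ *m _).
  apply: cprod_eq => k; rewrite sE => kl; rewrite !updE.
  by rewrite -!(inj_eq val_inj) /=; case: eqP => [|_]; [|case: eqP]; move: kl => /=; lia.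
rewrite -[_ :: _]/([:: lo i; hi i] ++ s'') cprod_cat.
rewrite /= upd2_lo upd2_hi mulmx1 -mulmxA; congr (_ *m (_ *m _)).
apply: cprod_eq => k ks; rewrite !updE.
move: u; rewrite cat_uniq => /and3P[_ _ /= /andP[+ /andP[]]].
rewrite inE negb_or => /andP[_ h] h' _.
case: eqP => [kh|_]; first by rewrite -kh ks in h'.
by case: eqP => [kh|//]; rewrite -kh ks in h.
Qed.

End CliffordMonomials.

Section IndUniversal.
Variables (K : fieldType) (n : nat) (A : hmod K n).
Local Notation bits := {ffun 'I_n -> bool}.
Local Notation d := (hdim A).
Local Notation t := (hT A).
Local Notation V := {ffun bits -> 'cV[K]_d}.
Local Notation N := #|{: bits * 'I_d}|.

Definition single (x : bits) (m : 'cV[K]_d) : V := [ffun y => if y == x then m else 0].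

Lemma single_linear x : linear (single x).
Proof.
move=> k u v; apply/ffunP => y; rewrite !ffunE; case: eqP => //.
by rewrite scaler0 addr0.
Qed.
HB.instance Definition _ x := GRing.isLinear.Build K _ _ _ (single x) (single_linear x).

Definition ind_eta : 'M[K]_(sdim (Ind A), hdim A) :=
  linmx (fun m => flat (single [ffun=> false] m)).

Lemma ind_etaE m : ind_eta *m m = flat (single [ffun=> false] m).
Proof. exact: (linmxE (@flat K n A \o single [ffun=> false])). Qed.

Lemma Top_single i m :
  Top i (single [ffun=> false] m) = single [ffun=> false] (t i *m m).
Proof.
apply/ffunP => x.
have e a b : single [ffun=> false] m (upd2 x i a b) =
    if (~~ a && ~~ b) && (upd2 x i false false == [ffun=> false]) then m else 0.
  rewrite ffunE; congr (if _ then _ else _).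
  apply/eqP/andP => [h|[/andP[/negPf-> /negPf->] /eqP //]].
  have ha : a = false by rewrite -[a](upd2_lo x i a b) h ffunE.
  have hb : b = false by rewrite -[b](upd2_hi x i a b) h ffunE.
  by rewrite -h ha hb.
rewrite (Top_ext e) ffunE /Tloc.
have xE := upd2_id x i.
case xl: (x (lo i)) xE; case xh: (x (hi i)) => xE /=.
- rewrite mulmx0 subr0 oppr0; case: eqP => // h; by rewrite h ffunE in xl.
- rewrite mulmx0 addr0; case: eqP => // h; by rewrite h ffunE in xl.
- rewrite mulmx0 subr0; case: eqP => // h; by rewrite h ffunE in xh.
- by rewrite addr0 xE; case: eqP => //; rewrite mulmx0.
Qed.

Lemma Cop_single (j : 'I_n) (x : bits) m : x j ->
  Cop j (single (flip x j) m) = (-1) ^+ parity (before j) x *: single x m.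
Proof.
move=> xj; apply/ffunP => y.
have fE : (flip y j == flip x j) = (y == x).
  by apply/eqP/eqP => [/(congr1 (fun z => flip z j))|-> //]; rewrite !flipK.
rewrite [LHS]ffunE [RHS]ffunE [single _ _ _]ffunE [single _ _ _]ffunE fE.
by case: eqP => [->|_]; rewrite ?scaler0 // xj addbF.
Qed.

Section Extension.
Variables (M : smod K n) (f : 'M[K]_(sdim M, d)).
Hypothesis fP : f \in hhoms A (res M).

(** The only candidate: a map over HC_n extending [f] must send [c_x] times [m] to [c_x] applied to
    [f m]. *)
Definition ind_extend (c : 'cV[K]_N) : 'cV[K]_(sdim M) :=
  \sum_x cmon M x *m (f *m unflat c x).

Lemma ind_extend_linear : linear ind_extend.
Proof.
move=> k u v; rewrite /ind_extend scaler_sumr -big_split /=; apply: eq_bigr => x _.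
by rewrite linearP !ffunE !mulmxDr -!scalemxAr.
Qed.
HB.instance Definition _ := GRing.isLinear.Build K _ _ _ ind_extend ind_extend_linear.

Lemma ind_extend_T i v :
  \sum_x cmon M x *m (f *m Top i v x) = sT M i *m \sum_x cmon M x *m (f *m v x).
Proof.
have fT := (hhomsP _).1 fP.
have [c1 c2 _ c4 c5] := sc_rel M.
rewrite [in LHS](sum_upd2 _ i) [in RHS](sum_upd2 _ i) mulmx_sumr; apply: eq_bigr => x _.
have [L [R [TL TR cE]]] := cmon_upd2 M i x; rewrite !cE !TopE /Tloc.
set w := fun a b => v (upd2 x i a b).
set C1 := sc M (lo i); set C2 := sc M (hi i); set T := sT M i.
(* [e1], [e2], [e3] carry [T_i] past [c_i], [c_(i+1)] and their product; these are the rules encoded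
   in [Tloc], so the block sums agree. *)
have e1 (u : 'cV_(sdim M)) : T *m (C1 *m u) = C2 *m (T *m u).
  by rewrite !mulmxA (c4 i _ (hi i)).
have e2 (u : 'cV_(sdim M)) : T *m (C2 *m u) = C1 *m (T *m u) + C1 *m u - C2 *m u.
  have := congr1 (mulmx^~ u) (c5 i (lo i) (hi i) erefl erefl).
  rewrite mulmxDl mul1mx !mulmxDl mulmxDr mulmx1 mulmxDl -!mulmxA => <-.
  by rewrite addrK.
have e3 (u : 'cV_(sdim M)) : T *m (C1 *m (C2 *m u)) =
    - (C1 *m (C2 *m (T *m u))) - C1 *m (C2 *m u) + u.
  have cc (y : 'cV_(sdim M)) : C2 *m (C1 *m y) = - (C1 *m (C2 *m y)).
    by rewrite mulmxA c2 ?mulNmx -?mulmxA // eq_sym lo_hi.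
  rewrite e1 e2 mulmxBr mulmxDr !cc; congr (_ + _).
  by rewrite mulmxA c1 mulNmx mul1mx opprK.
have TL' (u : 'cV_(sdim M)) : T *m (L *m u) = L *m (T *m u) by rewrite !mulmxA TL.
have TR' (u : 'cV_(sdim M)) : T *m (R *m u) = R *m (T *m u) by rewrite !mulmxA TR.
have fT' (u : 'cV_d) : T *m (f *m u) = f *m (t i *m u) by rewrite !mulmxA fT.
rewrite /cpow !mul1mx -!(mulmxA L) -!(mulmxA C1) -!(mulmxA C2).
rewrite !mulmxDr !TL' !e3 !e1 !e2 !TR' !fT'.
rewrite !(mulmxDr, mulmxN); linear_ring.
Qed.

Lemma ind_extend_c j v :
  \sum_x cmon M x *m (f *m Cop j v x) = sc M j *m \sum_x cmon M x *m (f *m v x).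
Proof.
have fi : injective (fun x : bits => flip x j).
  by apply: (can_inj (g := fun x => flip x j)) => x; exact: flipK.
rewrite mulmx_sumr (reindex_inj fi) /=; apply: eq_bigr => x _.
rewrite (mulmxA (sc M j)) cmon_c ffunE flipK parity_flip /before ltnn addbF updE eqxx negbK.
by rewrite -!scalemxAr -scalemxAl.
Qed.

Lemma ind_extend_uhoms : linmx ind_extend \in uhoms (Ind A) M.
Proof.
apply/uhomsP; split=> i; apply: flat_mxP => v; rewrite -!mulmxA.
  by rewrite /= ind_TE !linmxE /= /ind_extend !flatK ind_extend_T.
by rewrite /= ind_cE !linmxE /= /ind_extend !flatK ind_extend_c.
Qed.

Lemma ind_extend_eta : linmx ind_extend *m ind_eta = f.
Proof.
apply: mx_colP => m; rewrite -mulmxA ind_etaE linmxE /= /ind_extend flatK.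
rewrite (bigD1 [ffun=> false]) //= big1 ?addr0 => [|x x0].
  by rewrite ffunE eqxx cmon0 mul1mx.
by rewrite ffunE (negPf x0) !mulmx0.
Qed.

End Extension.

(** The image of [ind_eta] generates: a monomial with a factor [c_j] is, up to sign, [c_j] applied
    to the monomial without it, whence the induction on the number of factors. *)
Lemma ind_uniq (M : smod K n) (g : 'M_(sdim M, sdim (Ind A))) :
  g \in uhoms (Ind A) M -> g *m ind_eta = 0 -> g = 0.
Proof.
move=> /uhomsP[_ gc] g0.
have g1 k (x : bits) m : (#|[set j | x j]| <= k)%N -> g *m flat (single x m) = 0.
  elim: k x => [|k IH] x.
    rewrite leqn0 cards_eq0 => /eqP/setP x0.
    have -> : x = [ffun=> false] by apply/ffunP => j; have := x0 j; rewrite !inE ffunE.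
    by rewrite -ind_etaE mulmxA g0 mul0mx.
  have [/existsP[j xj]|/existsPn x0 _] := boolP [exists j, x j]; last first.
    apply: IH; rewrite (_ : [set _ | _] = set0) ?cards0 //.
    by apply/setP => j; rewrite !inE (negPf (x0 j)).
  rewrite (cardsD1 j) inE xj ltnS => xk.
  have e : g *m (sc (Ind A) j *m flat (single (flip x j) m)) = 0.
    rewrite mulmxA gc -mulmxA IH ?mulmx0 //; apply: leq_trans xk; apply: subset_leq_card.
    apply/subsetP => l; rewrite !inE updE.
    by case: eqP => [->|] //; rewrite xj.
  move: e; rewrite /= ind_cE Cop_single // linearZ -scalemxAr => /eqP.
  by rewrite scaler_eq0 signr_eq0 => /eqP.
apply: flat_mxP => v; rewrite mul0mx.
have -> : v = \sum_x single x (v x).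
  apply/ffunP => x; rewrite sum_ffunE (bigD1 x) //= ffunE eqxx big1 ?addr0 // => y yx.
  by rewrite ffunE eq_sym (negPf yx).
by rewrite linear_sum mulmx_sumr big1 // => x _; apply: g1 (leqnn _).
Qed.

Lemma Ind_uinduced : uinduced (A := A) (N := Ind A) ind_eta.
Proof.
split; last by move=> M g; exact: ind_uniq.
- apply/hhomsP => i; apply: mx_colP => m.
  by rewrite -!mulmxA !ind_etaE /= ind_TE Top_single.
- move=> a b pa; rewrite !mxE ffunE; case: eqP => [e|_]; last by rewrite mxE.
  move: pa; rewrite /= /ind_par e /parity_all /parity big1 // => k _.
  by rewrite ffunE.
- move=> M f fP; exists (linmx (ind_extend f)); first exact: ind_extend_uhoms.
  exact: ind_extend_eta.
Qed.

End IndUniversal.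

(** * Duality and coinduction *)

Section Duality.
Variables (K : fieldType) (n : nat).

(** Over H_n transposition alone would do; the indices are reversed to match [sdual], where the
    Clifford relations require it. *)
Lemma hdual_rel (M : hmod K n) : hecke_rel (fun i => (hT M (rev_ord i))^T).
Proof.
have [h1 h2 h3] := hT_rel M; split=> [i|i j ij|i j ij].
- by rewrite -trmx_mul h1 linearN.
- rewrite -!trmx_mul h2 //=; have := ltn_ord i; have := ltn_ord j; lia.
- rewrite -!trmx_mul !mulmxA -h3 //=; have := ltn_ord i; have := ltn_ord j; lia.
Qed.
Definition hdual M : hmod K n := HMod (hdual_rel M).

(* The anti-automorphism T_i |-> T_(n-i), c_j |-> c_(n+1-j) of HC_n makes the
   dual space of a left module a left module. *)
Section Sdual.
Variable M : smod K n.
Lemma sdual_T i (a b : 'I_(sdim M)) : spar a != spar b -> (sT M (rev_ord i))^T a b = 0.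
Proof. by move=> ab; rewrite mxE sT_even // eq_sym. Qed.
Lemma sdual_c j (a b : 'I_(sdim M)) : spar a = spar b -> (sc M (rev_ord j))^T a b = 0.
Proof. by move=> ab; rewrite mxE sc_odd. Qed.
Lemma sdual_rel : clifford_rel (fun i => (sT M (rev_ord i))^T) (fun j => (sc M (rev_ord j))^T).
Proof.
have [h1 h2 h3 h4 h5] := sc_rel M; split=> [j|j k jk|i j ij|i j k ji ki|i j k ji ki].
- by rewrite -trmx_mul h1 linearN /= trmx1.
- by rewrite -!trmx_mul h2 ?linearN // (inj_eq rev_ord_inj) eq_sym.
- rewrite -!trmx_mul h3 //=; have := ltn_ord i; have := ltn_ord j; lia.
- rewrite -!trmx_mul (h4 (rev_ord i) (rev_ord k) (rev_ord j)) //=;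
    have := ltn_ord i; have := ltn_ord j; lia.
- have e : (sT M (rev_ord i))^T + 1%:M = (sT M (rev_ord i) + 1%:M)^T.
    by rewrite linearD /= trmx1.
  rewrite e -!trmx_mul (h5 (rev_ord i) (rev_ord k) (rev_ord j)) //=;
    have := ltn_ord i; have := ltn_ord j; lia.
Qed.
Definition sdual : smod K n := SMod sdual_T sdual_c (hdual_rel (res M)) sdual_rel.
End Sdual.

Lemma uhoms_dual (M N : smod K n) f :
  f \in uhoms M (sdual N) -> f^T \in uhoms N (sdual M).
Proof.
case/uhomsP=> h1 h2; apply/uhomsP; split=> x /=; apply: trmx_inj.
  by rewrite !trmx_mul !trmxK h1 /= rev_ordK.
by rewrite !trmx_mul !trmxK h2 /= rev_ordK.
Qed.

Lemma hhoms_dual (A : hmod K n) (M : smod K n) f :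
  f \in hhoms (res M) A -> f^T \in hhoms (hdual A) (res (sdual M)).
Proof.
by move/hhomsP=> h; apply/hhomsP => i; rewrite /= -!trmx_mul -h.
Qed.

Lemma hhoms_dual2 (A : hmod K n) (M : smod K n) f :
  f \in hhoms (hdual A) (res M) -> f^T \in hhoms (res (sdual M)) A.
Proof.
move/hhomsP=> h; apply/hhomsP => i; apply: trmx_inj.
by rewrite /= !trmx_mul !trmxK -h /= rev_ordK.
Qed.

Definition Coind (A : hmod K n) : smod K n := sdual (Ind (hdual A)).

Definition coind_eps (A : hmod K n) : 'M[K]_(hdim A, sdim (Coind A)) :=
  (ind_eta (hdual A))^T.

Lemma coind_epsP A : coind_eps A \in hhoms (res (Coind A)) A.
Proof. by apply: hhoms_dual2; have [] := Ind_uinduced (hdual A). Qed.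

(** Transposing turns [res M -> A] into [hdual A -> res (sdual M)], which extends to
    [Ind (hdual A)]; transposing the extension lands in [Coind A]. *)
Lemma coind_exists (A : hmod K n) (M : smod K n) f : f \in hhoms (res M) A ->
  exists2 g, g \in uhoms M (Coind A) & coind_eps A *m g = f.
Proof.
move/hhoms_dual => fP; have [_ _ ex _] := Ind_uinduced (hdual A).
have [g gP gE] := ex _ _ fP; exists g^T; first exact: uhoms_dual gP.
by apply: trmx_inj; rewrite trmx_mul trmxK -gE /coind_eps trmxK.
Qed.

Lemma coind_uniq (A : hmod K n) (M : smod K n) g :
  g \in uhoms M (Coind A) -> coind_eps A *m g = 0 -> g = 0.
Proof.
move/uhoms_dual => gP g0; have [_ _ _ uq] := Ind_uinduced (hdual A).
apply: trmx_inj; rewrite linear0; apply: uq gP _.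
by apply: trmx_inj; rewrite trmx_mul trmxK g0 linear0.
Qed.

Lemma dim_uhoms_coind (A : hmod K n) (M : smod K n) :
  \dim (uhoms M (Coind A)) = \dim (hhoms (res M) A).
Proof.
apply: (dim_bij (f := mulmx (coind_eps A))) => /=.
- by move=> u; exact: coind_uniq.
- move=> u uP; exact: intertwiners_mul (@uhoms_res K n M (Coind A) u uP) (coind_epsP A).
- by move=> v /coind_exists[g gP ge]; exists g.
Qed.

Section IndMap.
Variables (A B : hmod K n).
Local Notation bits := {ffun 'I_n -> bool}.
Implicit Types h : 'M[K]_(hdim B, hdim A).

Definition vmap h (v : {ffun bits -> 'cV[K]_(hdim A)}) : {ffun bits -> 'cV[K]_(hdim B)} :=
  [ffun x => h *m v x].

Lemma vmap_linear h : linear (vmap h).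
Proof. by move=> k u v; apply/ffunP => x; rewrite !ffunE mulmxDr -scalemxAr. Qed.
HB.instance Definition _ h := GRing.isLinear.Build K _ _ _ (vmap h) (vmap_linear h).

Definition ind_map h : 'M[K]_(sdim (Ind B), sdim (Ind A)) :=
  linmx (@flat K n B \o vmap h \o @unflat K n A).

Lemma ind_mapE h v : ind_map h *m flat v = flat (vmap h v).
Proof. by rewrite linmxE /= flatK. Qed.

Lemma ind_map_eta h : ind_map h *m ind_eta A = ind_eta B *m h.
Proof.
apply: mx_colP => m; rewrite -!mulmxA !ind_etaE ind_mapE; congr flat.
by apply/ffunP => x; rewrite !ffunE; case: eqP; rewrite ?mulmx0.
Qed.

Lemma ind_map_shom h : h \in hhoms A B -> shom false (Ind A) (Ind B) (ind_map h).
Proof.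
move/hhomsP=> hP; apply/shom_uhoms; split.
  move=> a b; rewrite /= negb_eqb addbF => ab.
  rewrite mxE /= mxE ffunE unflat_delta ?mulmx0 ?mxE //.
  by apply: contraTneq ab => e; rewrite /ind_par e addbb.
apply/uhomsP; split=> x; apply: flat_mxP => v; rewrite -!mulmxA /=.
  rewrite ind_TE !ind_mapE ind_TE; congr flat; apply/ffunP => y.
  rewrite !ffunE; have hw u : h *m (hT A x *m u) = hT B x *m (h *m u) by rewrite !mulmxA hP.
  by case: (y _) (y _) => [] []; rewrite /Tloc !ffunE ?(mulmxDr, mulmxN, mulmxBr) !hw.
rewrite ind_cE !ind_mapE ind_cE; congr flat; apply/ffunP => y.
by rewrite !ffunE -scalemxAr.
Qed.

End IndMap.

(** Restriction is left adjoint to coinduction, which preserves surjections; a lifting problem over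
    [g] is moved to [G] between coinduced supermodules and solved there. *)
Lemma res_projective (P : smod K n) : sprojective P -> hprojective (res P).
Proof.
move=> Pproj M N g f gP g_surj fP.
have [s gs] := surjective_mx_section g_surj.
have gT : g^T \in hhoms (hdual N) (hdual M).
  by apply/hhomsP => i; rewrite /= -!trmx_mul gP.
pose G : 'M_(sdim (Coind N), sdim (Coind M)) := (ind_map g^T)^T.
have GP : shom false (Coind M) (Coind N) G.
  have [G0 /uhomsP[G1 G2]] := (shom_uhoms _).1 (ind_map_shom gT).
  apply/shom_uhoms; split.
    by move=> a b ab; rewrite mxE; apply: G0; rewrite addbC.
  by apply/uhomsP; split=> x; rewrite /= -!trmx_mul -?G1 -?G2.
have G_surj : surjective_mx G.
  (* The section [s] of [g] is merely linear. Since [ind_map] acts coefficient by coefficient, it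
     still provides a right inverse of [G], and surjectivity asks for no equivariance. *)
  move=> w; exists ((ind_map (A := hdual M) (B := hdual N) s^T)^T *m w).
  rewrite mulmxA -trmx_mul (_ : _ *m _ = 1%:M) ?trmx1 ?mul1mx //.
  apply: flat_mxP => v; rewrite mul1mx -mulmxA !ind_mapE; congr flat.
  by apply/ffunP => x; rewrite !ffunE mulmxA -trmx_mul gs trmx1 mul1mx.
have epsG : coind_eps N *m G = g *m coind_eps M.
  by apply: trmx_inj; rewrite !trmx_mul !trmxK ind_map_eta.
have [f' f'P f'E] := coind_exists ((hhomsP _).2 fP).
have [k kP kE] := sprojective_lift Pproj GP G_surj f'P.
exists (coind_eps M *m k).
  by apply/hhomsP; exact: intertwiners_mul (uhoms_res kP) (coind_epsP M).
by rewrite mulmxA -epsG -mulmxA kE.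
Qed.

End Duality.

(** * Homomorphisms from projective covers to one-dimensional modules *)

Section Multiplicity.
Variables (K : fieldType) (n : nat).

Lemma line_rel (l : 'I_n.-1 -> bool) :
  hecke_rel (fun i => (if l i then -1 else 0 : K)%:M : 'M_1).
Proof.
split=> [i|i j _|i j _].
- by case: ifP => _; rewrite -scalar_mxM -raddfN /= ?mulrNN ?mulr1 ?opprK ?mulr0 ?oppr0.
- by rewrite -!scalar_mxM mulrC.
- by rewrite -!scalar_mxM; do 2 case: ifP => _;
    rewrite ?(mulr0, mul0r, mulrNN, mulr1).
Qed.
Definition line l : hmod K n := HMod (line_rel l).

Lemma hecke_sub d r (T : 'I_n.-1 -> 'M[K]_d) (T' : 'I_n.-1 -> 'M[K]_r) (k : 'M_(d, r)) :
  (forall v : 'cV_r, k *m v = 0 -> v = 0) -> (forall i, T i *m k = k *m T' i) ->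
  hecke_rel T -> hecke_rel T'.
Proof.
move=> k_inj e [h1 h2 h3].
have kT i q (X : 'M_(r, q)) : k *m (T' i *m X) = T i *m (k *m X) by rewrite !mulmxA e.
split=> [i|i j ij|i j ij]; apply: (injective_mxI k_inj).
- by rewrite kT mulmxN -!e mulmxA h1 mulNmx.
- by rewrite !kT -!e !mulmxA h2.
- by rewrite -!mulmxA !kT -!e !mulmxA h3.
Qed.

Lemma hecke_quot d r (T : 'I_n.-1 -> 'M[K]_d) (T' : 'I_n.-1 -> 'M[K]_r) (g : 'M_(r, d)) :
  surjective_mx g -> (forall i, g *m T i = T' i *m g) ->
  hecke_rel T -> hecke_rel T'.
Proof.
move=> g_surj e [h1 h2 h3].
have gT i q (X : 'M_(q, r)) : X *m T' i *m g = X *m g *m T i by rewrite -!mulmxA e.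
split=> [i|i j ij|i j ij]; apply: (surjective_mxI g_surj).
- by rewrite gT mulNmx -!e -mulmxA h1 mulmxN.
- by rewrite !gT -!e -!mulmxA h2.
- by rewrite !gT -!e -!mulmxA !(mulmxA (T _)) h3.
Qed.

(** Hom(P, -) is exact, and a triangular action has a filtration by lines whose characters stand on
    the diagonal; the induction splits off one line. *)
Lemma dim_hhoms_triangular (P : hmod K n) (hP : hprojective P) d
    (T : 'I_n.-1 -> 'M[K]_d) (Trel : hecke_rel T)
    (rk : 'I_d -> nat) (l : 'I_d -> 'I_n.-1 -> bool) :
  (forall i a b, a != b -> T i a b != 0 -> (rk a < rk b)%N) ->
  (forall i a, T i a a = if l a i then -1 else 0) ->
  \dim (hhoms P (HMod Trel)) = (\sum_a \dim (hhoms P (line (l a))))%N.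
Proof.
elim: d T Trel rk l => [|d IH] T Trel rk l tri diag.
  rewrite big_ord0; apply/eqP; rewrite dimv_eq0 -subv0; apply/subvP => v _.
  by rewrite memv0; apply/eqP/matrixP => -[].
(* At minimal rank the column of every [T i] vanishes off the diagonal, so that this basis vector
   spans a submodule; deleting its row and column gives the quotient. *)
have [a0 _ rk_min] := @arg_minnP _ ord0 xpredT rk isT.
have Ta0 i a : a != a0 -> T i a a0 = 0.
  move=> aa0; apply/eqP/negPn/negP => /(tri _ _ _ aa0).
  by rewrite ltnNge rk_min //.
pose f : 'M[K]_(d.+1, 1) := delta_mx a0 0.
pose g : 'M[K]_(d, d.+1) := row' a0 1%:M.
pose T' i : 'M[K]_d := row' a0 (col' a0 (T i)).
have gE p (v : 'M_(d.+1, p)) : g *m v = row' a0 v.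
  apply/matrixP => a b; rewrite !mxE (bigD1 (lift a0 a)) //= !mxE eqxx mul1r.
  by rewrite big1 ?addr0 // => k; rewrite !mxE eq_sym => /negPf ->; rewrite mul0r.
have gT i : g *m T i = T' i *m g.
  rewrite gE; apply/matrixP => a b; rewrite !mxE.
  have [b' ->|->] := unliftP a0 b.
    rewrite (bigD1 b') //= !mxE eqxx mulr1 big1 ?addr0 // => k kb.
    by rewrite !mxE (inj_eq lift_inj) (negPf kb) mulr0.
  rewrite Ta0; last by rewrite eq_sym neq_lift.
  rewrite big1 // => k _; rewrite !mxE.
  by rewrite (negPf (_ : lift a0 k != a0)) ?mulr0 // eq_sym neq_lift.
have g_surj : surjective_mx g.
  move=> w; exists (\col_a (if unlift a0 a is Some a' then w a' 0 else 0)).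
  by rewrite gE; apply/colP => a; rewrite !mxE liftK.
have T'rel : hecke_rel T' := hecke_quot g_surj gT Trel.
have fT i : f *m (if l a0 i then -1 else 0 : K)%:M = T i *m f.
  apply/matrixP => a b; rewrite mul_mx_scalar mxE -colE !mxE ord1 eqxx andbT.
  have [->|aa0] := eqVneq a a0; first by rewrite mulr1 diag.
  by rewrite mulr0 Ta0.
have fg : short_exact f g.
  split=> // v.
  - move/colP/(_ a0); rewrite !mxE big_ord1 mxE !eqxx mul1r => v0.
    by apply/colP => b; rewrite ord1 v0 mxE.
  - rewrite gE; split=> [/colP v0|[u ->]]; last first.
      apply/colP => b; rewrite !mxE big_ord1 mxE eq_sym (negPf (neq_lift _ _)) mul0r.
      by [].
    exists (v a0 0)%:M; apply/colP => b; rewrite mul_mx_scalar !mxE eqxx andbT.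
    have [b' ->|->] := unliftP a0 b; last by rewrite eqxx mulr1.
    by have := v0 b'; rewrite !mxE eq_sym (negPf (neq_lift _ _)) mulr0.
have ->: \dim (hhoms P (HMod Trel)) =
    (\dim (hhoms P (line (l a0))) + \dim (hhoms P (HMod T'rel)))%N.
  apply: (dim_intertwiners_exactr (f := f) (g := g)) => //.
  - by apply/intertwinersP.
  - by apply/intertwinersP.
  - move=> u uP; have uP' := (@hhomsP K n P (HMod T'rel) u).1 uP.
    have [h hh gh] := hP (HMod Trel) (HMod T'rel) g u gT g_surj uP'.
    by exists h => //; apply/(@hhomsP K n P (HMod Trel)).
rewrite (IH T' T'rel (rk \o lift a0) (l \o lift a0)).
- rewrite [RHS](bigD1_ord a0) //=.
- move=> i a b ab; rewrite !mxE => /tri; apply.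
  by rewrite (inj_eq lift_inj).
- by move=> i a; rewrite !mxE diag.
Qed.

(** The kernel of a nonzero map [f] from [P] to a line is a proper submodule, so by minimality of
    the cover it does not surject onto the simple module. Hence [p] vanishes on it and is a nonzero
    multiple of [f], and the line has the character of [Smod K a]. *)
Lemma dim_hhoms_cover (P : hmod K n) (a : compn n) (l : 'I_n.-1 -> bool) :
  hproj_cover P (Smod K a) ->
  \dim (hhoms P (line l)) = [forall i : 'I_n.-1, l i == ((inord i.+1 : 'I_n.+1) \in D a)].
Proof.
case=> Pproj [p [pP p_surj p_cover]].
have p0 : p != 0.
  apply/eqP => p0; have [v] := p_surj 1%:M; rewrite p0 mul0mx.
  by move/matrixP/(_ 0 0)/eqP; rewrite !mxE eqxx eq_sym oner_eq0.
have prop f : f \in hhoms P (line l) -> f != 0 -> exists2 c, c != 0 & p = c *: f.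
  move=> /hhomsP fP f0.
  pose k := (row_base (kermx f^T))^T.
  have kfact r (X : 'M_(hdim P, r)) : f *m X = 0 -> exists Y, X = k *m Y.
    move=> fX; have /submxP[Y YE] : (X^T <= row_base (kermx f^T))%MS.
      by rewrite eq_row_base; apply/sub_kermxP; rewrite -trmx_mul fX linear0.
    by exists Y^T; apply: trmx_inj; rewrite YE trmx_mul !trmxK.
  have fk : f *m k = 0.
    apply: trmx_inj; rewrite trmx_mul trmxK linear0; apply/sub_kermxP.
    by rewrite eq_row_base.
  have k_inj (v : 'cV_(\rank (kermx f^T))) : k *m v = 0 -> v = 0.
    move=> kv; apply: trmx_inj; apply: (row_free_inj (row_base_free (kermx f^T))).
    by rewrite linear0 mul0mx -[row_base _]trmxK -trmx_mul kv linear0.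
  have /fin_all_exists[T' T'E] i : exists Y, hT P i *m k = k *m Y.
    by apply: kfact; rewrite mulmxA fP -mulmxA fk mulmx0.
  pose N := HMod (hecke_sub k_inj T'E (hT_rel P)).
  have pk : p *m k = 0.
    apply/eqP/negPn/negP => pk0.
    have /(p_cover N)k_surj : hhom N P k by move=> i; rewrite T'E.
    case/eqP: f0; apply: mx_colP => v; rewrite mul0mx.
    have [|u <-] := k_surj _ v; last by rewrite mulmxA fk mul0mx.
    have [b pkb] : exists b, (p *m k) 0 b != 0.
      apply/existsP; apply: contraNT pk0 => /existsPn h; apply/eqP/matrixP => i j.
      by rewrite ord1 [RHS]mxE; apply/eqP/negPn/h.
    move=> w; exists ((w 0 0 / (p *m k) 0 b) *: delta_mx b 0); apply/colP => i.
    by rewrite -scalemxAr -colE mxE [col _ _ _ _]mxE ord1 divfK.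
  have [b fb] : exists b, f 0 b != 0.
    apply/existsP; apply: contraNT f0 => /existsPn h; apply/eqP/matrixP => i j.
    by rewrite ord1 [RHS]mxE; apply/eqP/negPn/h.
  pose u : 'cV_(hdim P) := (f 0 b)^-1 *: delta_mx b 0.
  have fu : f *m u = 1%:M.
    rewrite -scalemxAr -colE; apply/matrixP => i j; rewrite !ord1 !mxE eqxx.
    by rewrite mulVf.
  have [Y YE] : exists Y, 1%:M - u *m f = k *m Y.
    by apply: kfact; rewrite mulmxBr mulmx1 mulmxA fu mul1mx subrr.
  have pE : p = (p *m u) *m f.
    have : p *m (1%:M - u *m f) = 0 by rewrite YE mulmxA pk mul0mx.
    by rewrite mulmxBr mulmx1 mulmxA => /eqP; rewrite subr_eq0 => /eqP.
  have pc : p = ((p *m u) 0 0) *: f.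
    by rewrite -mul_scalar_mx -mx11_scalar.
  exists ((p *m u) 0 0) => //; apply: contraNneq p0 => c0.
  by rewrite pc c0 scale0r.
case: forallP => [lD|lD].
  suff -> : hhoms P (line l) = <[p]>%VS by rewrite dim_vline p0.
  apply/vspaceP => f; apply/idP/vlineP => [fP|[c ->]].
    have [->|f0] := eqVneq f 0; first by exists 0; rewrite scale0r.
    have [c c0 ->] := prop f fP f0; exists c^-1.
    by rewrite scalerA mulVf // scale1r.
  apply: rpredZ; apply/hhomsP => i; rewrite pP /= (eqP (lD i)); by [].
apply/eqP; rewrite dimv_eq0 -subv0; apply/subvP => f fP; rewrite memv0.
apply/negPn/negP => f0; apply: lD => i.
have [c c0 pE] := prop f fP f0.
have := pP i; rewrite pE -scalemxAl -scalemxAr.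
move/hhomsP: fP => ->; rewrite /= => /(scalerI c0); rewrite !mul_scalar_mx.
move/eqP; rewrite -subr_eq0 -scalerBl scaler_eq0 (negPf f0) orbF.
by case: (l i) (_ \in _) => [] [] //=; rewrite ?subr0 ?sub0r ?opprK ?oppr_eq0 ?oner_eq0.
Qed.

End Multiplicity.

(** * Composition factors of induced modules *)

Section Count.
Variable n : nat.
Local Notation bits := {ffun 'I_n -> bool}.

Definition factor_descents (m : 'I_n.-1 -> bool) (x : bits) (i : 'I_n.-1) : bool :=
  if m i then ~~ x (lo i) else x (hi i).

(* The number of composition factors of Ind S with descents l, where S is the
   one-dimensional module with descents m. *)
Definition factor_count (m l : 'I_n.-1 -> bool) : nat :=
  #|[set x : bits | [forall i, l i == factor_descents m x i]]|.

(* Along the arrows c_(i+1) -> c_i (i not a descent) and c_i -> c_(i+1)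
   (i a descent) in the action of T_i, this height decreases. *)
Definition height (m : 'I_n.-1 -> bool) (k : 'I_n) : nat :=
  #|[set i : 'I_n.-1 | (i < k)%N (+) m i]|.+1.

(** Between [lo i] and [hi i] only the index [i] itself changes sides, so the height moves by one:
    up if [i] is not a descent, down if it is. *)
Lemma height_hi m i : (height m (hi i) + m i = height m (lo i) + ~~ m i)%N.
Proof.
rewrite /height (cardsD1 i) [in RHS](cardsD1 i) !inE /= ltnn ltnSn /=.
rewrite (_ : [set _ | _] :\ i = [set i0 : 'I_n.-1 | (i0 < i)%N (+) m i0] :\ i); first by lia.
apply/setP => k; rewrite !inE; have [->//|/= ki] := eqVneq k i.
by congr (_ (+) _); rewrite ltnS leq_eqVlt (inj_eq val_inj) (negPf ki).
Qed.

Definition weight_bits m (x : bits) : nat := (\sum_k x k * height m k)%N.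

Lemma weight_bits_upd2 m x i p q :
  (weight_bits m (upd2 x i p q) =
   weight_bits m (upd2 x i false false) + p * height m (lo i) + q * height m (hi i))%N.
Proof.
have hl : hi i != lo i by rewrite eq_sym lo_hi.
rewrite /weight_bits (bigD1 (lo i)) // (bigD1 (hi i)) //=.
rewrite [in RHS](bigD1 (lo i)) // [in RHS](bigD1 (hi i)) //= !upd2_lo !upd2_hi.
rewrite (eq_bigr (fun k => (x k * height m k)%N)); last first.
  by move=> k /andP[/negPf h1 /negPf h2]; rewrite !updE h1 h2.
rewrite [in RHS](eq_bigr (fun k => (x k * height m k)%N)); first by lia.
by move=> k /andP[/negPf h1 /negPf h2]; rewrite !updE h1 h2.
Qed.

Lemma weight_bits_le m x : (weight_bits m x <= \sum_k height m k)%N.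
Proof. by apply: leq_sum => k _; case: (x k); rewrite ?mul1n. Qed.

End Count.

Section LineInd.
(** The action is a variable subject to [Tm], and not [line m] itself, in order to cover both
    [Smod K b] and its dual, whose matrices are transposes. *)
Variables (K : fieldType) (n : nat) (T : 'I_n.-1 -> 'M[K]_1) (Trel : hecke_rel T).
Variables (m : 'I_n.-1 -> bool).
Hypothesis Tm : forall i, T i = (if m i then -1 else 0)%:M.
Local Notation bits := {ffun 'I_n -> bool}.
Let A := HMod Trel.
Local Notation N := #|{: bits * 'I_1}|.
Let bit (a : 'I_N) : bits := (enum_val a).1.

Lemma bit_inj : injective bit.
Proof.
move=> a b ab; apply: enum_val_inj; move: ab; rewrite /bit.
by case: (enum_val a) (enum_val b) => [x i] [y j] /= ->; rewrite !ord1.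
Qed.

Lemma ind_T_line i (a b : 'I_N) : ind_T A i a b =
  Tloc (T i) (fun p q => (upd2 (bit a) i p q == bit b)%:R%:M)
    (bit a (lo i)) (bit a (hi i)) 0 0.
Proof.
rewrite !mxE ffunE ord1; congr (Tloc _ _ _ _ 0 0).
apply/funext => p; apply/funext => q; apply/matrixP => r s.
rewrite ffunE !mxE !ord1 eqxx andbT mulr1n; congr (_%:R).
by rewrite -(inj_eq enum_val_inj) enum_rankK /bit; case: (enum_val b) => y j;
  rewrite xpair_eqE /= ord1 eqxx andbT.
Qed.

Lemma ind_T_line_tri i (a b : 'I_N) : a != b -> ind_T A i a b != 0 ->
  (weight_bits m (bit a) < weight_bits m (bit b))%N.
Proof.
rewrite -(inj_eq bit_inj) ind_T_line Tm => ab.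
have hh := height_hi m i.
have wE := weight_bits_upd2 m (bit a) i.
have z : (false%:R)%:M = 0 :> 'M[K]_1 by rewrite mulr0n raddf0.
have := upd2_id (bit a) i; set x := bit a in ab wE *; set y := bit b in ab *.
case xl: (x (lo i)); case xh: (x (hi i)) => xE; rewrite /Tloc !mul_scalar_mx.
- by rewrite xE (negPf ab) z scaler0 !oppr0 addr0 mxE eqxx.
- case: (_ =P y) => [<-|_]; last by rewrite z scaler0 addr0 mxE eqxx.
  case: (m i) hh => /=; first by rewrite scaleN1r addNr mxE eqxx.
  have := wE true false; have := wE false true; rewrite xE /=; lia.
- rewrite xE (negPf ab) z subr0; case: (_ =P y) => [<-|_]; last by rewrite z scaler0 mxE eqxx.
  case: (m i) hh => /=; last by rewrite scale0r mxE eqxx.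
  have := wE false true; have := wE true false; rewrite xE /=; lia.
(* The arrow from [c_i c_(i+1)] to the monomial without both factors: it lowers the weight because
   the [.+1] in [height] makes every height positive. *)
- rewrite xE (negPf ab) z scaler0 add0r.
  case: (_ =P y) => [<-|_]; last by rewrite z mxE eqxx.
  have := wE false false; have := wE true true; rewrite xE /height /=; lia.
Qed.

Lemma ind_T_line_diag i (a : 'I_N) :
  ind_T A i a a = if factor_descents m (bit a) i then -1 else 0.
Proof.
rewrite ind_T_line Tm /factor_descents.
have := upd2_id (bit a) i; set x := bit a.
have z : (false%:R)%:M = 0 :> 'M[K]_1 by rewrite mulr0n raddf0.
have ne p q : (p != x (lo i)) || (q != x (hi i)) -> (upd2 x i p q == x) = false.
  move=> pq; apply/negP => /eqP e; move: pq.
  have <- : p = x (lo i) by rewrite -[in RHS]e upd2_lo.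
  have <- : q = x (hi i) by rewrite -[in RHS]e upd2_hi.
  by rewrite !eqxx.
case xl: (x (lo i)); case xh: (x (hi i)) => xE; rewrite /Tloc !mul_scalar_mx.
- by rewrite xE eqxx !mxE; case: (m i); rewrite ?mulN1r ?mul0r ?opprK ?oppr0 ?subrr ?sub0r.
- by rewrite !ne ?xl ?xh //= z scaler0 addr0 mxE; case: (m i).
- by rewrite xE eqxx ne ?xl ?xh //= z scaler0 sub0r !mxE eqxx; case: (m i).
- by rewrite xE eqxx ne ?xl ?xh //= z addr0 !mxE eqxx mulr1; case: (m i).
Qed.

Lemma dim_hhoms_ind (P : hmod K n) (a : compn n) : hproj_cover P (Smod K a) ->
  \dim (hhoms P (res (Ind A))) =
    factor_count m (fun i => (inord i.+1 : 'I_n.+1) \in D a).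
Proof.
move=> cover; have [Pproj _] := cover.
rewrite [LHS](@dim_hhoms_triangular K n P Pproj _ (ind_T A) (ind_hecke_rel A)
  (fun a => weight_bits m (bit a)) (fun a => factor_descents m (bit a))
  ind_T_line_tri ind_T_line_diag).
under eq_bigr do rewrite (dim_hhoms_cover _ cover).
rewrite /factor_count -sum1_card [in RHS]big_mkcond /=.
rewrite (reindex (fun x : bits => enum_rank (x, ord0 : 'I_1))) /=; last first.
  exists bit => [x _|k _]; first by rewrite /bit enum_rankK.
  by apply: bit_inj; rewrite /bit enum_rankK.
apply: eq_bigr => x _; rewrite inE /bit enum_rankK /=.
rewrite (_ : [forall _, _] =
  [forall i : 'I_n.-1, ((inord i.+1 : 'I_n.+1) \in D a) == factor_descents m x i]).
  by case: [forall _, _].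
by apply: eq_forallb => i; rewrite eq_sym.
Qed.

Lemma dim_hhoms_dual_ind (P : hmod K n) (a : compn n) : hproj_cover P (Smod K a) ->
  \dim (hhoms P (res (sdual (Ind A)))) =
    factor_count m (fun i => (inord (rev_ord i).+1 : 'I_n.+1) \in D a).
Proof.
move=> cover; have [Pproj _] := cover.
(* Transposition reverses the arrows, so the weight is replaced by its distance to an upper
   bound. *)
pose rk (a : 'I_N) := (\sum_k height m k - weight_bits m (bit a))%N.
rewrite [LHS](@dim_hhoms_triangular K n P Pproj _ (fun i => (ind_T A (rev_ord i))^T)
  (hdual_rel (res (Ind A))) rk (fun a i => factor_descents m (bit a) (rev_ord i))).
- under eq_bigr do rewrite (dim_hhoms_cover _ cover).
  rewrite /factor_count -sum1_card [in RHS]big_mkcond /=.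
  rewrite (reindex (fun x : bits => enum_rank (x, ord0 : 'I_1))) /=; last first.
    exists bit => [x _|k _]; first by rewrite /bit enum_rankK.
    by apply: bit_inj; rewrite /bit enum_rankK.
  apply: eq_bigr => x _; rewrite inE /bit enum_rankK /=.
  rewrite (_ : [forall _, _] =
    [forall i : 'I_n.-1, ((inord (rev_ord i).+1 : 'I_n.+1) \in D a) == factor_descents m x i]).
    by case: [forall _, _].
  apply/forallP/forallP => h i; have := h (rev_ord i).
    by rewrite rev_ordK eq_sym.
  by rewrite rev_ordK eq_sym.
- move=> i b c bc; rewrite mxE => /ind_T_line_tri; rewrite eq_sym => /(_ bc) lt.
  by rewrite /rk ltn_sub2l // (leq_trans lt) // weight_bits_le.
- by move=> i b; rewrite mxE ind_T_line_diag.
Qed.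

End LineInd.

(** * Descent words of compositions *)

Section Words.

(* The descent word of a composition of n: its k-th letter, 0 <= k < n - 1,
   tells whether k + 1 is a descent. *)
Fixpoint descent_word (p : seq nat) : seq bool :=
  if p is u :: q then
    nseq u.-1 false ++ (if q is _ :: _ then true :: descent_word q else [::])
  else [::].

Lemma size_descent_word p : all (leq 1) p -> size (descent_word p) = (sumn p).-1.
Proof.
elim: p => //= u q IH /andP[u0 q0]; rewrite size_cat size_nseq.
case: q IH q0 => [_ _|v q IH q0]; first by rewrite /= !addn0.
rewrite [size (_ :: _)]/= IH //; move: q0 => /= /andP[v0 _]; lia.
Qed.

Lemma partial_sums_word p x : all (leq 1) p ->
  (x \in [seq sumn (take i p) | i <- iota 1 (size p).-1]) =
  (0 < x)%N && nth false (descent_word p) x.-1.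
Proof.
elim: p x => [|u [|v q] IH] x; first by rewrite /= in_nil nth_nil andbF.
  by rewrite /= in_nil cats0 nth_nseq if_same andbF.
move=> pos; have [u0 v0 q0] : [/\ 0 < u, 0 < v & all (leq 1) q]%N by case/and3P: pos.
set w := descent_word (v :: q).
rewrite -[descent_word [:: u, v & q]]/(nseq u.-1 false ++ true :: w).
set ps := [seq sumn (take i (v :: q)) | i <- iota 1 (size (v :: q)).-1].
have -> : [seq sumn (take i [:: u, v & q]) | i <- iota 1 (size [:: u, v & q]).-1] =
    u :: [seq (u + y)%N | y <- ps].
  rewrite /= addn0; congr (_ :: _).
  by rewrite -map_comp /= -(addn1 1) iotaDl -map_comp; apply: eq_map.
have -> : (x \in u :: [seq (u + y)%N | y <- ps]) = (x == u) || (u <= x)%N && ((x - u)%N \in ps).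
  rewrite in_cons; congr (_ || _); apply/mapP/andP => [[y ys ->]|[ux xs]].
    by rewrite leq_addr addKn.
  by exists (x - u)%N => //; rewrite subnKC.
rewrite {}/ps IH; last by rewrite /= v0.
rewrite -/w nth_cat size_nseq nth_nseq if_same subn_gt0.
have [xu|xu|->] := ltngtP x u.
- by case: x xu => [|x] //= xu; rewrite (_ : (x < u.-1)%N = true) //; lia.
- rewrite (leq_trans u0 (ltnW xu)) /= (_ : (x.-1 < u.-1)%N = false); last by lia.
  by rewrite (_ : (x.-1 - u.-1)%N = (x - u).-1.+1) //; lia.
- by rewrite u0 ?subnn !ltnn ?subnn.
Qed.

Lemma parts_pos (a : composition) : all (leq 1) (parts a).
Proof. by rewrite /parts; case: a => s /=; elim: s => //= x s ->; rewrite (valP x). Qed.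

Variable n : nat.
Implicit Types a b : compn n.

Definition word a : seq bool := descent_word (parts (val a)).

Lemma size_word a : size (word a) = n.-1.
Proof. by rewrite size_descent_word ?parts_pos //; exact: (congr1 predn (eqP (valP a))). Qed.

(** Positions are counted from 1; the guard keeps [x = 0] from reading the first letter through
    [0.-1 = 0]. *)
Definition descent a (x : nat) : bool := (0 < x)%N && nth false (word a) x.-1.

Lemma descent_lt a x : descent a x -> (0 < x < n)%N.
Proof.
case/andP=> x0 xn; rewrite x0 /=; case: ltnP => // nx.
by rewrite nth_default // size_word in xn; lia.
Qed.

Lemma in_D a (x : 'I_n.+1) : (x \in D a) = descent a x.
Proof. by rewrite inE /partial_sums /clen partial_sums_word ?parts_pos. Qed.

Lemma in_D_inord a k : (k <= n)%N -> ((inord k : 'I_n.+1) \in D a) = descent a k.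
Proof. by move=> kn; rewrite in_D inordK. Qed.

Lemma in_peaks a (k : 'I_n) :
  (lift ord0 k \in peaks a) = descent a k.+1 && ~~ ((k == 0%N :> nat) || descent a k).
Proof.
have kn := ltn_ord k; rewrite inE lift0 /= !in_D inordK ?lift0; last by rewrite ltnS ltnW.
case dk: (descent a k.+1); rewrite ?andbF ?andbT //=.
have /andP[_ ->] := descent_lt dk; rewrite andbT ltnS lt0n.
by case: eqP.
Qed.

Lemma peaks0 a : (ord0 \in peaks a) = false.
Proof. by rewrite inE. Qed.

Lemma in_DD a (k : 'I_n) : (lift ord0 k \in DD a) = descent a k.+1 (+) descent a k.
Proof.
have kn := ltn_ord k.
have sh : (lift ord0 k \in shift1 (D a)) = descent a k.
  rewrite inE; apply/existsP/idP => [[y /andP[yD]]|dk].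
    by rewrite lift0 eqSS => /eqP ->; rewrite -in_D.
  by exists (inord k); rewrite in_D_inord ?(ltnW kn) // dk lift0 eqSS inordK //; lia.
rewrite /DD /symdiff in_setU !in_setD sh in_D lift0.
by case: (descent a k.+1) (descent a k) => [] [].
Qed.

Lemma peaks_subset_DD a b : (peaks b \subset DD a) =
  [forall k : 'I_n, (descent b k.+1 && ~~ ((k == 0%N :> nat) || descent b k)) ==>
     (descent a k.+1 (+) descent a k)].
Proof.
apply/subsetP/forallP => [h k|h x].
  by apply/implyP; rewrite -in_peaks -in_DD; exact: h.
have [k ->|->] := unliftP ord0 x; last by rewrite peaks0.
by have /implyP := h k; rewrite -in_peaks -in_DD.
Qed.

Lemma card_peaks b : #|peaks b| =
  (\sum_(k < n) (descent b k.+1 && ~~ ((k == 0%N :> nat) || descent b k)))%N.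
Proof.
rewrite -sum1_card [in LHS]big_mkcond [in LHS]big_ord_recl peaks0 /= add0n; apply: eq_bigr => k _.
by rewrite in_peaks; case: (_ && _).
Qed.

Definition dset a (i : 'I_n.-1) : bool := (inord i.+1 : 'I_n.+1) \in D a.

Lemma dsetE a i : dset a i = descent a i.+1.
Proof. by rewrite /dset in_D_inord //; have := ltn_ord i; lia. Qed.

(** Each condition of [factor_descents] bears on a single bit, so the count is a product over the
    bits. Bit [k] must be the negation of [a] at [k + 1] if [k + 1] is a descent of [b], and equal
    [a] at [k] if [k > 0] is not one. At a peak both apply, and they are compatible exactly when [a]
    differs at [k] and [k + 1]. *)
Lemma factor_count_dset a b : factor_count (dset b) (dset a) =
  if peaks b \subset DD a then (if n == 0 then 1 else 2 ^ (#|peaks b| + 1))%N else 0%N.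
Proof.
pose F (k : 'I_n) : pred bool := fun v =>
  (descent b k.+1 ==> (v != descent a k.+1)) &&
  (~~ ((k == 0%N :> nat) || descent b k) ==> (v == descent a k)).
pose peak (k : 'I_n) := descent b k.+1 && ~~ ((k == 0%N :> nat) || descent b k).
pose free (k : 'I_n) := ~~ descent b k.+1 && ((k == 0%N :> nat) || descent b k).
have cardF k : #|F k| =
    if peak k then (descent a k.+1 (+) descent a k : nat) else (2 ^ free k)%N.
  rewrite -sum1_card big_mkcond big_bool /= /in_mem /= /F /peak /free.
  by case: (descent b k.+1) (_ || _) (descent a k.+1) (descent a k) => [] [] [] [].
have -> : factor_count (dset b) (dset a) = (\prod_k #|F k|)%N.
  have -> : (\prod_k #|F k|)%N = #|family F| by rewrite card_family foldrE big_map big_enum.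
  rewrite /factor_count.
  apply: eq_card => x; rewrite inE; apply/forallP/familyP => [h k|h i].
    apply/andP; split; apply/implyP.
      move=> dk; have /andP[_ kn] := descent_lt dk.
      have kn' : (k < n.-1)%N by lia.
      have := h (Ordinal kn'); rewrite /factor_descents !dsetE /= dk.
      rewrite (_ : lo _ = k); last exact/val_inj.
      by move=> /eqP ->; case: (x k).
    rewrite negb_or => /andP[k0 dk]; have kn := ltn_ord k.
    have kn' : (k.-1 < n.-1)%N by lia.
    have kE : k.-1.+1 = k by rewrite prednK // lt0n.
    have := h (Ordinal kn'); rewrite /factor_descents !dsetE /= kE (negPf dk).
    rewrite (_ : hi _ = k); last by apply/val_inj; rewrite /= kE.
    by rewrite eq_sym.
  rewrite /factor_descents !dsetE; case: ifP => di.
    have /andP[/implyP/(_ di)+ _] := h (lo i); rewrite /= eq_sym.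
    by case: (x _) (descent _ _) => [] [].
  by have /andP[_ /implyP] := h (hi i); rewrite /= di => /(_ isT); rewrite eq_sym.
rewrite peaks_subset_DD; case: forallP => [h|h].
  rewrite (eq_bigr (fun k => 2 ^ free k)%N) => [|k _]; last first.
    rewrite cardF; case pk: (peak k) => //.
    by have /implyP/(_ pk)-> := h k; rewrite /free; move: pk => /andP[-> _].
  rewrite -expn_sum; case: eqP => [n0|/eqP n0].
    by rewrite big1 // => k _; have := ltn_ord k; rewrite {2}n0.
  congr (2 ^ _)%N; rewrite card_peaks -/peak.
  (* The free bits outnumber the peaks by one: the two descent sums are shifts of each other, the
     position 0 counts as a descent in one of them, and [n] is never a descent in the other. *)
  have e : (\sum_k free k + \sum_(k < n) descent b k.+1 =
      \sum_k peak k + \sum_(k < n) ((k == 0%N :> nat) || descent b k))%N.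
    rewrite -!big_split; apply: eq_bigr => k _; rewrite /free /peak.
    by case: (descent b k.+1) (_ || _) => [] [].
  suff e' : (\sum_(k < n) ((k == 0%N :> nat) || descent b k) =
      1 + \sum_(k < n) descent b k.+1)%N.
    by apply/eqP; rewrite -(eqn_add2r (\sum_(k < n) descent b k.+1)%N) e e' addnA.
  have dn : descent b n = false by apply/negP => /descent_lt; rewrite ltnn andbF.
  case: (n) n0 (descent b) dn => // m _ d dm.
  by rewrite big_ord_recl /= [in RHS]big_ord_recr /= dm addn0.
have /existsP[k] : [exists k, ~~ (peak k ==> (descent a k.+1 (+) descent a k))].
  by rewrite -negb_forall; apply/negP => /forallP h'; apply: h.
rewrite negb_imply => /andP[pk /negPf ak].
by rewrite (bigD1 k) //= cardF pk ak.
Qed.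

End Words.

Section BitSequences.

Fixpoint words (k : nat) : seq (seq bool) :=
  if k is k'.+1 then map (cons true) (words k') ++ map (cons false) (words k')
  else [:: [::]].

Lemma mem_words k w : (w \in words k) = (size w == k).
Proof.
elim: k w => [|k IH] w; first by rewrite inE size_eq0.
rewrite /= mem_cat; apply/orP/idP => [[] /mapP[v]|].
- by rewrite IH => /eqP <- ->.
- by rewrite IH => /eqP <- ->.
case: w => [|[] w] //=; rewrite eqSS -IH => wk; [left|right]; exact: map_f.
Qed.

Lemma words_uniq k : uniq (words k).
Proof.
elim: k => //= k IH; rewrite cat_uniq !map_inj_uniq ?IH => [|u v [] //|u v [] //].
rewrite andbT /=; apply/hasPn => w /mapP[v _ ->]; apply/negP => /mapP[] //.
Qed.

Lemma big_wordsS (V : nmodType) k (G : seq bool -> V) :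
  \sum_(w <- words k.+1) G w =
  \sum_(w <- words k) (G (true :: w) + G (false :: w)).
Proof. by rewrite big_cat !big_map big_split. Qed.

Lemma big_words_cat (V : nmodType) k l (G : seq bool -> V) :
  \sum_(w <- words (k + l)) G w =
  \sum_(u <- words k) \sum_(v <- words l) G (u ++ v).
Proof.
elim: k G => [|k IH] G; first by rewrite big_seq1.
by rewrite addSn !big_wordsS IH; apply: eq_bigr => u _; rewrite big_split.
Qed.

(* The condition that the letters x select the descents s from w, as in
   factor_descents. *)
Fixpoint fits (s w x : seq bool) : bool :=
  match s, w, x with
  | [::], [::], [:: _] => true
  | a :: s', b :: w', c :: ((d :: _) as x') =>
      (a == if b then ~~ c else d) && fits s' w' x'
  | _, _, _ => false
  end.

(** The middle letter is the only one that sees both parts, through the last bit of [x1] and the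
    first bit of [x2]; this makes the counts multiplicative. *)
Lemma fits_cat a b s1 s2 w1 w2 x1 x2 : size w1 = size s1 -> size x1 = (size s1).+1 ->
  fits (s1 ++ a :: s2) (w1 ++ b :: w2) (x1 ++ x2) =
  [&& fits s1 w1 x1, (0 < size x2)%N, a == if b then ~~ last false x1 else head false x2
    & fits s2 w2 x2].
Proof.
elim: s1 w1 x1 => [|a1 s1 IH] [|b1 w1] [|c1 [|d1 x1]] //=.
  by move=> _ _; case: x2.
by move=> [sw] [sx]; rewrite -cat_cons IH //= ?sx // -!andbA.
Qed.

Lemma fits_nth s w x : size w = size s -> size x = (size s).+1 ->
  fits s w x = all (fun i => nth false s i ==
    if nth false w i then ~~ nth false x i else nth false x i.+1) (iota 0 (size s)).
Proof.
elim: s w x => [|a s IH] [|b w] [|c [|d x]] //= [sw] [sx].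
by rewrite IH //= ?sx // (iotaDl 1 0) all_map.
Qed.

Definition bits_seq n (x : {ffun 'I_n -> bool}) : seq bool := [seq x i | i <- enum 'I_n].

Lemma nth_bits_seq n (x : {ffun 'I_n -> bool}) (i : 'I_n) : nth false (bits_seq x) i = x i.
Proof. by rewrite (nth_map i) ?size_enum_ord // nth_ord_enum. Qed.

Lemma big_bits (V : nmodType) n (G : seq bool -> V) :
  \sum_(x : {ffun 'I_n -> bool}) G (bits_seq x) = \sum_(w <- words n) G w.
Proof.
rewrite -(big_map (@bits_seq n) xpredT G); apply: perm_big; apply: uniq_perm.
- rewrite map_inj_uniq ?index_enum_uniq // => x y xy; apply/ffunP => i.
  by rewrite -!nth_bits_seq xy.
- exact: words_uniq.
move=> w; rewrite mem_words; apply/mapP/eqP => [[x _ ->]|wn].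
  by rewrite size_map size_enum_ord.
exists [ffun i : 'I_n => nth false w i]; first exact: mem_index_enum.
apply: (@eq_from_nth _ false); first by rewrite size_map size_enum_ord.
move=> i; rewrite wn => lt_in; rewrite -[i]/(val (Ordinal lt_in)) nth_bits_seq.
by rewrite ffunE.
Qed.

End BitSequences.

Section CompositionWords.
Variable n : nat.
Implicit Types a b : compn n.

(** Inverse of [descent_word] when started at 1: [m] is the size already reached by the current
    part. *)
Fixpoint parts_of_word (m : nat) (w : seq bool) : seq nat :=
  match w with
  | [::] => [:: m]
  | false :: w' => parts_of_word m.+1 w'
  | true :: w' => m :: parts_of_word 1 w'
  end.

Lemma parts_of_word_nseq m k w :
  parts_of_word m (nseq k false ++ w) = parts_of_word (m + k) w.
Proof. by elim: k m => [|k IH] m; rewrite ?addn0 //= IH addSnnS. Qed.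

Lemma descent_wordK p : all (leq 1) p -> p != [::] -> parts_of_word 1 (descent_word p) = p.
Proof.
elim: p => //= u q IH /andP[u0 q0] _; rewrite parts_of_word_nseq add1n prednK //.
by case: q IH q0 => //= v q IH q0; rewrite IH.
Qed.

Lemma size_parts_of_word m w : size (parts_of_word m w) = (count id w).+1.
Proof. by elim: w m => [|[] w IH] m //=; rewrite IH. Qed.

Lemma descent_word_cons u q : q != [::] ->
  descent_word (u :: q) = nseq u.-1 false ++ true :: descent_word q.
Proof. by case: q. Qed.

Lemma parts_of_wordK m w : (0 < m)%N ->
  descent_word (parts_of_word m w) = nseq m.-1 false ++ w.
Proof.
elim: w m => [|[] w IH] m m0 //.
  by rewrite [parts_of_word _ _]/= descent_word_cons ?IH // -size_eq0 size_parts_of_word.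
rewrite [parts_of_word _ _]/= IH //=; case: m m0 => //= m _.
by elim: m => //= m ->.
Qed.

Lemma parts_of_word_pos m w : (0 < m)%N -> all (leq 1) (parts_of_word m w).
Proof. by elim: w m => [|[] w IH] m m0 /=; rewrite ?m0 ?IH. Qed.

Lemma sumn_parts_of_word m w : sumn (parts_of_word m w) = (m + size w)%N.
Proof. by elim: w m => [|[] w IH] m //=; rewrite IH ?addSn ?addnS. Qed.

(** Degree 0 is apart: the empty word of the empty composition would be read back as the composition
    (1). *)
Lemma parts_word a : (0 < n)%N -> parts (val a) = parts_of_word 1 (word a).
Proof.
move=> n0; rewrite descent_wordK ?parts_pos //.
by apply: contraTneq n0 => p0; have := eqP (valP a); rewrite /weight p0 /= => <-.
Qed.

Lemma clen_word a : (0 < n)%N -> clen a = (count id (word a)).+1.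
Proof. by move=> n0; rewrite /clen parts_word // size_parts_of_word. Qed.

Lemma word_inj : (0 < n)%N -> injective (@word n).
Proof.
move=> n0 a b ab; apply/val_inj; rewrite -[val a]seq_compK -[val b]seq_compK.
by rewrite !parts_word // ab.
Qed.

Lemma parts_seq_comp s : all (leq 1) s -> parts (seq_comp s) = s.
Proof.
rewrite /parts /seq_comp /=; elim: s => //= x s IH /andP[x0 /IH sE].
by case: insubP => [y _ yx|]; rewrite ?x0 //= yx sE.
Qed.

Lemma word_surj w : (0 < n)%N -> size w = n.-1 -> exists a : compn n, word a = w.
Proof.
move=> n0 wn; have wE : weight (seq_comp (parts_of_word 1 w)) == n.
  by rewrite /weight parts_seq_comp ?parts_of_word_pos // sumn_parts_of_word wn add1n prednK.
exists (Comp wE); rewrite /word /= parts_seq_comp ?parts_of_word_pos //.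
by rewrite parts_of_wordK.
Qed.

Lemma big_compn (V : nmodType) (G : seq bool -> V) : (0 < n)%N ->
  \sum_(a : compn n) G (word a) = \sum_(w <- words n.-1) G w.
Proof.
move=> n0; rewrite -(big_map (@word n) xpredT G); apply: perm_big; apply: uniq_perm.
- by rewrite map_inj_uniq ?index_enum_uniq //; exact: word_inj.
- exact: words_uniq.
move=> w; rewrite mem_words; apply/mapP/eqP => [[a _ ->]|/(word_surj n0)[a <-]].
  exact: size_word.
by exists a; first exact: mem_index_enum.
Qed.

Lemma all2_implb (v w : seq bool) : size v = size w ->
  all2 implb v w <-> (forall i, nth false v i -> nth false w i).
Proof.
elim: v w => [|b v IH] [|c w] //=.
move=> [sz]; split=> [/andP[/implyP bc /(IH _ sz) h]|h]; first by case.
apply/andP; split; first by apply/implyP; exact: (h 0%N).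
by apply/(IH _ sz) => i; exact: (h i.+1).
Qed.

Lemma D_subset_word a b : (D b \subset D a) = all2 implb (word b) (word a).
Proof.
apply/subsetP/idP => [h|/all2_implb h x].
  apply/all2_implb; rewrite ?size_word // => i bi.
  have di : descent b i.+1 by rewrite /descent.
  have /andP[_ lt_in] := descent_lt di.
  have := h (inord i.+1); rewrite !in_D_inord ?(ltnW lt_in) // => /(_ di).
  by case/andP.
by rewrite !in_D => /andP[x0 /h ax]; rewrite ?size_word // /descent x0 ax ?size_word.
Qed.

Lemma descent_word_cat p q : p != [::] -> q != [::] ->
  descent_word (p ++ q) = descent_word p ++ true :: descent_word q.
Proof.
move=> + q0; elim: p => //= u p IH _; case: p IH => [|v p] IH /=.
  by rewrite cats0; case: q q0 {IH}.
by rewrite -catA cat_cons -IH.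
Qed.

Lemma descent_word_rev p : descent_word (rev p) = rev (descent_word p).
Proof.
elim: p => //= u p IH; rewrite rev_cons -cats1.
case: p IH => [|v p] IH; first by rewrite /= !cats0 rev_nseq.
have r0 : rev (v :: p) != [::] by rewrite -size_eq0 size_rev.
rewrite descent_word_cat // IH rev_cat rev_nseq rev_cons -cats1 -catA /=.
by rewrite cats0.
Qed.

Lemma word_crev a : word (crev a) = rev (word a).
Proof. by rewrite /word /= /parts /= map_rev descent_word_rev. Qed.

Lemma dset_crev a i : dset (crev a) i = dset a (rev_ord i).
Proof.
rewrite !dsetE /descent /= word_crev nth_rev ?size_word ?ltn_ord //.
Qed.

Lemma crevK : involutive (@crev n).
Proof.
by move=> a; apply/val_inj; rewrite /crev /=; case: (val a) => s /=; rewrite revK.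
Qed.

End CompositionWords.

(** * Ribbons in NSym *)

Section Ribbons.
Variable K : fieldType.
Local Notation NSym := (NSym K).
Local Notation H := (H K).
Local Notation E := (E K).
Local Notation Q := (Q K).

Lemma H0 : H 0 = 1.
Proof. by rewrite /Defs.H insubF. Qed.

Definition Hword m w : NSym := \prod_(u <- parts_of_word m w) H u.

Lemma monomial_prod (a : composition) : << a >> = \prod_(u <- parts a) H u :> NSym.
Proof.
case: a => s; rewrite /parts /=; elim: s => [|x s IH].
  by rewrite big_nil -fmoneE.
rewrite big_cons -IH H_gen malgM_def fgmulUU mulr1.
by rewrite /mmul /= fmmulE.
Qed.

Lemma Hcomp_word n (a : compn n) : (0 < n)%N -> Hcomp K a = Hword 1 (word a).
Proof. by move=> n0; rewrite /Hcomp monomial_prod parts_word. Qed.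

(* The ribbon with descent word w whose first row is prolonged to the left
   by m - 1 boxes. *)
Fixpoint Rword (m : nat) (w : seq bool) : NSym :=
  match w with
  | [::] => H m
  | false :: w' => Rword m.+1 w'
  | true :: w' => H m * Rword 1 w' - Rword m.+1 w'
  end.

Lemma Rword_expand m w : Rword m w =
  \sum_(v <- words (size w) | all2 implb v w)
    (-1) ^+ (count id v + count id w) *: Hword m v.
Proof.
elim: w m => [|b w IH] m.
  by rewrite big_mkcond big_seq1 /= addn0 expr0 scale1r /Hword big_seq1.
rewrite [size _]/= big_mkcond big_wordsS; case: b.
  rewrite [Rword _ _]/= !IH [in RHS]big_split /= mulr_sumr -sumrN.
  congr (_ + _); rewrite big_mkcond; apply: eq_bigr => v _; case: (all2 _ _ _) => //.
    rewrite addnACA (exprD _ (1 + 1)) -[(1 + 1)%N]/2%N sqrrN expr1n mul1r.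
    by rewrite /Hword /= big_cons nsym_scalerAr.
  by rewrite add0n addnCA add1n exprS mulN1r scaleNr.
rewrite [Rword _ _]/= IH big_mkcond; apply: eq_bigr => v _.
by rewrite /= add0r.
Qed.

Lemma Rib_word n (a : compn n) : (0 < n)%N -> Rib K a = Rword 1 (word a).
Proof.
move=> n0; rewrite Rword_expand size_word [RHS]big_mkcond /Rib [LHS]big_mkcond /=.
pose G v := if all2 implb v (word a)
  then (-1) ^+ (count id v + count id (word a)) *: Hword 1 v else 0.
rewrite -[RHS](@big_compn n _ G n0); apply: eq_bigr => b _.
rewrite /G D_subset_word; case: (all2 _ _ _); last by [].
rewrite (Hcomp_word b n0) (clen_word b n0) (clen_word a n0) addSn addnS.
by rewrite !exprS !mulN1r opprK.
Qed.

(** The product rule for ribbons, glued end to end with or without a descent. The recursion defining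
    [Rword] is this rule when the first ribbon is a single row. *)
Lemma Rword_mul m s t :
  Rword m s * Rword 1 t = Rword m (s ++ true :: t) + Rword m (s ++ false :: t).
Proof.
elim: s m => [|[] s IH] m /=; first by rewrite subrK.
  by rewrite mulrBl -mulrA !IH mulrDr opprD addrACA.
exact: IH.
Qed.

Lemma Rword_nseq m k w : Rword m (nseq k false ++ w) = Rword (m + k) w.
Proof. by elim: k m => [|k IH] m; rewrite ?addn0 //= IH addSnnS. Qed.

Lemma H_Rword m : (0 < m)%N -> H m = Rword 1 (nseq m.-1 false).
Proof. by case: m => // m _; rewrite -[nseq _ _]cats0 Rword_nseq add1n. Qed.

(** The ribbon of the composition [(1, ..., 1, l + 1)] with [k] ones. *)
Definition hook k l : NSym := Rword 1 (nseq k true ++ nseq l false).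

Definition Eword k : NSym := if k is k'.+1 then Rword 1 (nseq k' true) else 1.

Lemma hook_mul k l : Rword 1 (nseq k true) * Rword 1 (nseq l false) =
  hook k.+1 l + hook k l.+1.
Proof.
rewrite Rword_mul /hook; congr (Rword _ _ + _).
by rewrite -(cat1s true) catA; congr (_ ++ _); elim: k => //= k ->.
Qed.

(** By [hook_mul] the product of a column and a row is a sum of two neighbouring hooks; the
    alternating sum telescopes, and the defining relation of [E] leaves a single column. *)
Lemma E_Eword n : E n = Eword n.
Proof.
elim/ltn_ind: n => -[|n] IH.
  by have := E_def K 0; rewrite big_ord1 /= subn0 H0 expr0 mul1r mulr1.
have part j : (j <= n)%N ->
    \sum_(i < j.+1) (-1) ^+ i * E i * H (n.+1 - i) = (-1) ^+ j * hook j (n - j).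
  elim: j => [|j IHj] jn.
    by rewrite big_ord1 expr0 !mul1r H_Rword // !subn0.
  rewrite big_ord_recr /= IHj ?(ltnW jn) // IH //= subSS.
  rewrite -mulrA (H_Rword (m := n - j)) ?subn_gt0 // hook_mul.
  rewrite subnS -[X in hook j X](_ : (n - j).-1.+1 = (n - j)%N); last first.
    by rewrite prednK // subn_gt0.
  by rewrite exprS mulN1r mulNr mulrDr opprD addrCA subrr addr0 mulNr.
have := E_def K n.+1; rewrite big_ord_recr /= part // subnn subnn H0 mulr1.
rewrite exprS mulN1r mulNr -mulrBr => /eqP.
rewrite -signr_odd mulr_sign; case: (odd n); rewrite ?oppr_eq0 subr_eq0 => /eqP <-;
by rewrite /hook cats0.
Qed.

(* Unfolding the recursion of E makes unification diverge. *)
Local Opaque Defs.E.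

Definition theta_word s : NSym :=
  \sum_(w <- words (size s)) \sum_(x <- words (size s).+1) Rword 1 w *+ fits s w x.

(** The part of [theta_word (nseq k false)] with first bit [c], behind a prefix [p] of letters
    already chosen. *)
Definition all_false_sum p k c : NSym :=
  \sum_(w <- words k) \sum_(x <- words k)
    Rword 1 (p ++ w) *+ fits (nseq k false) w (c :: x).

(** Without descents in [s], a letter true of [w] requires the bit at its left to be true, and a
    letter false forces the bit at its right to be false. *)
Lemma all_false_sumS p k c : all_false_sum p k.+1 c =
  (if c then all_false_sum (rcons p true) k true + all_false_sum (rcons p true) k false
   else 0) + all_false_sum (rcons p false) k false.
Proof.
rewrite /all_false_sum big_wordsS; case: c.
  rewrite -!big_split; apply: eq_bigr => w _ /=.
  rewrite !big_wordsS -!big_split; apply: eq_bigr => x _ /=.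
  by rewrite !cat_rcons mulr0n add0r.
rewrite add0r; apply: eq_bigr => w _.
rewrite !big_wordsS -!big_split; apply: eq_bigr => x _ /=.
by rewrite !cat_rcons !mulr0n !add0r.
Qed.

Lemma all_false_sum_false p k : all_false_sum p k false = Rword 1 (p ++ nseq k false).
Proof.
elim: k p => [|k IH] p; first by rewrite /all_false_sum !big_seq1.
by rewrite all_false_sumS add0r IH cat_rcons.
Qed.

(** Either a descent follows and the next bit is true, as in the induction hypothesis for [j + 1],
    or the next bit is false, which leaves two words whose ribbons sum to
    [E (j + 1) * H (k + 1)]. *)
Lemma all_false_sum_true j k : all_false_sum (nseq j true) k true =
  \sum_(i < k.+1) E (j.+1 + i) * H (k - i).
Proof.
elim: k j => [|k IH] j.
  by rewrite big_ord1 E_Eword H0 mulr1 addn0 /all_false_sum !big_seq1 /= cats0.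
have IH' : all_false_sum (rcons (nseq j true) true) k true =
    \sum_(i < k.+1) E (j.+2 + i) * H (k - i).
  by rewrite -IH; congr (all_false_sum _ k true); elim: j => //= j ->.
have eE : E j.+1 * H k.+1 = Rword 1 (rcons (nseq j true) true ++ nseq k false) +
    Rword 1 (rcons (nseq j true) false ++ nseq k false).
  by rewrite E_Eword (@H_Rword k.+1 isT) Rword_mul !cat_rcons.
rewrite all_false_sumS IH' !all_false_sum_false [RHS]big_ord_recl addn0 subn0 eE.
rewrite -[LHS]addrA [LHS]addrC; apply: congr1; apply: eq_bigr => i _.
by rewrite lift0 subSS addnS.
Qed.

(** First bit false gives the term [H (k + 1)] of [Q], first bit true all the others. *)
Lemma Q_theta_word k : Q k.+1 = theta_word (nseq k false).
Proof.
rewrite /Defs.Q big_ord_recl E_Eword mul1r subn0 H_Rword //=.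
rewrite -[nseq k false]/([::] ++ nseq k false) -all_false_sum_false.
rewrite (eq_bigr (fun i : 'I_k.+1 => E (1 + i) * H (k - i))) => [|i _]; last first.
  by [].
rewrite -(all_false_sum_true 0) /theta_word size_nseq addrC -big_split.
by apply: eq_bigr => w _ /=; rewrite big_wordsS big_split.
Qed.

(** This is the rule of [Rword_mul] again: for fixed [x1], [x2] and middle letter [b] of [w], the
    condition [ok] holds for exactly one middle letter [a] of [s], so each word arises once on the
    right. *)
Lemma theta_word_mul s t :
  theta_word s * theta_word t = theta_word (s ++ true :: t) + theta_word (s ++ false :: t).
Proof.
pose ok a b x1 x2 := a == if b then ~~ last false x1 else head false x2.
have split_word a : theta_word (s ++ a :: t) =
    \sum_(w1 <- words (size s)) \sum_(w2 <- words (size t))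
    \sum_(x1 <- words (size s).+1) \sum_(x2 <- words (size t).+1)
      (Rword 1 (w1 ++ true :: w2) *+ (fits s w1 x1 && fits t w2 x2 && ok a true x1 x2) +
       Rword 1 (w1 ++ false :: w2) *+ (fits s w1 x1 && fits t w2 x2 && ok a false x1 x2)).
  rewrite /theta_word size_cat [size (_ :: _)]/= big_words_cat.
  apply: eq_big_seq => w1; rewrite mem_words => /eqP sw1.
  rewrite big_wordsS; apply: eq_bigr => w2 _.
  rewrite -addSn !big_words_cat -big_split; apply: eq_big_seq => x1.
  rewrite mem_words => /eqP sx1; rewrite -big_split; apply: eq_big_seq => x2.
  rewrite mem_words => /eqP sx2; rewrite !fits_cat // sx2 /= /ok.
  by congr (_ *+ _ + _ *+ _); case: (fits s _ _) (fits t _ _) (_ == _) => [] [] [].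
rewrite !split_word -big_split /theta_word mulr_suml; apply: eq_bigr => w1 _.
rewrite mulr_sumr -big_split; apply: eq_bigr => w2 _.
rewrite -big_split mulr_suml; apply: eq_bigr => x1 _.
rewrite mulr_sumr -big_split; apply: eq_bigr => x2 _ /=.
rewrite mulrnAr mulrnAl -mulrnA Rword_mul /ok.
case: (fits s w1 x1); case: (fits t w2 x2) => //=; rewrite ?muln0 ?mulr0n ?addr0 // muln1 mulr1n.
case: (~~ _) (head _ _) => [] [] /=; rewrite ?mulr1n ?mulr0n ?addr0 ?add0r //.
by rewrite addrC.
Qed.

Lemma theta_Rword m s : (0 < m)%N -> theta (Rword m s) = theta_word (nseq m.-1 false ++ s).
Proof.
have thB u v : theta (u - v) = theta u - theta v :> NSym by rewrite /theta linearB.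
elim: s m => [|[] s IH] m m0 /=.
- case: m m0 => // m _; rewrite cats0 -Q_theta_word.
  exact: (theta_H K (Sub m.+1 isT : posnat)).
- rewrite thB thetaM IH // IH //=; case: m m0 => // m _.
  rewrite (theta_H K (Sub m.+1 isT : posnat)) Q_theta_word theta_word_mul /=.
  apply/eqP; rewrite subr_eq; apply/eqP; congr (_ + theta_word _).
  by elim: m => //= m ->.
- rewrite IH //=; case: m m0 => // m _; congr theta_word.
  by elim: m => //= m ->.
Qed.

Lemma sum_fits n (a b : compn n) : (0 < n)%N ->
  (\sum_(x <- words n) fits (word a) (word b) x)%N = factor_count (dset b) (dset a).
Proof.
move=> n0; rewrite -(@big_bits _ n (fun x => fits (word a) (word b) x : nat)).
rewrite /factor_count -sum1_card [in RHS]big_mkcond /=; apply: eq_bigr => x _.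
have szx : size (bits_seq x) = (size (word a)).+1.
  by rewrite size_map size_enum_ord size_word prednK.
rewrite inE (fits_nth _ szx) ?size_word //.
rewrite (_ : all _ _ = [forall i, dset a i == factor_descents (dset b) x i]).
  by case: [forall _, _].
apply/allP/forallP => [h i|h i].
  have := h (val i); rewrite mem_iota ltn_ord => /(_ isT).
  rewrite /factor_descents !dsetE /descent /=.
  by rewrite -(nth_bits_seq x (lo i)) -(nth_bits_seq x (hi i)).
rewrite mem_iota /= add0n => lt_in; have := h (Ordinal lt_in).
rewrite /factor_descents !dsetE /descent /=.
by rewrite -(nth_bits_seq x (lo _)) -(nth_bits_seq x (hi _)).
Qed.

Lemma compn0_eq (a b : compn 0) : a = b.
Proof.
have nil (c : compn 0) : parts (val c) = [::].
  have := eqP (valP c); have := parts_pos (val c); rewrite /weight.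
  by case: (parts _) => //= x s /andP[x0 _]; lia.
by apply/val_inj; rewrite -[val a]seq_compK -[val b]seq_compK !nil.
Qed.

Lemma theta1 : theta (1 : NSym) = 1.
Proof.
have e : 1 = << FMonom [::] >> :> NSym by rewrite -fmoneE.
by rewrite [in LHS]e /theta lextU /= big_nil.
Qed.

Lemma theta_Rib n (a : compn n) :
  theta (Rib K a) = \sum_(b : compn n) (factor_count (dset b) (dset a))%:R *: Rib K b.
Proof.
have [n0|n0] := posnP n; last first.
  rewrite Rib_word // theta_Rword //= /theta_word size_word prednK //.
  rewrite -(big_compn (fun w => \sum_(x <- words n) Rword 1 w *+ fits (word a) w x)) //.
  apply: eq_bigr => b _; rewrite -Rib_word // -(sum_fits _ _ n0).
  by rewrite sumrMnr scaler_nat.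
subst n; rewrite (big_pred1 a) => [|b]; last by rewrite (compn0_eq b a) /= eqxx.
have Rib1 : Rib K a = 1.
  rewrite /Rib (big_pred1 a) => [|b]; last by rewrite (compn0_eq b a) /= eqxx; exact: subxx.
  rewrite addnn -signr_odd odd_double expr0 scale1r /Hcomp monomial_prod.
  have := eqP (valP a); have := parts_pos (val a); rewrite /weight.
  case: (parts _) => //= [_ _|x s /andP[x0 _]]; first by rewrite big_nil.
  by lia.
rewrite factor_count_dset eqxx Rib1 (_ : peaks a = set0) ?sub0set; last first.
  by apply/setP => x; rewrite !inE; case: x => x /= _; lia.
by rewrite scale1r theta1.
Qed.

Lemma all2_implb_rev (v w : seq bool) : size v = size w ->
  all2 implb (rev v) (rev w) = all2 implb v w.
Proof. by move=> sz; rewrite !all2E !size_rev sz eqxx -rev_zip // all_rev. Qed.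

Lemma phibar_Rib n (a : compn n) : phibar (Rib K a) = Rib K (crev a).
Proof.
have clen_crev (c : compn n) : clen (crev c) = clen c.
  by rewrite /clen /parts /= !size_map size_rev.
rewrite /Rib /phibar linear_sum [RHS](reindex_inj (inv_inj (@crevK n))) /=.
apply: eq_big => [b|b _].
  by rewrite !D_subset_word !word_crev all2_implb_rev ?size_word.
by rewrite linearZ /= /Hcomp lextU !clen_crev.
Qed.

End Ribbons.

(** * Grothendieck groups *)

Section HeckeGroth.
Variable K : fieldType.

Lemma clsKhE n (Q : hpmod K n) : clsKh (hp_val Q) = cls (@Khecke_rel K) (Tagged (hpmod K) Q).
Proof.
rewrite /clsKh; case: pselect => [pQ|nQ]; last by case: nQ; exact: hp_proj.
congr (cls _ (Tagged _ _)).
by case: Q pQ => Q pQ pQ' /=; congr HPMod; exact: Prop_irrelevance.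
Qed.

Lemma hprojective_split n (B C : hmod K n) (g : 'M_(hdim C, hdim B)) :
  hprojective C -> hhom B C g -> surjective_mx g ->
  exists2 s, s \in hhoms C B & g *m s = 1%:M.
Proof.
move=> Cproj gP g_surj; have idP : hhom C C 1%:M by move=> i; rewrite mul1mx mulmx1.
by have [s /hhomsP sP gs] := Cproj B C g 1%:M gP g_surj idP; exists s.
Qed.

Lemma clsKh_ses n (A B C : hmod K n) (f : 'M_(hdim B, hdim A)) (g : 'M_(hdim C, hdim B)) :
  hprojective A -> hprojective B -> hprojective C ->
  hhom A B f -> hhom B C g -> short_exact f g -> clsKh B = clsKh A + clsKh C.
Proof.
move=> pA pB pC fP gP fg.
have h : lspan (@Khecke_rel K) (<< Tagged (hpmod K) (HPMod pB) >> -
    (<< Tagged (hpmod K) (HPMod pA) >> + << Tagged (hpmod K) (HPMod pC) >>)).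
  rewrite opprD addrA -[X in lspan _ X]addr0 -[X in lspan _ (X + _)]scale1r.
  by apply: lspanD (lspan0 _); apply: (@Khecke_ses K n (HPMod pA) (HPMod pB) (HPMod pC) f g).
have := (Defs.piP _ _ _).2 h; rewrite raddfD => e.
by rewrite -[A]/(hp_val (HPMod pA)) -[B]/(hp_val (HPMod pB)) -[C]/(hp_val (HPMod pC)) !clsKhE.
Qed.

Lemma glift_Khecke (W : lmodType K) (F : {n : nat & hpmod K n} -> W) :
  (forall n (A B C : hpmod K n) f g, hhom (hp_val A) (hp_val B) f ->
     hhom (hp_val B) (hp_val C) g -> short_exact f g ->
     F (Tagged (hpmod K) B) = F (Tagged (hpmod K) A) + F (Tagged (hpmod K) C)) ->
  linear (glift F : Khecke K -> W) /\ forall x, glift F (cls (@Khecke_rel K) x) = F x.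
Proof.
move=> FD; apply: glift_cls => u [n A B C f g fP gP fg].
by rewrite !linearB /= !lextU (FD _ _ _ _ _ _ fP gP fg) [F _ + _]addrC addrK subrr.
Qed.

(* The multiplicity of the one-dimensional module of H_n with descents l in
   the head of a projective module of H_n. *)
Definition head_mult (n : nat) (l : nat -> bool) (Q : {m : nat & hpmod K m}) : K^o :=
  if tag Q == n then
    (\dim (hhoms (hp_val (tagged Q)) (line K (fun i : 'I_(tag Q).-1 => l i))))%:R
  else 0.

Definition chi n l : Khecke K -> K^o := glift (head_mult n l).

(** Hom into a line is additive on these sequences because [C] is projective and the sequence
    splits. *)
Lemma chi_cls_linear n l : linear (chi n l) /\
  forall x, chi n l (cls (@Khecke_rel K) x) = head_mult n l x.
Proof.
apply: glift_Khecke => m A B C f g fP gP fg; rewrite /head_mult /=.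
case: eqP => [_|]; last by rewrite addr0.
rewrite -natrD; congr _%:R; rewrite addnC.
apply: (@dim_intertwiners_exactl K _ _ _ _ _ _ _ _ (hT (line K (fun i : 'I_m.-1 => l i)))
  f g ((hhomsP _).2 fP) ((hhomsP _).2 gP) fg).
by have [_ g_surj _] := fg; exact: hprojective_split (@hp_proj _ _ C) gP g_surj.
Qed.

HB.instance Definition _ n l := GRing.isLinear.Build K (Khecke K) K^o *:%R (chi n l)
  (chi_cls_linear n l).1.

Lemma chi_clsKh n l m (Q : hmod K m) : hprojective Q -> chi n l (clsKh Q) =
  if m == n then (\dim (hhoms Q (line K (fun i : 'I_m.-1 => l i))))%:R else 0.
Proof.
move=> pQ; rewrite -[Q]/(hp_val (HPMod pQ)) clsKhE.
exact: (chi_cls_linear n l).2.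
Qed.

Lemma htwist_projective n (Q : hmod K n) : hprojective Q -> hprojective (htwist Q).
Proof.
move=> pQ M N g f gP g_surj fP.
have tw (A B : hmod K n) h : hhom A B h -> hhom (htwist A) (htwist B) h by move=> hP i; exact: hP.
have fP' : hhom Q (htwist N) f by move=> i /=; have := fP (rev_ord i); rewrite /= rev_ordK.
have [h hP gh] := pQ _ _ _ _ (tw _ _ _ gP) g_surj fP'; exists h => // i /=.
by have := hP (rev_ord i); rewrite /= rev_ordK.
Qed.

Lemma Twist_cls_linear : linear (@Twist K) /\
  forall n (Q : hmod K n), hprojective Q -> Twist (clsKh Q) = clsKh (htwist Q).
Proof.
have [|h1 h2] := @glift_Khecke (Khecke K) (fun P => clsKh (htwist (hp_val (tagged P)))).
  move=> n A B C f g fP gP fg /=.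
  apply: (@clsKh_ses n (htwist (hp_val A)) (htwist (hp_val B)) (htwist (hp_val C)) f g) => //;
    by [apply: htwist_projective; exact: hp_proj | move=> i; exact: fP | move=> i; exact: gP].
split=> // n Q pQ; rewrite -[Q in LHS]/(hp_val (HPMod pQ)) clsKhE.
exact: h2.
Qed.

HB.instance Definition _ := GRing.isLinear.Build K (Khecke K) (Khecke K) *:%R (@Twist K)
  Twist_cls_linear.1.

Local Notation Ksrel := (@super_rel K (fun n => spmod K n) (@sp_val K)).
Local Notation Gsrel := (@super_rel K (fun n => smod K n) (fun n M => M)).

Lemma glift_super (X : nat -> choiceType) (U : forall n, X n -> smod K n)
    (W : lmodType K) (F : {n : nat & X n} -> W) :
  (forall n (A B C : X n) f g, shom false (U n A) (U n B) f ->
     shom false (U n B) (U n C) g -> short_exact f g ->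
     F (Tagged X B) = F (Tagged X A) + F (Tagged X C)) ->
  (forall n (A B : X n), U n B = parity_change (U n A) -> F (Tagged X B) = F (Tagged X A)) ->
  linear (glift F : groth (super_rel U) -> W) /\
  forall x, glift F (cls (super_rel U) x) = F x.
Proof.
move=> FD FP; apply: glift_cls => u [n A B C f g fP gP fg|n A B AB].
  by rewrite !linearB /= !lextU (FD _ _ _ _ _ _ fP gP fg) [F _ + _]addrC addrK subrr.
by rewrite linearB /= !lextU (FP _ _ _ AB) subrr.
Qed.

Lemma Res_cls_linear : linear (@Res K) /\
  forall n (P : spmod K n), Res (cls Ksrel (Tagged (spmod K) P)) = clsKh (res (sp_val P)).
Proof.
have [||h1 h2] := @glift_super (fun n => spmod K n) (@sp_val K) (Khecke K)
  (fun P => clsKh (res (sp_val (tagged P)))).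
- move=> n A B C f g [_ fP _] [_ gP _] fg /=.
  apply: (@clsKh_ses n (res (sp_val A)) (res (sp_val B)) (res (sp_val C)) f g) => //;
    by apply: res_projective; exact: sp_proj.
- by move=> n A B /= ->.
- by split=> // n P; exact: h2.
Qed.

HB.instance Definition _ := GRing.isLinear.Build K (Ksuper K) (Khecke K) *:%R (@Res K)
  Res_cls_linear.1.

Lemma hom_pairingE n (P : spmod K n) (M : smod K n) :
  hom_pairing (Tagged (spmod K) P) (Tagged (smod K) M) = (\dim (uhoms (sp_val P) M))%:R.
Proof.
rewrite /hom_pairing /=; case: eqVneq => [e|]; last by rewrite eqxx.
by rewrite (eq_irrelevance e erefl) /= hom_dimE.
Qed.

Lemma hom_pairing_neq n m (P : spmod K n) (M : smod K m) : m != n ->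
  hom_pairing (Tagged (spmod K) P) (Tagged (smod K) M) = 0.
Proof. by move=> /eqP mn; rewrite /hom_pairing /=; case: eqVneq => // e; case: (mn e). Qed.

(** [glift] has its meaning only once the relations are respected: in the second variable by
    projectivity, in the first by splitting, and for parity changes because they exchange even and
    odd homomorphisms. *)
Lemma pairing_cls n (P : spmod K n) m (M : smod K m) :
  pairing (cls Ksrel (Tagged (spmod K) P)) (clsG M) =
  hom_pairing (Tagged (spmod K) P) (Tagged (smod K) M).
Proof.
have inner (T : {n : nat & spmod K n}) m' (N : smod K m') :
    glift (hom_pairing T) (clsG N) = hom_pairing T (Tagged (smod K) N).
  case: T => k T.
  have [||_ h2] := @glift_super (fun n => smod K n) (fun n M => M) K^o (hom_pairing (existT _ k T)).
  - move=> j A B C f g fP gP fg; have [e|jk] := eqVneq j k; last first.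
      by rewrite !(hom_pairing_neq T _ jk) addr0.
    subst j; rewrite !hom_pairingE -natrD; congr _%:R.
    have [[_ fu] [_ gu]] := ((shom_uhoms _).1 fP, (shom_uhoms _).1 gP).
    apply: (dim_intertwiners_exactr fu gu fg) => u uP.
    have [_ g_surj _] := fg.
    exact: sprojective_lift (@sp_proj _ _ T) gP g_surj uP.
  - move=> j A B /= AB; have [e|jk] := eqVneq j k; last first.
      by rewrite !(hom_pairing_neq T _ jk).
    by subst j; rewrite !hom_pairingE AB -!hom_dimE hom_dim_parityr.
  - exact: h2.
rewrite /pairing.
have [||_ h2] := @glift_super (fun n => spmod K n) (@sp_val K) K^o
   (fun P => glift (hom_pairing P) (clsG M)).
- move=> j A B C f g fP gP fg; rewrite !inner; have [e|jm] := eqVneq m j; last first.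
    by rewrite !(hom_pairing_neq _ _ jm) addr0.
  subst j; rewrite !hom_pairingE -natrD; congr _%:R; rewrite addnC.
  have [[_ fu] [_ gu]] := ((shom_uhoms _).1 fP, (shom_uhoms _).1 gP).
  apply: (@dim_intertwiners_exactl K _ _ _ _ _ _ _ _ (sgen M) f g fu gu fg).
  have [_ g_surj _] := fg.
  have idP : 1%:M \in uhoms (sp_val C) (sp_val C).
    by apply/uhomsP; split=> x; rewrite mul1mx mulmx1.
  by have [s sP gs] := sprojective_lift (@sp_proj _ _ C) gP g_surj idP; exists s.
- move=> j A B AB; rewrite !inner; have [e|jm] := eqVneq m j; last first.
    by rewrite !(hom_pairing_neq _ _ jm).
  by subst j; rewrite !hom_pairingE AB -!hom_dimE hom_dim_parityl.
- by rewrite (h2 (Tagged (spmod K) P)) inner.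
Qed.

End HeckeGroth.

Section Spans.
Variable K : fieldType.

Lemma D_inj n : injective (@D n).
Proof.
move=> a b ab; have [n0|n0] := posnP n; first by subst n; exact: compn0_eq.
apply: (word_inj n0); apply: (@eq_from_nth _ false); first by rewrite !size_word.
move=> i; rewrite size_word => lt_in.
have e (c : compn n) : nth false (word c) i = ((inord i.+1 : 'I_n.+1) \in D c).
  by rewrite in_D_inord //; lia.
by rewrite !e ab.
Qed.

Lemma dset_inj n (a b : compn n) : dset a =1 dset b -> a = b.
Proof.
move=> ab; apply: D_inj; apply/setP => x; rewrite !in_D.
have [lt_xn|nx] := boolP (0 < x < n)%N.
  have hx : (x.-1 < n.-1)%N by lia.
  have e (c : compn n) : descent c x = dset c (Ordinal hx).
    by rewrite dsetE /= prednK //; case/andP: lt_xn.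
  by rewrite !e ab.
by case da: (descent a x); case db: (descent b x) => //;
  move: nx; rewrite ?(descent_lt da) ?(descent_lt db).
Qed.

(** The expansion of [R_a] in the [H_b] is unitriangular for coarsening, so the ribbons span; the
    induction is on the number of descents. *)
Lemma NSym_Rib_ind (P : NSym K -> Prop) : P 0 ->
  (forall c u v, P u -> P v -> P (c *: u + v)) ->
  (forall n (a : compn n), P (Rib K a)) -> forall h, P h.
Proof.
move=> P0 PD PR.
have PS I (r : seq I) (Q : pred I) (c : I -> K) (g : I -> NSym K) :
    (forall i, Q i -> P (g i)) -> P (\sum_(i <- r | Q i) c i *: g i).
  move=> Pg; elim: r => [|i r IH]; first by rewrite big_nil.
  by rewrite big_cons; case: ifP => // Qi; apply: PD => //; exact: Pg.
have PH n (a : compn n) : P (Hcomp K a).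
  have [k] := ubnP #|D a|; elim: k a => // k IH a; rewrite ltnS => ak.
  have RE : Hcomp K a = - (\sum_(b : compn n | (D b \subset D a) && (b != a))
      (-1) ^+ (clen b + clen a) *: Hcomp K b) + Rib K a.
    rewrite /Rib [X in _ + X](bigD1 a) //= [RHS]addrC addrK.
    by rewrite addnn -signr_odd odd_double expr0 scale1r.
  rewrite RE -scaleN1r; apply: PD => //; apply: PS => b /andP[ba b_a].
  apply: IH; apply: leq_trans ak; apply: proper_card; rewrite properEneq ba andbT.
  by apply: contraNneq b_a => /D_inj ->.
move=> h; rewrite [h]monalgE.
have -> : \sum_(k <- msupp h) << h@_k *g k >> = \sum_(k <- msupp h) h@_k *: << k >>.
  apply: eq_bigr => k _; apply/malgP => k'; rewrite mcoeffZ !mcoeffU mulrnAr mulr1.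
  by [].
by apply: PS => k _; exact: (PH (weight k) (Comp (eqxx (weight k)))).
Qed.

Lemma Theta_surj (F : Peak K) : exists h, F = Theta h.
Proof.
suff [h hE] : exists h, Peak_val F = theta h by exists h; apply: val_inj.
case: F => u /= /asboolP; elim=> [n| | |c v w _ [h ->] _ [h' ->]|v w _ [h ->] _ [h' ->]].
- case: n => [|n]; last by exists (H K n.+1); rewrite (theta_H K (Sub n.+1 isT : posnat)).
  exists 1; rewrite theta1 /Q big_ord1 subnn /E /= H0 mulr1.
  by [].
- by exists 1; rewrite theta1.
- by exists 0; rewrite /theta linear0.
- by exists (c *: h + h'); rewrite /theta linearP.
- by exists (h * h'); rewrite thetaM.
Qed.

End Spans.

(** * The peak algebra *)

Section LinearMaps.
Variable K : fieldType.

Lemma theta_linear : linear (@theta K).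
Proof. exact: linearP. Qed.
HB.instance Definition _ := GRing.isLinear.Build K (NSym K) (NSym K) *:%R (@theta K)
  theta_linear.

Lemma phibar_linear : linear (@phibar K).
Proof. exact: linearP. Qed.
HB.instance Definition _ := GRing.isLinear.Build K (NSym K) (NSym K) *:%R (@phibar K)
  phibar_linear.

Lemma Theta_linear : linear (@Theta K).
Proof. by move=> c u v; apply: val_inj; rewrite /= linearP. Qed.
HB.instance Definition _ := GRing.isLinear.Build K (NSym K) (Peak K) *:%R (@Theta K)
  Theta_linear.

Lemma linear_Rib_ext (V : lmodType K) (f g : {linear NSym K -> V}) :
  (forall n (a : compn n), f (Rib K a) = g (Rib K a)) -> forall h, f h = g h.
Proof.
move=> fg; apply: NSym_Rib_ind => [|c u v fu fv|//]; first by rewrite !linear0.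
by rewrite !linearP fu fv.
Qed.

Lemma Peak_valE (h : NSym K) : Peak_val (Theta h) = theta h.
Proof. by []. Qed.

End LinearMaps.

Definition peak_coef n (Q A : {set 'I_n.+1}) : nat :=
  if Q \subset A then (if n == 0 then 1 else 2 ^ (#|Q| + 1))%N else 0%N.

Section PeakAlgebra.
Variables (K : fieldType) (char0 : [pchar K] =i pred0).

Lemma theta_Rib_Xi n (a : compn n) :
  theta (Rib K a) = \sum_(Q : {set 'I_n.+1}) (peak_coef Q (DD a))%:R *: Xi K Q.
Proof.
rewrite theta_Rib (partition_big (@peaks n) xpredT) //=; apply: eq_bigr => Q _.
rewrite /Xi scaler_sumr; apply: eq_bigr => b /eqP <-.
by rewrite factor_count_dset.
Qed.

Lemma peaks_val n (c : compn n) x : x \in peaks c ->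
  exists2 k : 'I_n, x = lift ord0 k & (0 < k)%N && (k.+1 < n)%N.
Proof.
rewrite inE => /andP[/andP[x1 xn] _].
have xn' : (x.-1 < n)%N by lia.
exists (Ordinal xn') => /=; last by lia.
by apply/val_inj; rewrite /= /bump /=; lia.
Qed.

Lemma peak_set_peaks n (c : compn n) : peak_set (peaks c).
Proof.
apply/forall_inP => x; rewrite inE => /and3P[-> xD _] /=.
by rewrite inE negb_and (negPf xD) !andbF orbT.
Qed.

(** Membership in [DD a] is the change of the descent indicator from one position to the next, so
    any set of interior positions is realised by summing its indicator modulo 2. *)
Lemma exists_DD n (c : compn n) (Q : {set 'I_n.+1}) : exists a : compn n,
  forall k : 'I_n, (0 < k)%N && (k.+1 < n)%N -> (lift ord0 k \in DD a) = (lift ord0 k \in Q).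
Proof.
have [n0|n0] := posnP n; first by exists c => k; have := ltn_ord k; rewrite {2}n0.
(* [x] is to be a descent exactly when [Q] has an odd number of elements up to [x]. *)
pose cnt x := (\sum_(y < x.+1) ((inord y : 'I_n.+1) \in Q))%N.
have [a aE] := @word_surj n (mkseq (fun i => odd (cnt i.+1)) n.-1) n0 (size_mkseq _ _).
exists a => k /andP[k0 kn].
have dE x : (0 < x < n)%N -> descent a x = odd (cnt x).
  move=> /andP[x0 xn]; have hx : (x.-1 < n.-1)%N by lia.
  by rewrite /descent x0 /= aE nth_mkseq // prednK.
rewrite in_DD (dE k.+1) ?kn // (dE k) ?k0 ?(ltnW kn) //.
rewrite {1}/cnt big_ord_recr oddD /= -/(cnt k) addbC addbA addbb addFb.
rewrite (_ : inord _ = lift ord0 k) ?oddb //.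
by apply/ord_inj; rewrite inordK ?lift0 // ltnS ltnW.
Qed.

Lemma natr_neq0 m : (0 < m)%N -> m%:R != 0 :> K.
Proof.
move/prednK <-; have := (pcharf0P K).1 char0 m.-1.+1.
by move=> ->.
Qed.

Lemma Xi_eq0 n (Q : {set 'I_n.+1}) : ~~ [exists c : compn n, peaks c == Q] -> Xi K Q = 0.
Proof. by move/existsPn => nQ; rewrite /Xi big1 // => c cQ; have := nQ c; rewrite cQ. Qed.

(** With [DD a] equal to [Q] on the positions that can be peaks, [theta (Rib K a)] involves only the
    Xi of subsets of [Q], that of [Q] with a power of 2; induction on the size of [Q] removes the
    proper subsets. *)
Lemma Xi_in_Peak n (Q : {set 'I_n.+1}) : Xi K Q \in @in_Peakb K.
Proof.
have [k] := ubnP #|Q|; elim: k Q => // k IH Q; rewrite ltnS => Qk.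
have [/existsP[c /eqP cQ]|/Xi_eq0->] := boolP [exists c : compn n, peaks c == Q];
  last exact: rpred0.
have [a aE] := exists_DD c Q.
have QE d : (peaks d \subset DD a) = (peaks d \subset Q).
  apply/subsetP/subsetP => h x xd; have [l xl lP] := peaks_val xd;
    by have := h x xd; rewrite xl aE.
have := theta_in_Peak (Rib K a); rewrite theta_Rib_Xi (bigD1 Q) //=.
rewrite -[in_Peakb _]/(_ \in @in_Peakb K) rpredDr; last first.
  apply: rpred_sum => Q' Q'Q; have [/existsP[d /eqP dQ']|/Xi_eq0->] :=
    boolP [exists d : compn n, peaks d == Q']; last by rewrite scaler0 rpred0.
  rewrite /peak_coef -{1}dQ' QE dQ'; case: ifP => [sub|_]; last by rewrite scale0r rpred0.
  apply/rpredZ/IH; apply: leq_trans Qk; apply: proper_card.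
  by rewrite properEneq Q'Q sub.
rewrite /peak_coef -{1}cQ QE cQ subxx => h.
set m := (if _ then _ else _ : nat) in h.
have m0 : m%:R != 0 :> K by apply: natr_neq0; rewrite /m; case: ifP => // _; rewrite expn_gt0.
by rewrite -[Xi K Q]scale1r -(mulVf m0) -scalerA rpredZ.
Qed.

Definition xi n (Q : {set 'I_n.+1}) : Peak K := MkPeak (Xi_in_Peak Q).

Lemma Theta_Rib_xi n (a : compn n) :
  Theta (Rib K a) = \sum_(Q : {set 'I_n.+1}) (peak_coef Q (DD a))%:R *: xi Q.
Proof.
apply: val_inj; rewrite [RHS]linear_sum /= theta_Rib_Xi.
by [].
Qed.

End PeakAlgebra.

Lemma Tagged_neq (T : nat -> eqType) m n (a : T m) (b : T n) : m != n ->
  (Tagged T a == Tagged T b) = false.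
Proof. by move=> mn; apply/negP => /eqP /(congr1 tag) /= e; rewrite e eqxx in mn. Qed.

(** * Coordinates of classes of projective H_n-modules *)

Section ProjectiveClasses.
Variables (K : fieldType) (char0 : [pchar K] =i pred0).
Variables (P : forall n : nat, compn n -> hmod K n).
Hypothesis hP : forall (n : nat) (a : compn n), hproj_cover (P a) (Smod K a).
Variable Ch_star : {linear NSym K -> Khecke K}.
Hypothesis Ch_star_bij : bijective Ch_star.
Hypothesis Ch_star_R : forall (n : nat) (a : compn n), Ch_star (Rib K a) = clsKh (P a).

Definition chi_comp n (b : compn n) : Khecke K -> K^o := chi n (fun i => descent b i.+1).
HB.instance Definition _ n (b : compn n) := GRing.Linear.on (chi_comp b).

Lemma chi_comp_cls n (b : compn n) m (Q : hmod K m) : hprojective Q ->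
  chi_comp b (clsKh Q) =
  if m == n then (\dim (hhoms Q (line K (fun i : 'I_m.-1 => descent b i.+1))))%:R else 0.
Proof. exact: chi_clsKh. Qed.

Lemma chi_comp_P n (b : compn n) m (a : compn m) :
  chi_comp b (clsKh (P a)) = (Tagged compn a == Tagged compn b)%:R.
Proof.
rewrite chi_comp_cls; last by have [] := hP a.
have [mn|mn] := eqVneq m n; last first.
  by rewrite Tagged_neq.
subst m; rewrite (dim_hhoms_cover _ (hP a)) eq_Tagged /=; congr (_%:R).
congr (nat_of_bool _); apply/forallP/eqP => [h|-> i].
  by apply: dset_inj => i; rewrite [RHS]dsetE; apply/esym/eqP; exact: h.
by rewrite -/(dset b i) dsetE.
Qed.

Definition rib_comb (u : {malg K[{n : nat & compn n}]}) : NSym K :=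
  lext (fun s => Rib K (tagged s)) u.

Lemma rib_comb_surj h : exists u, h = rib_comb u.
Proof.
elim/(@NSym_Rib_ind K): h => [|c u v [u' ->] [v' ->]|n a].
- by exists 0; rewrite /rib_comb linear0.
- by exists (c *: u' + v'); rewrite /rib_comb linearP.
- by exists << Tagged compn a >>; rewrite /rib_comb lextU.
Qed.

Lemma chi_comp_rib_comb n (b : compn n) u :
  chi_comp b (Ch_star (rib_comb u)) = u@_(Tagged compn b).
Proof.
rewrite /rib_comb /lext !linear_sum /=.
under eq_bigr => s _ do rewrite !linearZ /= Ch_star_R chi_comp_P.
have [bu|bu] := boolP (Tagged compn b \in msupp u).
  rewrite (bigD1_seq (Tagged compn b)) ?fset_uniq //= ?eqxx.
  rewrite big1 ?addr0 => [|s /negPf sb]; first by rewrite /GRing.scale /= mulr1.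
  by case: s sb => m a /= ->; rewrite scaler0.
rewrite (mcoeff_outdom bu) big_seq big1 // => -[m a] au.
rewrite (_ : (_ == _) = false) ?scaler0 //; apply/negP => /eqP e.
by rewrite -e au in bu.
Qed.

Lemma chi_comp_separates h :
  (forall n (b : compn n), chi_comp b (Ch_star h) = 0) -> h = 0.
Proof.
have [u ->] := rib_comb_surj h => u0.
suff -> : u = 0 by rewrite /rib_comb linear0.
by apply/malgP => -[n b]; rewrite mcoeff0 -[RHS](u0 n b) chi_comp_rib_comb.
Qed.

(** Both sides have the same values under every [chi_comp]. As [Ch_star] is onto, their difference
    comes from NSym, where these functionals separate points. *)
Lemma clsKh_expand n (Q : hmod K n) : hprojective Q ->
  clsKh Q = \sum_(c : compn n) (\dim (hhoms Q (Smod K c)))%:R *: clsKh (P c).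
Proof.
move=> pQ; apply/eqP; rewrite -subr_eq0; set y := _ - _.
have [g _ gK] := Ch_star_bij; rewrite -(gK y).
suff -> : g y = 0 by rewrite linear0.
apply: chi_comp_separates => m b; rewrite gK /y linearB /= (linear_sum (chi_comp b)) /=.
rewrite chi_comp_cls //; have [nm|nm] := eqVneq n m; last first.
  rewrite big1 ?subr0 // => c _; rewrite linearZ /= chi_comp_P.
  by rewrite Tagged_neq ?scaler0 // eq_sym.
subst m; rewrite (bigD1 b) //= linearZ /= chi_comp_P eqxx big1 => [|c /negPf cb].
  rewrite addr0 /GRing.scale /= mulr1; apply/eqP; rewrite subr_eq0; apply/eqP.
  congr (\dim _)%:R; apply/vspaceP => f; apply/idP/idP => /intertwinersP h;
    apply/intertwinersP => i;
    by rewrite h /= -/(dset b i) dsetE.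
by rewrite linearZ /= chi_comp_P eq_Tagged /= cb scaler0.
Qed.

(** For a peak set [Q] this is also the pairing of Xi with [KP K (peaks b)], so [chi_comp b] stands
    in for the pairing with the class induced from [Smod K b]. *)
Lemma chi_comp_Xi n (b : compn n) m (Q : {set 'I_m.+1}) :
  chi_comp b (Ch_star (Xi K Q)) = (Tagged (fun k => {set 'I_k.+1}) Q ==
                                   Tagged (fun k => {set 'I_k.+1}) (peaks b))%:R.
Proof.
rewrite /Xi linear_sum (linear_sum (chi_comp b)) /=.
under eq_bigr => d _ do rewrite Ch_star_R chi_comp_P.
have [mn|mn] := eqVneq m n; last first.
  by rewrite Tagged_neq // big1 // => d _; rewrite Tagged_neq.
subst m; rewrite eq_Tagged /= big_mkcond /= (bigD1 b) //= eqxx big1 ?addr0 => [|d /negPf db].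
  by rewrite eq_sym; case: (Q == _).
by rewrite eq_Tagged /= db if_same.
Qed.

Lemma chi_comp_theta_Rib n (b : compn n) m (a : compn m) :
  chi_comp b (Ch_star (theta (Rib K a))) =
  \sum_(d : compn m) (factor_count (dset d) (dset a))%:R *
     (Tagged compn d == Tagged compn b)%:R.
Proof.
rewrite theta_Rib linear_sum (linear_sum (chi_comp b)) /=; apply: eq_bigr => d _.
by rewrite !linearZ /= Ch_star_R chi_comp_P.
Qed.

Lemma dim_hhoms_P n (a c : compn n) : \dim (hhoms (P a) (Smod K c)) = (a == c).
Proof.
rewrite [LHS](dim_hhoms_cover (dset c) (hP a)); congr (nat_of_bool _).
apply/forallP/eqP => [h|-> i]; last exact: eqxx.
by apply: dset_inj => i; have := h i; rewrite eq_sym => /eqP.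
Qed.

Lemma clsKh_htwist n (a : compn n) : clsKh (htwist (P a)) = clsKh (P (crev a)).
Proof.
have [pP _] := hP a; rewrite clsKh_expand; last exact: htwist_projective.
have mult c : \dim (hhoms (htwist (P a)) (Smod K c)) = (c == crev a).
  transitivity (\dim (hhoms (P a) (Smod K (crev c)))).
    congr (\dim _); apply/vspaceP => f; apply/idP/idP => /intertwinersP h; apply/intertwinersP => i.
      have := h (rev_ord i); rewrite /= rev_ordK => ->.
      by rewrite -/(dset c (rev_ord i)) -/(dset (crev c) i) dset_crev.
    have := h (rev_ord i); rewrite /= => ->.
    by rewrite -/(dset (crev c) (rev_ord i)) -/(dset c i) dset_crev rev_ordK.
  by rewrite dim_hhoms_P -(inj_eq (inv_inj (@crevK n))) crevK eq_sym.
rewrite (bigD1 (crev a)) //= big1 ?addr0 => [|c /negPf ca].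
  by rewrite mult eqxx scale1r.
by rewrite mult ca scale0r.
Qed.

Lemma Twist_phibar h : Twist (Ch_star (phibar h)) = Ch_star h.
Proof.
apply: (@linear_Rib_ext K _ (@Twist K \o Ch_star \o @phibar K) Ch_star) => n a /=.
rewrite phibar_Rib !Ch_star_R (Twist_cls_linear K).2; last by have [] := hP (crev a).
by rewrite clsKh_htwist crevK.
Qed.

End ProjectiveClasses.

(** [St] is given by its universal property alone, so it is compared with the explicit [Ind] through
    mutually inverse maps [g] and [h]; the rest is adjunction and [dim_hhoms_ind]. *)
Lemma dim_uhoms_induced_line (K : fieldType) n (P : hmod K n) (a b : compn n)
    (Pt St : smod K n) : hproj_cover P (Smod K a) ->
  induced P Pt -> induced (Smod K b) St ->
  \dim (uhoms Pt St) = factor_count (dset b) (dset a).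
Proof.
move=> cover /induced_uinduced[eta etaP] /induced_uinduced[eta' [e1 e2 ex uq]].
rewrite (dim_uhoms_induced _ etaP).
rewrite -(@dim_hhoms_ind K n _ (simple_rel K b) (dset b) (fun=> erefl) P a cover).
have [i1 i2 iex iuq] := Ind_uinduced (Smod K b).
have [g gP gE] := ex _ _ i1; have [h hP hE] := iex _ _ e1.
have idu (M : smod K n) : 1%:M \in uhoms M M by apply/uhomsP; split=> x; rewrite mul1mx mulmx1.
have gh : g *m h = 1%:M.
  apply/eqP; rewrite -subr_eq0; apply/eqP/iuq.
    by rewrite rpredB ?idu ?(intertwiners_mul hP gP).
  by rewrite mulmxBl mul1mx -mulmxA hE gE subrr.
have hg : h *m g = 1%:M.
  apply/eqP; rewrite -subr_eq0; apply/eqP/uq.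
    by rewrite rpredB ?idu ?(intertwiners_mul gP hP).
  by rewrite mulmxBl mul1mx -mulmxA gE hE subrr.
apply: (dim_bij (f := mulmx g)) => /=.
- by move=> u _ gu; rewrite -[u]mul1mx -hg -mulmxA gu mulmx0.
- by move=> u uP; exact: intertwiners_mul uP (uhoms_res gP).
- move=> v vP; exists (h *m v); last by rewrite mulmxA gh mul1mx.
  exact: intertwiners_mul vP (uhoms_res hP).
Qed.

(** Two adjunctions: Hom(Res Ind P, S_c) = Hom(Ind P, Coind S_c) = Hom(P, Res Coind S_c). The inner
    dual in [Coind] replaces [c] by [crev c], and the outer one reverses the descents of the
    factors, which amounts to reversing [a]. *)
Lemma dim_hhoms_res_induced (K : fieldType) n (P : hmod K n) (a c : compn n)
    (Pt : smod K n) : hproj_cover P (Smod K a) -> induced P Pt ->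
  \dim (hhoms (res Pt) (Smod K c)) = factor_count (dset (crev c)) (dset (crev a)).
Proof.
move=> cover /induced_uinduced[eta etaP].
rewrite -dim_uhoms_coind (dim_uhoms_induced _ etaP).
rewrite [LHS](@dim_hhoms_dual_ind K n _ (hdual_rel (Smod K c)) (dset (crev c)) _ P a cover).
  by congr (factor_count _ _); apply/funext => i; rewrite dset_crev.
by move=> i; rewrite tr_scalar_mx dset_crev.
Qed.

Theorem theorem4p1p3 (K : closedFieldType) (char0 : [pchar K] =i pred0)
    (P : forall n : nat, compn n -> hmod K n)
    (hP : forall (n : nat) (a : compn n), hproj_cover (P n a) (Smod K a))
    (St : forall n : nat, compn n -> smod K n)
    (hSt : forall (n : nat) (a : compn n), induced (Smod K a) (St n a))
    (Pt : forall n : nat, compn n -> smod K n)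
    (hPt : forall (n : nat) (a : compn n), induced (P n a) (Pt n a))
    (pr : Peak K -> PeakDual K -> K)
    (hpr : peak_pairing pr)
    (phi : Peak K -> Peak K)
    (hphi : forall h : NSym K, phi (Theta h) = Theta (phibar h))
    (Ch_star : {linear NSym K -> Khecke K})
    (Ch_star_bij : bijective Ch_star)
    (Ch_star_R : forall (n : nat) (a : compn n), Ch_star (Rib K a) = clsKh (P n a))
    (tCh : {linear Gsuper K -> PeakDual K})
    (tCh_bij : bijective tCh)
    (tCh_S : forall (n : nat) (a : compn n), PeakDual_val (tCh (clsG (St n a))) = KP K (peaks a))
    (tCh_star : {linear Peak K -> Ksuper K})
    (tCh_star_bij : bijective tCh_star)
    (tCh_star_adj : forall (F : Peak K) (n : nat) (M : smod K n),
       pr F (tCh (clsG M)) = pairing (tCh_star F) (clsG M)) :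
  [/\ forall F : Peak K,
        Res (tCh_star F) = Ch_star (phibar (Peak_val (phi F))),
      forall F : Peak K,
        Twist (Res (tCh_star F)) = Ch_star (Peak_val (phi F)) &
      forall (n : nat) (a : compn n), (0 < n)%N ->
        clsKh (res (Pt n a)) =
          \sum_(b : compn n | peaks b \subset DD (crev a))
            2%:R ^+ (#|peaks b| + 1) *: clsKh (P n (crev b))].
Proof.
have Ptproj n a : sprojective (Pt n a).
  have [eta etaP] := induced_uinduced (hPt n a).
  by apply: sprojective_induced etaP; have [] := hP n a.
pose Pts n a := SPMod (Ptproj n a).
have resE n a : clsKh (res (Pt n a)) =
    \sum_(b : compn n) (factor_count (dset b) (dset (crev a)))%:R *: clsKh (P n (crev b)).
  rewrite (clsKh_expand hP Ch_star_bij Ch_star_R); last exact: res_projective.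
  rewrite (reindex_inj (inv_inj (@crevK n))) /=; apply: eq_bigr => b _.
  by rewrite (dim_hhoms_res_induced _ (hP n a) (hPt n a)) crevK.
(* Both sides are linear in [F], so it suffices to take [F = Theta (Rib K a)], expanded in the
   Xi. *)
have chi_pr F n (b : compn n) :
    pr F (tCh (clsG (St n b))) = chi_comp b (Ch_star (Peak_val F)).
  have [_ prl prX] := hpr; set y := tCh _.
  pose prL : {linear Peak K -> K^o} := HB.pack (pr^~ y)
    (GRing.isLinear.Build K (Peak K) K^o *:%R (pr^~ y) (prl y)).
  rewrite -[LHS]/(prL F).
  have [h ->] := Theta_surj F; elim/(@NSym_Rib_ind K): h => [|c u v IHu IHv|m a].
  - by rewrite Peak_valE !linear0.
  - move: IHu IHv; rewrite !Peak_valE !linearP => -> ->.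
    by [].
  rewrite Peak_valE theta_Rib_Xi (Theta_Rib_xi char0).
  rewrite (linear_sum prL) (linear_sum Ch_star) (linear_sum (chi_comp b)).
  apply: eq_bigr => Q _; rewrite !linearZ /= (chi_comp_Xi hP Ch_star_R).
  apply: (congr1 (fun z : K^o => _ *: z)).
  (* [hpr] speaks of peak sets only; a set that is no [peaks c] has Xi equal to 0. *)
  have [/existsP[c /eqP cQ]|nQ] := boolP [exists c : compn m, peaks c == Q].
    apply: prX => //; last exact: tCh_S.
      by rewrite -cQ peak_set_peaks.
    exact: peak_set_peaks.
  have xi0 : xi char0 Q = 0 by apply: val_inj; rewrite /= Xi_eq0.
  rewrite xi0 -(chi_comp_Xi hP Ch_star_R) Xi_eq0 // !linear0.
  exact: (linear0 prL).
(* The class is pulled back along [tCh_star] to some [F], which is compared with [Theta (Rib K a)]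
   inside NSym by the functionals [chi_comp b]; by [chi_pr] and adjointness their values on [F] are
   dimensions of Hom. *)
have PtE n a : tCh_star (Theta (Rib K a)) =
    cls (@super_rel K (fun n => spmod K n) (@sp_val K)) (Tagged (spmod K) (Pts n a)).
  have [g _ gK] := tCh_star_bij; rewrite -[RHS]gK; congr (tCh_star _).
  set F := g _; apply/esym/val_inj/eqP; rewrite -subr_eq0; apply/eqP.
  apply: (chi_comp_separates hP Ch_star_R) => m b.
  rewrite !linearB /= -chi_pr tCh_star_adj gK pairing_cls (chi_comp_theta_Rib hP Ch_star_R).
  apply/eqP; rewrite subr_eq0; apply/eqP; have [mn|mn] := eqVneq m n; last first.
    rewrite hom_pairing_neq // big1 // => d _.
    by rewrite Tagged_neq ?mulr0 // eq_sym.
  subst m; rewrite hom_pairingE (dim_uhoms_induced_line (hP n a) (hPt n a) (hSt n b)).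
  rewrite (bigD1 b) //= eqxx mulr1 big1 ?addr0 // => d /negPf db.
  by rewrite eq_Tagged /= db mulr0.
have ResE n (a : compn n) : Res (tCh_star (Theta (Rib K a))) =
    \sum_(b : compn n) (factor_count (dset b) (dset (crev a)))%:R *: clsKh (P n (crev b)).
  by rewrite PtE (Res_cls_linear K).2 /= resE.
have phiE n (a : compn n) : Peak_val (phi (Theta (Rib K a))) =
    \sum_(b : compn n) (factor_count (dset b) (dset (crev a)))%:R *: Rib K b.
  by rewrite hphi /= phibar_Rib theta_Rib.
(* [phi] is a bare function, reached through [hphi]; with [theta \o phibar] in its place both sides
   are linear maps on NSym and are compared on ribbons. *)
pose f1 : {linear NSym K -> Khecke K} := @Res K \o tCh_star \o @Theta K.
pose f2 : {linear NSym K -> Khecke K} := Ch_star \o @phibar K \o @theta K \o @phibar K.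
have part1 F : Res (tCh_star F) = Ch_star (phibar (Peak_val (phi F))).
  have [h ->] := Theta_surj F; rewrite hphi.
  apply: (@linear_Rib_ext K _ f1 f2) => n a.
  rewrite /f2 /= -[theta _]/(Peak_val (Theta (phibar (Rib K a)))) -hphi phiE.
  rewrite [RHS]/= (linear_sum (@phibar K)) (linear_sum Ch_star) [LHS]ResE.
  by apply: eq_bigr => b _; rewrite !linearZ /= phibar_Rib Ch_star_R.
split=> //; first by move=> F; rewrite part1 (Twist_phibar hP Ch_star_bij Ch_star_R).
move=> n a n0; rewrite resE [RHS]big_mkcond /=; apply: eq_bigr => b _.
(* [n0] excludes degree 0, where the coefficient is 1. *)
rewrite factor_count_dset gtn_eqF //; case: ifP => _; last by rewrite scale0r.
by rewrite natrX.
Qed.
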